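(* Let $(\mathcal M,g)$ be an oriented and time-oriented Lorentzian spacetime, let $\mathcal S=(\mathscr H_{\mathcal S},V)$ be a system carrying a representation $V$ of $\mathrm{Poin}(\mathcal M,g)$, let $\mathcal R=(U,\mathsf E_{\mathcal R},\mathscr H_{\mathcal R})$ be a general relativistic quantum reference frame, $\phi\in\mathcal A(\mathscr H_{\mathcal S})$ and $\omega=(\omega_x)\in\mathscr S(\mathscr H_{\mathcal R})$. Then for all bisections $b\in\mathrm{Bis}(\mathrm{Poin}(\mathcal M,g))$, $$\mathbf V_b\,\hat\Phi^{\mathcal R}(\omega)\,\mathbf V_b^\dagger=\hat\Phi^{\mathcal R}(\omega^b),\qquad\text{where}\quad \omega^b=\left(\omega^b_x=U_{b(\varphi_b^{-1}(x))}\,\omega_{\varphi_b^{-1}(x)}\,U_{b(\varphi_b^{-1}(x))}^\dagger\right).$$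
   Context: **Poincaré groupoid.** $\Gamma:=\mathrm{Poin}(\mathcal M,g)\rightrightarrows\mathcal M$ is the Lie groupoid whose arrows $x\to y$ are orientation- and time-orientation-preserving linear isometries $T_x\mathcal M\to T_y\mathcal M$, with composition of maps; $s,t$ source/target; $\Gamma^x=t^{-1}(x)$; $L_\alpha:\Gamma^{s(\alpha)}\to\Gamma^{t(\alpha)}$, $L_\alpha\beta=\alpha\circ\beta$. $\mu_g$ is the volume measure. A bisection is a smooth section $b$ of $s$ with $\varphi_b:=t\circ b\in\mathrm{Diff}(\mathcal M)$. **Fields.** Hilbert spaces are complex separable. For a continuous field $\mathscr H=\bigsqcup_x\mathcal H^x$ over $\mathcal M$: $\mathcal A(\mathscr H)=\int_{\mathcal M}^\oplus\mathcal B(\mathcal H^x)d\mu_g(x)$ (essentially bounded measurable operator fields mod a.e. equality), acting on $\int^\oplus_{\mathcal M}\mathcal H^xd\mu_g(x)$; $\mathscr S(\mathscr H)$: fields in $\mathcal A(\mathscr H)$ that are density operators a.e. A unitary representation of $\Gamma$: measurable assignment of unitaries $U_\alpha:\mathcal H^{s(\alpha)}\to\mathcal H^{t(\alpha)}$ with $U_{\alpha\circ\beta}=U_\alpha U_\beta$, $U_{1_x}=\mathbb 1$; fibre-wise ultraweakly continuous if $\alpha\mapsto\mathrm{Tr}[U_\alpha\chi_\alpha]$ is continuous for every field $\chi_\alpha\in\mathcal T(\mathcal H^{t(\alpha)},\mathcal H^{s(\alpha)})$ that is locally a trace-norm uniform limit of finite-rank fields $\sum_j|\xi^j_{s(\alpha)}\rangle\langle\eta^j_{t(\alpha)}|$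 with $\xi^j,\eta^j$ continuous sections. A system $(\mathscr H_{\mathcal S},V)$: a continuous field with such a representation $V$ of $\Gamma$. For a bisection $b$, $\mathbf V_b$ is the unitary on $\int^\oplus\mathcal H^x_{\mathcal S}d\mu_g$ given by $(\mathbf V_b\Psi)_x=\big(\tfrac{d((\varphi_b)_*\mu_g)}{d\mu_g}(x)\big)^{1/2}V_{b(\varphi_b^{-1}(x))}\Psi(\varphi_b^{-1}(x))$. **Frames.** A general relativistic quantum reference frame $\mathcal R=(U,\mathsf E_{\mathcal R},\mathscr H_{\mathcal R})$: a continuous field $\mathscr H_{\mathcal R}$ with a fibre-wise ultraweakly continuous unitary representation $U$ of $\Gamma$ and normalized POVMs $\mathsf E^x_{\mathcal R}:\mathrm{Bor}(\Gamma^x)\to\mathcal E(\mathcal H^x_{\mathcal R})$, measurable ($x\mapsto\mathsf E^x_{\mathcal R}(\Delta\cap\Gamma^x)$ measurable for all $\Delta\in\mathrm{Bor}(\Gamma)$), covariant ($U_\alpha\mathsf E^{s(\alpha)}_{\mathcal R}(\Delta)U_\alpha^\dagger=\mathsf E^{t(\alpha)}_{\mathcal R}(L_\alpha\Delta)$), and $\mu_g$-admissible (for $\mu_g$-a.e. $x$: $\mu_g(N)=0\Rightarrow\mathsf E^x_{\mathcal R}(s^{-1}(N)\cap\Gamma^x)=0$). **Relational quantum field** of $\phi=(\phi_x)\in\mathcal A(\mathscr H_{\mathcal S})$: $\hat\Phi^{\mathcal R}:\mathscr S(\mathscr H_{\mathcal R})\to\mathcal A(\mathscr H_{\mathcal S})$,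 $\hat\Phi^{\mathcal R}(\omega)=\int^\oplus_{\mathcal M}\hat\Phi^{\mathcal R}_x(\omega)d\mu_g(x)$ with $\hat\Phi^{\mathcal R}_x(\omega)=\int_{\Gamma^x}V_\beta\phi_{s(\beta)}V_\beta^\dagger\,d\mu^{\mathsf E^x_{\mathcal R}}_{\omega_x}(\beta)$ (ultraweak integral), $\mu^{\mathsf E^x_{\mathcal R}}_{\omega_x}(\Delta)=\mathrm{Tr}[\omega_x\mathsf E^x_{\mathcal R}(\Delta)]$. *)

(* Defs.v *)
From HB Require Import structures.
From mathcomp Require Import all_boot all_order all_algebra.
From mathcomp Require Import complex.
From mathcomp Require Import all_classical all_reals all_analysis.

Set Implicit Arguments.
Unset Strict Implicit.
Unset Printing Implicit Defensive.

Import Order.TTheory GRing.Theory Num.Theory.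
Import numFieldNormedType.Exports.

Local Open Scope classical_set_scope.
Local Open Scope ring_scope.


Section smooth.
Context {R : realType} {V W : normedModType R}.

(* C^(k+1) on an open set U: (Frechet) differentiable there, with all
   directional derivatives of class C^k. *)
Fixpoint Ck_on (k : nat) (U : set V) (f : V -> W) : Prop :=
  if k is k'.+1 then
    (forall x, U x -> differentiable f x) /\
    (forall v, Ck_on k' U (fun x => 'D_v f x))
  else forall x, U x -> {for x, continuous f}.

Definition smooth_on (U : set V) (f : V -> W) := forall k, Ck_on k U f.

End smooth.

(* A smooth orientation is encoded by the atlas: all changes of charts have
   positive Jacobian determinant.  [param c] is the inverse of [coord c] on the
   image of the domain of [c], and is irrelevant elsewhere. *)
Record oriented_manifold (R : realType) (n : nat) (M : ptopologicalType) := {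
  chart : Type;
  dom : chart -> set M;
  coord : chart -> M -> 'rV[R]_n;
  param : chart -> 'rV[R]_n -> M;
  manifold_hausdorff : hausdorff_space M;
  manifold_second_countable : @second_countable M;
  dom_open : forall c, open (dom c);
  dom_cover : forall x, exists c, dom c x;
  coord_open : forall c, open (coord c @` dom c);
  coordK : forall c x, dom c x -> param c (coord c x) = x;
  coord_continuous : forall c x, dom c x -> {for x, continuous (coord c)};
  param_continuous : forall c x, dom c x ->
    {for coord c x, continuous (param c)};
  change_smooth : forall c c',
    smooth_on (coord c @` (dom c `&` dom c')) (coord c' \o param c);
  change_oriented : forall c c' x, dom c x -> dom c' x ->
    0 < \det (jacobian (coord c' \o param c) (coord c x)) }.

Lemma jacobian_chain (R : realType) (n : nat) (f g h : 'rV[R]_n -> 'rV[R]_n)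
    (p : 'rV[R]_n) :
  {near p, h =1 g \o f} -> differentiable f p -> differentiable g (f p) ->
  differentiable h p -> jacobian h p = jacobian f p *m jacobian g (f p).
Proof.
move=> hE df dg dh.
suff H (v : 'rV[R]_n) : v *m jacobian h p = v *m jacobian f p *m jacobian g (f p).
  apply/row_matrixP => i; rewrite [LHS]rowE [RHS]rowE H.
  by rewrite -mulmxA.
have dgf : differentiable (g \o f) p := differentiable_comp df dg.
have e1 : v *m jacobian h p = 'D_v h p := esym (deriveEjacobian v dh).
have e2 : v *m jacobian f p = 'd f p v := mul_rV_lin1 ('d f p) v.
have e3 : 'd f p v *m jacobian g (f p) = 'd g (f p) ('d f p v)
  := mul_rV_lin1 ('d g (f p)) ('d f p v).
have e4 : 'D_v h p = 'D_v (g \o f) p := near_eq_derive v hE.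
have e5 : 'D_v (g \o f) p = 'd (g \o f) p v := deriveE v dgf.
have e6 : 'd (g \o f) p v = 'd g (f p) ('d f p v) :=
  congr1 (fun F : 'rV[R]_n -> 'rV[R]_n => F v) (diff_comp df dg).
exact: etrans e1 (etrans e4 (etrans e5 (etrans e6 (etrans (esym e3)
  (congr1 (mulmx^~ (jacobian g (f p))) (esym e2)))))).
Qed.

Section tangent.
Context {R : realType} {n : nat} {M : ptopologicalType}.
Variable A : oriented_manifold R n M.

(* Jacobian matrix at x of the change from c-coordinates to c'-coordinates,
   acting on row vectors. *)
Definition jac (c c' : chart A) (x : M) : 'M[R]_n :=
  jacobian (coord c' \o param c) (coord c x).

Lemma jac_comp c c1 c2 x : dom c x -> dom c1 x -> dom c2 x ->
  jac c c2 x = jac c c1 x *m jac c1 c2 x.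
Proof.
move=> cx c1x c2x; rewrite /jac.
have Ef : (coord c1 \o param c) (coord c x) = coord c1 x.
  exact: (congr1 (coord c1) (coordK cx)).
have := @jacobian_chain R n (coord c1 \o param c) (coord c2 \o param c1)
  (coord c2 \o param c) (coord c x).
rewrite Ef; apply.
- have Uo : nbhs (param c (coord c x)) (dom c1).
    rewrite (coordK cx); apply: open_nbhs_nbhs; split; last exact: c1x.
    exact: dom_open.
  have Un : nbhs (coord c x) (param c @^-1` dom c1) := param_continuous cx Uo.
  apply: filterS Un => u c1u.
  exact: (congr1 (coord c2) (esym (coordK c1u))).
- by apply: (change_smooth c c1 1).1; exists x.
- by apply: (change_smooth c1 c2 1).1; exists x.
- by apply: (change_smooth c c2 1).1; exists x.
Qed.

(* A tangent vector at x is a family of components, one row vector for each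
   chart around x, transforming with the Jacobians of the changes of charts
   (and, as a normalisation, null for the other charts). *)
Definition tangent_pred (x : M) : {pred (chart A -> 'rV[R]_n)} := fun v =>
  `[< (forall c, ~ dom c x -> v c = 0) /\
      (forall c c', dom c x -> dom c' x -> v c' = v c *m jac c c' x) >].

Lemma tangent_submod x : submod_closed (tangent_pred x).
Proof.
split; first by apply/asboolP; split=> // c c' _ _; rewrite /= mul0mx.
move=> a u v /asboolP[u0 uJ] /asboolP[v0 vJ]; apply/asboolP.
split=> [c cx|c c' cx c'x].
  by rewrite !fctE u0// v0// scaler0 addr0.
by rewrite !fctE (uJ c c')// (vJ c c')// mulmxDl scalemxAl.
Qed.

HB.instance Definition _ x :=
  GRing.isSubmodClosed.Build R (chart A -> 'rV[R]_n) (tangent_pred x)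
    (tangent_submod x).

Record tangent (x : M) := Tangent {
  tval :> chart A -> 'rV[R]_n;
  tvalP : tval \in tangent_pred x }.

HB.instance Definition _ x := [isSub for @tval x].
HB.instance Definition _ x := [Choice of tangent x by <:].
HB.instance Definition _ x := [SubChoice_isSubLmodule of tangent x by <:].

Definition tvec_fun (c : chart A) (x : M) (u : 'rV[R]_n) : chart A -> 'rV[R]_n :=
  fun c' => if `[< dom c x /\ dom c' x >] then u *m jac c c' x else 0.

Lemma tvec_subproof c x u : tvec_fun c x u \in tangent_pred x.
Proof.
apply/asboolP; split=> [c' nc'|c1 c2 c1x c2x]; rewrite /tvec_fun.
  by case: asboolP => // -[].
case: (asboolP (dom c x /\ dom c2 x)) => [[cx _]|nc2]; last first.
  case: (asboolP (dom c x /\ dom c1 x)) => [[cx _]|_]; last by rewrite mul0mx.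
  by case: nc2.
case: (asboolP (dom c x /\ dom c1 x)) => [_|nc1]; last by case: nc1.
exact: etrans (congr1 (mulmx u) (jac_comp cx c1x c2x)) (mulmxA _ _ _).
Qed.

(* the tangent vector at x whose components in the chart c are u *)
Definition tvec c x u : tangent x := Tangent (tvec_subproof c x u).

Definition partial (c : chart A) (x : M) (i : 'I_n) : tangent x :=
  tvec c x (delta_mx 0 i).

Definition oriented_frame (x : M) (e : 'I_n -> tangent x) :=
  forall c, dom c x -> 0 < \det (\matrix_(i, j) e i c 0 j).

Definition smooth_map (f : M -> M) :=
  continuous f /\ forall c c' : chart A,
    smooth_on (coord c @` (dom c `&` f @^-1` dom c'))
              (coord c' \o f \o param c).

End tangent.


(* Signature (-,+,...,+).  The time orientation is represented by a smooth
   timelike vector field, future-directed by convention. *)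
Record spacetime (R : realType) (n : nat) (M : ptopologicalType)
    (A : oriented_manifold R n M) := {
  metric : forall x, tangent A x -> tangent A x -> R;
  metric_linear : forall x a (u v w : tangent A x),
    metric (a *: u + v) w = a * metric u w + metric v w;
  metric_sym : forall x (u v : tangent A x), metric u v = metric v u;
  metric_lorentzian : forall x, exists e : 'I_n -> tangent A x, forall i j,
    metric (e i) (e j) = if i == j then (if val i == 0%N then -1 else 1) else 0;
  metric_smooth : forall c i j, smooth_on (coord c @` dom c)
    (fun u => metric (partial c (param c u) i) (partial c (param c u) j));
  time_field : forall x, tangent A x;
  time_field_timelike : forall x, metric (time_field x) (time_field x) < 0;
  time_field_smooth : forall c, smooth_on (coord c @` dom c)
    (fun u => time_field (param c u) c) }.

(* Lebesgue integral over R^n, as an iterated integral; it is meant for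
   nonnegative Borel functions (Tonelli). *)
Fixpoint integral_rV (R : realType) (n : nat) :
    ('rV[R]_n -> \bar R) -> \bar R :=
  if n is n'.+1 then fun f =>
    (\int[lebesgue_measure]_t
        integral_rV (fun u : 'rV[R]_n' => f (row_mx (t%:M : 'rV[R]_1) u)))%E
  else fun f => f 0.

Definition borel (T : ptopologicalType) := g_sigma_algebraType (@open T).

Section poincare.
Context {R : realType} {n : nat} {M : ptopologicalType}.
Context {A : oriented_manifold R n M}.
Variable S : spacetime A.

(* mu is the volume measure mu_g: in each chart it has density |det g|^(1/2)
   with respect to the Lebesgue measure. *)
Definition is_volume_measure (mu : {measure set (borel M) -> \bar R}) :=
  forall (c : chart A) (B : set (borel M)), measurable B -> B `<=` dom c ->
    mu B = integral_rV (fun u =>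
      (\1_(coord c @` B) u *
       Num.sqrt `|\det (\matrix_(i < n, j < n)
          metric S (partial c (param c u) i) (partial c (param c u) j))|)%:E).

Definition future_timelike x (v : tangent A x) :=
  metric S v v < 0 /\ metric S v (time_field S x) < 0.


Record hom (x y : M) := Hom {
  hom_fun :> tangent A x -> tangent A y;
  hom_linear : linear hom_fun;
  hom_isometry : forall u v, metric S (hom_fun u) (hom_fun v) = metric S u v;
  hom_orientation : forall e : 'I_n -> tangent A x,
    oriented_frame e -> oriented_frame (hom_fun \o e);
  hom_time_orientation : forall v,
    future_timelike v -> future_timelike (hom_fun v) }.

Definition id_hom x : hom x x :=
  @Hom x x id (fun _ _ _ => erefl) (fun _ _ => erefl) (fun _ h => h)
    (fun _ h => h).

Definition comp_hom x y z (f : hom y z) (g : hom x y) : hom x z :=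
  @Hom x z (f \o g)
    (fun a u v => etrans (congr1 f (hom_linear g a u v)) (hom_linear f a _ _))
    (fun u v => etrans (hom_isometry f _ _) (hom_isometry g u v))
    (fun e h => hom_orientation f (hom_orientation g h))
    (fun v h => hom_time_orientation f (hom_time_orientation g h)).

Record arrow := Arrow { src : M; tgt : M; arrow_hom : hom src tgt }.

(* matrix of a linear map T_xM -> T_yM in charts around x and y *)
Definition hom_mx (c c' : chart A) x y (f : hom x y) : 'M[R]_n :=
  \matrix_(i, j) f (partial c x i) c' 0 j.

HB.instance Definition _ := gen_eqMixin arrow.
HB.instance Definition _ := gen_choiceMixin arrow.
HB.instance Definition _ := isPointed.Build arrow (Arrow (id_hom (@point M))).

End poincare.

Section groupoid.
Context {R : realType} {n : nat} {M : ptopologicalType}.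
Context {A : oriented_manifold R n M}.
Variable S : spacetime A.

(* Gamma is topologised as a submanifold of the bundle Hom(TM, TM) over M x M:
   W is open when it is relatively open in the coordinates (s, t, matrix) given
   by any two charts of M. *)
Definition arrow_coord (c c' : chart A) (f : arrow S) :
    'rV[R]_n * 'rV[R]_n * 'M[R]_n :=
  (coord c (src f), coord c' (tgt f), hom_mx c c' (arrow_hom f)).

Definition arrow_open (W : set (arrow S)) :=
  forall c c', exists2 U, open U &
    forall f, dom c (src f) -> dom c' (tgt f) -> W f <-> U (arrow_coord c c' f).

Lemma arrow_openT : arrow_open setT.
Proof. by move=> c c'; exists setT => //; exact: openT. Qed.

Lemma arrow_openI : setI_closed arrow_open.
Proof.
move=> V W oV oW c c'; have [U oU UP] := oV c c'; have [P oP PQ] := oW c c'.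
exists (U `&` P); first exact: openI.
by move=> f sf tf; split=> -[/(UP f sf tf) ? /(PQ f sf tf) ?].
Qed.

Lemma arrow_open_bigU (I : Type) (W : I -> set (arrow S)) :
  (forall i, arrow_open (W i)) -> arrow_open (\bigcup_i W i).
Proof.
move=> oW c c'; have /choice[U UP] : forall i, exists U, open U /\ forall f,
    dom c (src f) -> dom c' (tgt f) -> W i f <-> U (arrow_coord c c' f).
  by move=> i; have [U] := oW i c c'; exists U.
exists (\bigcup_i U i); first by apply: bigcup_open => i _; have [] := UP i.
move=> f sf tf; split=> -[i _ Wf]; exists i => //;
  by have [_ /(_ f sf tf) H] := UP i; apply/H.
Qed.

HB.instance Definition _ := @isOpenTopological.Build (arrow S) arrow_open
  arrow_openT arrow_openI arrow_open_bigU.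

(* Gamma^x = t^-1(x), parametrised so that the target is x definitionally. *)
Record fiber (x : M) := Fiber { fiber_src : M; fiber_hom : hom S fiber_src x }.

HB.instance Definition _ x := gen_eqMixin (fiber x).
HB.instance Definition _ x := gen_choiceMixin (fiber x).
HB.instance Definition _ x := isPointed.Build (fiber x) (Fiber (id_hom S x)).

Definition fiber_arrow x (f : fiber x) : arrow S := Arrow (fiber_hom f).

(* Gamma^x with the Borel sigma-algebra of its subspace topology *)
Definition borel_fiber x := g_sigma_algebraType
  [set D : set (fiber x) | exists2 W, open W & D = @fiber_arrow x @^-1` W].

Definition Lmul x y (f : hom S x y) (g : fiber x) : fiber y :=
  Fiber (comp_hom f (fiber_hom g)).

Record bisection := Bisection {
  bis_map : M -> M;
  bis_hom : forall x, hom S x (bis_map x);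
  bis_inv : M -> M;
  bis_mapK : cancel bis_map bis_inv;
  bis_invK : cancel bis_inv bis_map;
  bis_map_smooth : smooth_map A bis_map;
  bis_inv_smooth : smooth_map A bis_inv;
  bis_hom_smooth : forall c c' i j,
    smooth_on (coord c @` (dom c `&` bis_map @^-1` dom c'))
              (fun u => hom_mx c c' (bis_hom (param c u)) i j) }.

(* b(phi_b^-1(x)), as an arrow from phi_b^-1(x) to x *)
Definition bis_to (b : bisection) (x : M) : hom S (bis_inv b x) x :=
  ecast y (hom S (bis_inv b x) y) (bis_invK b x) (bis_hom b (bis_inv b x)).

End groupoid.

Definition ip_norm (R : realType) (V : lmodType R[i]) (ip : V -> V -> R[i])
  (u : V) : R := Num.sqrt (complex.Re (ip u u)).

(* Separable complex Hilbert spaces; the inner product is linear on the right. *)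
Record hilbert (R : realType) := Hilbert {
  hcar :> lmodType R[i];
  hip : hcar -> hcar -> R[i];
  hip_linear : forall w a u v, hip w (a *: u + v) = a * hip w u + hip w v;
  hip_conj : forall u v, hip v u = Num.conj (hip u v);
  hip_pos : forall u, u != 0 -> 0 < hip u u;
  hilbert_complete : forall u : nat -> hcar,
    (forall e, 0 < e -> exists N, forall p q, (N <= p)%N -> (N <= q)%N ->
      ip_norm hip (u p - u q) < e) ->
    exists l, (fun k => ip_norm hip (u k - l)) @ \oo --> (0 : R);
  hilbert_separable : exists d : nat -> hcar,
    forall v e, 0 < e -> exists k, ip_norm hip (d k - v) < e }.

Section operators.
Context {R : realType}.
Implicit Types H K : hilbert R.

Definition hnorm H (u : H) : R := ip_norm (@hip R H) u.

Definition bounded_op H K (T : H -> K) :=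
  linear T /\ exists c : R, forall u, hnorm (T u) <= c * hnorm u.

Definition adj H K (T : H -> K) : K -> H :=
  xget (fun=> 0) [set B | forall u v, hip (T u) v = hip u (B v)].

Definition unitary_op H K (T : H -> K) :=
  [/\ linear T, forall u v, hip (T u) (T v) = hip u v
    & forall v, exists u, T u = v].

Definition positive_op H (T : H -> H) := forall u, 0 <= hip u (T u).

Definition effect H (T : H -> H) :=
  [/\ bounded_op T, positive_op T & forall u, hip u (T u) <= hip u u].

(* Null vectors are allowed in the enumeration, so that finite-dimensional
   spaces are covered. *)
Definition orthonormal_basis H (e : nat -> H) :=
  [/\ forall i j, i != j -> hip (e i) (e j) = 0,
      forall i, hip (e i) (e i) = 1 \/ e i = 0
    & forall v, (forall i, hip (e i) v = 0) -> v = 0].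

Definition some_basis H : nat -> H := xget (fun=> 0) (@orthonormal_basis H).

(* Tr T = sum_k <e_k, T e_k> *)
Definition tr H (T : H -> H) : R[i] :=
  let s N := \sum_(k < N) hip (some_basis H k) (T (some_basis H k)) in
  Complex (limn (fun N => complex.Re (s N))) (limn (fun N => complex.Im (s N))).

(* The trace norm between two Hilbert spaces, as the nuclear norm: infimum of
   sum_k |xi_k| |eta_k| over the expansions T = sum_k |xi_k><eta_k|. *)
Definition trace_norm H K (T : H -> K) : \bar R :=
  ereal_inf [set s | exists xi : nat -> K, exists eta : nat -> H,
    (forall v, (fun N => hnorm (T v - \sum_(k < N) hip (eta k) v *: xi k))
               @ \oo --> (0 : R)) /\
    s = (\sum_(0 <= k <oo) (hnorm (xi k) * hnorm (eta k))%:E)%E].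

Definition trace_class H K (T : H -> K) :=
  bounded_op T /\ (trace_norm T < +oo)%E.

Definition density_op H (T : H -> H) :=
  [/\ trace_class T, positive_op T & tr T = 1].

Definition cmeasurable d (T : measurableType d) (f : T -> R[i]) :=
  measurable_fun setT (fun t => complex.Re (f t)) /\ measurable_fun setT (fun t => complex.Im (f t)).

Definition ccontinuous (T : topologicalType) (f : T -> R[i]) :=
  continuous (fun t => complex.Re (f t)) /\ continuous (fun t => complex.Im (f t)).

Definition cintegrable d (T : measurableType d) (m : set T -> \bar R)
    (f : T -> R[i]) :=
  m.-integrable setT (fun t => (complex.Re (f t))%:E) /\
  m.-integrable setT (fun t => (complex.Im (f t))%:E).

Definition cintegral d (T : measurableType d) (m : set T -> \bar R)
    (f : T -> R[i]) : R[i] :=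
  Complex (fine (\int[m]_t (complex.Re (f t))%:E))
          (fine (\int[m]_t (complex.Im (f t))%:E)).

End operators.

(* Continuous fields of Hilbert spaces (Dixmier-Douady), given by their
   continuous sections.  They are separable: some sequence of continuous
   sections is dense in every fibre. *)
Record cfield (R : realType) (M : ptopologicalType) := CField {
  cfib :> M -> hilbert R;
  csec : set (forall x, cfib x);
  csec_linear : forall (a : R[i]) xi eta, csec xi -> csec eta ->
    csec (fun x => a *: xi x + eta x);
  csec_norm : forall xi, csec xi -> continuous (fun x => hnorm (xi x));
  csec_local : forall eta : (forall x, cfib x),
    (forall (x : M) (e : R), 0 < e -> exists2 xi, csec xi &
       \forall y \near x, hnorm (eta y - xi y) <= e) -> csec eta;
  csec_dense : exists xi : nat -> forall x, cfib x, (forall k, csec (xi k)) /\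
    forall x (v : cfib x) e, 0 < e -> exists k, hnorm (xi k x - v) < e }.

Section direct_integral.
Context {R : realType} {M : ptopologicalType}.
Variable mu : {measure set (borel M) -> \bar R}.
Implicit Type F : cfield R M.

Definition section F := forall x, F x.
Definition opfield F := forall x, F x -> F x.

Definition measurable_section F (Psi : section F) := forall xi : section F, csec xi ->
  cmeasurable (fun x : borel M => hip (xi x) (Psi x)).

Definition measurable_opfield F (T : opfield F) :=
  forall xi eta : section F, csec xi -> csec eta ->
  cmeasurable (fun x : borel M => hip (xi x) (T x (eta x))).

(* Representatives of the elements of the direct integral Hilbert space; two
   representatives are identified when they agree mu-a.e. *)
Definition square_integrable F (Psi : section F) :=
  measurable_section Psi /\
  (\int[mu]_(x in [set: borel M]) ((hnorm (Psi x)) ^+ 2)%:E < +oo)%E.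

Definition dint_ip F (Psi Chi : section F) : R[i] :=
  cintegral mu (fun x : borel M => hip (Psi x) (Chi x)).

Definition dint_adj F (T : section F -> section F) (Psi : section F) :
    section F :=
  xget (fun=> 0) [set Chi : section F | square_integrable Chi /\
    forall Xi, square_integrable Xi -> dint_ip (T Xi) Psi = dint_ip Xi Chi].

(* Representatives of the elements of A(F) *)
Definition vn_field F (T : opfield F) :=
  [/\ forall x, bounded_op (T x), measurable_opfield T
    & exists c : R, {ae mu, forall x : borel M,
        forall v : F x, hnorm (T x v) <= c * hnorm v}].

Definition state_field F (w : opfield F) :=
  vn_field w /\ {ae mu, forall x : borel M, density_op (w x)}.

Definition dint_act F (T : opfield F) (Psi : section F) : section F :=
  fun x => T x (Psi x).

(* Radon-Nikodym derivative, as a nonnegative function.  (The library's one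
   asks for a finite charge nu.) *)
Definition RN_derivative (nu : set (borel M) -> \bar R) : borel M -> R :=
  xget (fun=> 0) [set f : borel M -> R |
    [/\ measurable_fun setT f, forall x, 0 <= f x
      & forall B, measurable B -> nu B = (\int[mu]_(x in B) (f x)%:E)%E]].

End direct_integral.

Section qrf.
Context {R : realType} {n : nat} {M : ptopologicalType}.
Context {A : oriented_manifold R n M}.
Variable S : spacetime A.
Implicit Type F : cfield R M.

Definition rep F := forall x y, hom S x y -> F x -> F y.

Definition unitary_rep F (U : rep F) :=
  [/\ forall x y (f : hom S x y), unitary_op (U x y f),
      forall x y z (f : hom S y z) (g : hom S x y) v,
        U x z (comp_hom f g) v = U y z f (U x y g v),
      forall x v, U x x (id_hom S x) v = v
    & forall xi eta : section F, csec xi -> csec eta ->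
        cmeasurable (fun f : borel (arrow S) =>
          hip (eta (tgt f)) (U _ _ (arrow_hom f) (xi (src f))))].

Definition finite_rank_field F (N : nat) (xi eta : nat -> section F)
    (f : arrow S) (v : F (tgt f)) : F (src f) :=
  \sum_(j < N) hip (eta j (tgt f)) v *: xi j (src f).

Definition fibrewise_ultraweakly_continuous F (U : rep F) :=
  forall chi : (forall f : arrow S, F (tgt f) -> F (src f)),
    (forall f, trace_class (chi f)) ->
    (forall f0, exists2 W : set (arrow S), open_nbhs f0 W &
       forall e : R, 0 < e -> exists N, exists xi eta : nat -> section F,
         (forall j, csec (xi j) /\ csec (eta j)) /\
         forall f, W f -> (trace_norm (fun v =>
           (chi f v - @finite_rank_field F N xi eta f v)%R) <= e%:E)%E) ->
    ccontinuous (fun f => tr (U _ _ (arrow_hom f) \o chi f)).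

Record qsystem := QSystem {
  sys_field :> cfield R M;
  sys_rep : rep sys_field;
  sys_unitary : unitary_rep sys_rep;
  sys_continuous : fibrewise_ultraweakly_continuous sys_rep }.

(* The values of [frame_povm x] matter on Borel subsets of Gamma^x only. *)
Record qframe (mu : {measure set (borel M) -> \bar R}) := QFrame {
  frame_field :> cfield R M;
  frame_rep : rep frame_field;
  frame_povm : forall x, set (borel_fiber S x) -> frame_field x -> frame_field x;
  frame_unitary : unitary_rep frame_rep;
  frame_continuous : fibrewise_ultraweakly_continuous frame_rep;
  povm_effect : forall x (D : set (borel_fiber S x)), measurable D ->
    effect (frame_povm D);
  povm_normalized : forall x (v : frame_field x), frame_povm setT v = v;
  povm_sigma_additive : forall x (D : nat -> set (borel_fiber S x)),
    (forall k, measurable (D k)) -> trivIset setT D ->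
    forall v : frame_field x,
      (fun N => \sum_(k < N) complex.Re (hip v (frame_povm (D k) v)))
        @ \oo --> complex.Re (hip v (frame_povm (\bigcup_k D k) v));
  povm_measurable : forall D : set (borel (arrow S)), measurable D ->
    measurable_opfield (fun x =>
      frame_povm (@fiber_arrow _ _ _ _ S x @^-1` D : set (borel_fiber S x)));
  povm_covariant : forall x y (f : hom S x y) (D : set (borel_fiber S x)),
    measurable D -> forall v : frame_field y,
    frame_rep f (frame_povm D (adj (frame_rep f) v)) =
    frame_povm (Lmul f @` D : set (borel_fiber S y)) v;
  povm_admissible : {ae mu, forall x : borel M, forall N : set (borel M),
    measurable N -> mu N = 0%E -> forall v : frame_field x,
    frame_povm (@fiber_src _ _ _ _ S x @^-1` N : set (borel_fiber S x)) v = 0} }.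

Section relational_field.
Variable mu : {measure set (borel M) -> \bar R}.
Variables (Sys : qsystem) (Fr : qframe mu).

Definition povm_state (w : opfield Fr) x : set (borel_fiber S x) -> \bar R :=
  fun D => (complex.Re (tr (w x \o frame_povm (q := Fr) D)))%:E.

(* T is the ultraweak integral over Gamma^x of V_f phi_s(f) V_f^* *)
Definition is_relational_value (phi : opfield Sys) (w : opfield Fr) x
    (T : Sys x -> Sys x) :=
  bounded_op T /\
  forall rho : Sys x -> Sys x, trace_class rho ->
    let h (f : borel_fiber S x) :=
      tr (rho \o (sys_rep (fiber_hom f) \o phi (fiber_src f) \o
                  adj (sys_rep (fiber_hom f)))) in
    cintegrable (@povm_state w x) h /\
    tr (rho \o T) = cintegral (@povm_state w x) h.

Definition relational_field (phi : opfield Sys) (w : opfield Fr) :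
    opfield Sys :=
  fun x => xget (fun=> 0) (@is_relational_value phi w x).

Definition bisection_op (b : bisection S) (Psi : section Sys) : section Sys :=
  let phi : borel M -> borel M := bis_map b in
  fun x =>
    Complex (Num.sqrt (RN_derivative mu (pushforward mu phi) x)) 0 *:
    sys_rep (bis_to b x) (Psi (bis_inv b x)).

Definition bisection_state (b : bisection S) (w : opfield Fr) : opfield Fr :=
  fun x => frame_rep (bis_to b x) \o w (bis_inv b x) \o
           adj (frame_rep (bis_to b x)).

End relational_field.

End qrf.

(* Main.v *)
From Pilot Require Import Defs.
From HB Require Import structures.
From mathcomp Require Import all_boot all_order all_algebra.
From mathcomp Require Import complex.
From mathcomp Require Import all_classical all_reals all_analysis.
From mathcomp Require Import measurable_realfun ring lra.
Import Pilot.Defs.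

(** Both sides are computed at almost every [x].  Write [y] for the inverse
    image of [x] under [phi_b] and [f : y -> x] for the arrow of [b] at [y].
    - Left translation [L_f] identifies [Gamma^y] with [Gamma^x], and by
      covariance of the POVM and unitary invariance of the trace it carries the
      measure of [omega_y] to that of [U_f omega_y U_f^*].  Hence the defining
      property of the ultraweak integral passes from [T] at [y] to
      [V_f T V_f^*] at [x]; as the integral is unique, the values of the two
      relational fields are conjugate under [V_f].  Whether the integral
      exists plays no role: if it fails to, it fails at both points, and both
      values are [0].
    - The adjoint of [V_b] is
      [Psi |-> (y |-> r(phi_b y)^(-1/2) V_f^* Psi(phi_b y))], where [r] is the
      density of [(phi_b)_* mu] with respect to [mu].  The two factors
      [r^(1/2)] and [r^(-1/2)] cancel wherever [r > 0].
    The density exists and is positive almost everywhere because a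
    diffeomorphism preserves null sets: a C^1 map is Lipschitz on small boxes,
    an outer regular Lebesgue null set is covered by dyadic cubes of small
    total volume, and these go to sets of comparably small volume. *)

Set Implicit Arguments.
Unset Strict Implicit.
Unset Printing Implicit Defensive.

Import Order.TTheory GRing.Theory Num.Theory.
Import numFieldNormedType.Exports.

Local Open Scope classical_set_scope.
Local Open Scope ring_scope.

(** * Hilbert spaces *)

(** The adjoint, the basis behind [tr], the ultraweak integral, the density and the adjoint on the
    direct integral are values of the choice operator [xget]. What can be said of them comes from
    existence proofs (Riesz, Gram-Schmidt, Radon-Nikodym) and from uniqueness, which for the
    ultraweak integral is tested on rank-one operators. The trace is the main obstacle: bases are
    chosen in each fibre without regard to [V_f], so unitary invariance cannot be had by carrying a
    basis along. It comes from expansions into sums of [|xi_k><eta_k|], since the trace equals the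
    sum of [<eta_k, xi_k>], which mentions no basis. Two objects have to be built. Arrows carry no
    inverse in their definition, and inverting [L_f] needs one; that it keeps the time orientation
    is a fact of Lorentzian geometry. The volume measure is given by an iterated integral, for which
    a Lebesgue measure on row vectors is constructed. Preservation of null sets serves twice: for
    the density, and to use at the inverse image of [x] what holds at almost every [y]. *)

Section complex_parts.
Context {R : realType}.
Implicit Types z w : R[i].

Lemma cReD z w : complex.Re (z + w) = complex.Re z + complex.Re w.
Proof. by case: z; case: w. Qed.

Lemma cImD z w : complex.Im (z + w) = complex.Im z + complex.Im w.
Proof. by case: z; case: w. Qed.

Lemma cReN z : complex.Re (- z) = - complex.Re z.
Proof. by case: z. Qed.

Lemma cImN z : complex.Im (- z) = - complex.Im z.
Proof. by case: z. Qed.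

Lemma cReM z w : complex.Re (z * w) =
  complex.Re z * complex.Re w - complex.Im z * complex.Im w.
Proof. by case: z; case: w. Qed.

Lemma cImM z w : complex.Im (z * w) =
  complex.Re z * complex.Im w + complex.Im z * complex.Re w.
Proof. by case: z; case: w => *; rewrite /= addrC. Qed.

Lemma cRe_sum (I : Type) (r : seq I) (P : pred I) (F : I -> R[i]) :
  complex.Re (\sum_(i <- r | P i) F i) = \sum_(i <- r | P i) complex.Re (F i).
Proof. by elim/big_rec2 : _ => // i a b _ <-; rewrite cReD. Qed.

Lemma cIm_sum (I : Type) (r : seq I) (P : pred I) (F : I -> R[i]) :
  complex.Im (\sum_(i <- r | P i) F i) = \sum_(i <- r | P i) complex.Im (F i).
Proof. by elim/big_rec2 : _ => // i a b _ <-; rewrite cImD. Qed.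

Lemma cReC z : complex.Re z^* = complex.Re z.
Proof. by case: z. Qed.

Lemma cImC z : complex.Im z^* = - complex.Im z.
Proof. by case: z. Qed.

Lemma complex_eq z w :
  complex.Re z = complex.Re w -> complex.Im z = complex.Im w -> z = w.
Proof. by case: z; case: w => /= a b c d -> ->. Qed.

Definition csq z : R := complex.Re z ^+ 2 + complex.Im z ^+ 2.

Lemma csq_ge0 z : 0 <= csq z.
Proof. by rewrite addr_ge0 ?sqr_ge0. Qed.

Lemma mul_conjE z : z^* * z = Complex (csq z) 0.
Proof. by case: z => a b; apply: complex_eq; rewrite /csq/=; ring. Qed.

Lemma csqC z : csq z^* = csq z.
Proof. by rewrite /csq cReC cImC sqrrN. Qed.

Lemma csq_eq0 z : csq z = 0 -> z = 0.
Proof.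
move=> /eqP; rewrite paddr_eq0 ?sqr_ge0// !sqrf_eq0 => /andP[/eqP a /eqP b].
exact: complex_eq.
Qed.

End complex_parts.

Notation rip u v := (complex.Re (hip u v)).

Section inner_product.
Context {R : realType} {H : hilbert R}.
Implicit Types u v w : H.

Lemma hipDr w u v : hip w (u + v) = hip w u + hip w v.
Proof. by have := hip_linear w 1 u v; rewrite scale1r mul1r. Qed.

Lemma hip0r w : hip w 0 = 0.
Proof. by apply: (addrI (hip w 0)); rewrite -hipDr !addr0. Qed.

Lemma hipZr w a u : hip w (a *: u) = a * hip w u.
Proof. by have := hip_linear w a u 0; rewrite !addr0 hip0r addr0. Qed.

Lemma hipNr w u : hip w (- u) = - hip w u.
Proof. by rewrite -scaleN1r hipZr mulN1r. Qed.

Lemma hipBr w u v : hip w (u - v) = hip w u - hip w v.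
Proof. by rewrite hipDr hipNr. Qed.

Lemma hip_sumr w (I : Type) (r : seq I) (P : pred I) (F : I -> H) :
  hip w (\sum_(i <- r | P i) F i) = \sum_(i <- r | P i) hip w (F i).
Proof.
elim/big_rec2 : _ => [|i a b _ <-]; [exact: hip0r | exact: hipDr].
Qed.

Lemma hipDl w u v : hip (u + v) w = hip u w + hip v w.
Proof. by rewrite hip_conj hipDr rmorphD (hip_conj w u) (hip_conj w v). Qed.

Lemma hip0l w : hip 0 w = 0.
Proof. by rewrite hip_conj hip0r rmorph0. Qed.

Lemma hipZl w a u : hip (a *: u) w = a^* * hip u w.
Proof. by rewrite hip_conj hipZr rmorphM (hip_conj w u). Qed.

Lemma hipNl w u : hip (- u) w = - hip u w.
Proof. by rewrite hip_conj hipNr rmorphN (hip_conj w u). Qed.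

Lemma hipBl w u v : hip (u - v) w = hip u w - hip v w.
Proof. by rewrite hipDl hipNl. Qed.

Lemma hip_suml w (I : Type) (r : seq I) (P : pred I) (F : I -> H) :
  hip (\sum_(i <- r | P i) F i) w = \sum_(i <- r | P i) hip (F i) w.
Proof.
elim/big_rec2 : _ => [|i a b _ <-]; [exact: hip0l | exact: hipDl].
Qed.

Lemma rip_sym u v : rip u v = rip v u.
Proof. by rewrite hip_conj cReC. Qed.

Lemma hip_ge0 u : 0 <= hip u u.
Proof. by have [->|/hip_pos/ltW//] := eqVneq u 0; rewrite hip0r. Qed.

Lemma rip_ge0 u : 0 <= rip u u.
Proof. by have := hip_ge0 u; rewrite lecE => /andP[]. Qed.

Lemma Im_hipuu u : complex.Im (hip u u) = 0.
Proof. by have := hip_ge0 u; rewrite lecE => /andP[/eqP]. Qed.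

Lemma hipuuE u : hip u u = Complex (rip u u) 0.
Proof. by apply: complex_eq; rewrite ?Im_hipuu. Qed.

Lemma rip_eq0 u : rip u u = 0 -> u = 0.
Proof.
move=> u0; apply/eqP/negPn/negP => /hip_pos; rewrite ltcE u0.
by rewrite ltxx andbF.
Qed.

Lemma hnorm_ge0 u : 0 <= hnorm u. Proof. exact: sqrtr_ge0. Qed.

Lemma hnorm_sqr u : hnorm u ^+ 2 = rip u u.
Proof. by rewrite sqr_sqrtr// rip_ge0. Qed.

Lemma hnorm_eq0 u : hnorm u = 0 -> u = 0.
Proof. by move=> u0; apply: rip_eq0; rewrite -hnorm_sqr u0 expr0n. Qed.

Lemma hnorm0 : hnorm (0 : H) = 0.
Proof. by rewrite /hnorm /ip_norm hip0r sqrtr0. Qed.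

Lemma hnormZ a u : hnorm (a *: u) = Num.sqrt (csq a) * hnorm u.
Proof.
rewrite /hnorm /ip_norm hipZr hipZl mulrA [a * _]mulrC mul_conjE cReM /=.
by rewrite mul0r subr0 sqrtrM ?csq_ge0.
Qed.

Lemma hnormN u : hnorm (- u) = hnorm u.
Proof. by rewrite /hnorm /ip_norm hipNl hipNr opprK. Qed.

Lemma hnormBC u v : hnorm (u - v) = hnorm (v - u).
Proof. by rewrite -hnormN opprB. Qed.

(** The squared norm of [u - t v] is nonnegative; the real [t] that minimises it gives the bound. *)
Lemma rip_le_hnorm u v : rip u v <= hnorm u * hnorm v.
Proof.
have [->|v0] := eqVneq v 0; first by rewrite hip0r hnorm0 mulr0.
have nv : 0 < hnorm v.
  by rewrite lt_neqAle hnorm_ge0 andbT eq_sym; apply: contra_neq v0; exact: hnorm_eq0.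
pose t := rip u v / hnorm v ^+ 2.
have := rip_ge0 (u - Complex t 0 *: v).
rewrite hipBl !hipBr !hipZr !hipZl !(cReD, cReN, cReM, cReC, cImC) /= !(mul0r, subr0, oppr0).
rewrite (rip_sym v u) -!hnorm_sqr => h.
have tE : t * hnorm v ^+ 2 = rip u v by rewrite /t divfK// expf_neq0// gt_eqF.
have : 0 <= hnorm u ^+ 2 - t * rip u v by move: h tE; nra.
rewrite -(ler_pM2r (exprn_gt0 2 nv)) mul0r mulrBl.
rewrite [t * _ * _]mulrAC tE -expr2 subr_ge0 -exprMn.
move=> h2; apply: le_trans (ler_norm _) _.
by rewrite -(@ler_pXn2r _ 2)// ?nnegrE ?mulr_ge0 ?hnorm_ge0// real_normK// num_real.
Qed.

Lemma norm_rip_le u v : `|rip u v| <= hnorm u * hnorm v.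
Proof.
rewrite ler_norml rip_le_hnorm andbT lerNl -cReN -hipNr.
by rewrite -[hnorm v]hnormN rip_le_hnorm.
Qed.

(** Multiplying [v] by the conjugate of [hip u v] turns the inner product into its squared modulus,
    so that the bound for real parts applies; the nonzero factor [csq (hip u v)] is then
    cancelled. *)
Lemma csq_hip_le u v : csq (hip u v) <= hnorm u ^+ 2 * hnorm v ^+ 2.
Proof.
have [->|h0] := eqVneq (csq (hip u v)) 0.
  by rewrite mulr_ge0 ?exprn_ge0 ?hnorm_ge0.
have := rip_le_hnorm u ((hip u v)^* *: v).
rewrite hipZr mul_conjE /= hnormZ csqC => h.
have := csq_ge0 (hip u v); rewrite le_eqVlt eq_sym (negbTE h0)/= => hp.
rewrite -exprMn -(@ler_pM2l _ (csq (hip u v)))// -expr2.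
rewrite -{2}(sqr_sqrtr (ltW hp)) -exprMn.
rewrite ler_pXn2r// ?nnegrE ?(ltW hp)// ?mulr_ge0 ?sqrtr_ge0 ?hnorm_ge0//.
by rewrite mulrCA.
Qed.

Lemma hnormD u v : hnorm (u + v) <= hnorm u + hnorm v.
Proof.
rewrite -(@ler_pXn2r _ 2)// ?nnegrE ?addr_ge0 ?hnorm_ge0//.
rewrite hnorm_sqr hipDl !hipDr !cReD (rip_sym v u) -!hnorm_sqr.
by have := rip_le_hnorm u v; nra.
Qed.

Lemma hnormB u v : hnorm (u - v) <= hnorm u + hnorm v.
Proof. by rewrite -[hnorm v]hnormN hnormD. Qed.

(** Limits and bounds are proved for real parts; this identity carries them over to imaginary
    parts. *)
Lemma Im_hipE u v : complex.Im (hip u v) = - rip u (Complex 0 1 *: v).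
Proof. by rewrite hipZr cReM /= mul0r mul1r sub0r opprK. Qed.

Lemma rip_ext u v : (forall w, rip w u = rip w v) -> u = v.
Proof.
move=> h; apply/eqP; rewrite -subr_eq0; apply/eqP/rip_eq0.
by rewrite hipBr cReD cReN h subrr.
Qed.

Lemma hip_ext u v : (forall w, hip w u = hip w v) -> u = v.
Proof. by move=> h; apply: rip_ext => w; rewrite h. Qed.

End inner_product.

Section convergence.
Context {R : realType}.

Definition hcvg (H : hilbert R) (u : nat -> H) (l : H) :=
  (fun k => hnorm (u k - l)) @ \oo --> (0 : R).

Lemma cvg0_le (f g : nat -> R) : (forall k, 0 <= f k <= g k) ->
  g @ \oo --> (0 : R) -> f @ \oo --> (0 : R).
Proof.
move=> fg g0; apply: (@squeeze_cvgr _ _ _ _ (fun=> 0) g) => //.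
- by near=> k; exact: fg.
- exact: cvg_cst.
Unshelve. all: by end_near. Qed.

Lemma cvgr_dist0 (f : nat -> R) (l : R) :
  (fun k => `|f k - l|) @ \oo --> (0 : R) -> f @ \oo --> l.
Proof.
move=> h; apply: (@cvg_sub0 _ _ _ _ _ f (fun=> l)); last exact: cvg_cst.
exact/norm_cvg0P.
Qed.

Lemma hcvg_rip (H : hilbert R) (u : nat -> H) l w : hcvg u l ->
  (fun k => rip w (u k)) @ \oo --> rip w l.
Proof.
move=> ul; apply: cvgr_dist0.
apply: (@cvg0_le _ (fun k => hnorm w * hnorm (u k - l))).
  by move=> k; rewrite normr_ge0 -cReN -cReD -hipBr norm_rip_le.
by rewrite -(mulr0 (hnorm w)); apply: cvgMr; exact: ul.
Qed.

Lemma cvgn_eq0 (f : nat -> R) (a : R) : f @ \oo --> (0 : R) ->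
  (forall k, a <= f k) -> a <= 0.
Proof.
move=> f0 af; rewrite -(cvg_lim (@Rhausdorff R) f0).
by apply: limr_ge; [exact: cvgP f0|near=> k; exact: af].
Unshelve. all: by end_near. Qed.

Lemma bounded_series_cvg (b : nat -> R) (B : R) : (forall k, 0 <= b k) ->
  (forall N, \sum_(k < N) b k <= B) ->
  exists2 l : R, (fun N => \sum_(k < N) b k) @ \oo --> l &
    forall N, \sum_(k < N) b k <= l.
Proof.
move=> b0 bB; pose s N := \sum_(k < N) b k.
have nds : {homo s : m n / (m <= n)%N >-> m <= n}.
  apply/nondecreasing_seqP => n.
  by rewrite /s big_ord_recr/= lerDl.
have cs : cvgn s by apply: nondecreasing_is_cvgn => //; exists B => _ [N _ <-]; exact: bB.
exists (limn s) => // N; exact: nondecreasing_cvgn_le.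
Qed.

Lemma sum_ord_split (V : zmodType) (a : nat -> V) m n : (m <= n)%N ->
  \sum_(k < n) a k = \sum_(k < m) a k + \sum_(m <= k < n) a k.
Proof. by move=> mn; rewrite -!(big_mkord xpredT a) (big_cat_nat (leq0n m) mn). Qed.

(** Dominated convergence for series. Beyond [K] terms every row [a N], and [al] as well, has a
    remainder of at most [S - \sum_(k < K) b k], uniformly in [N]; so [L - t N] consists of two
    small remainders and a finite sum that converges term by term. *)
Lemma tannery (a : nat -> nat -> R) (b al t : nat -> R) (B : R) :
  (forall N k, `|a N k| <= b k) -> (forall N, \sum_(k < N) b k <= B) ->
  (forall k, a^~ k @ \oo --> al k) ->
  (forall N, (fun K => \sum_(k < K) a N k) @ \oo --> t N) ->
  exists2 L : R, (fun K => \sum_(k < K) al k) @ \oo --> L & t @ \oo --> L.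
Proof.
move=> ab bB aal at_.
have b0 k : 0 <= b k := le_trans (normr_ge0 _) (ab 0%N k).
have alb k : `|al k| <= b k.
  have h : (fun N => `|a N k|) @ \oo --> `|al k| by apply: cvg_norm; exact: aal.
  rewrite -(cvg_lim (@Rhausdorff R) h).
  apply: limr_le; first exact: cvgP h.
  by near=> N; exact: ab.
have [S cS leS] := bounded_series_cvg b0 bB.
have [L cL] : exists L : R, (fun K => \sum_(k < K) al k) @ \oo --> L.
  have : cvgn (series al).
    apply: normed_cvg; rewrite /normed_series_of/=.
    apply: nondecreasing_is_cvgn.
      by apply: nondecreasing_series => k _ _; exact: normr_ge0.
    exists B => _ [N _ <-]; rewrite /series/= big_mkord.
    by apply: le_trans (bB N); apply: ler_sum => i _; exact: alb.
  move=> cal; exists (limn (series al)).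
  have -> : (fun K => \sum_(k < K) al k) = series al.
    by apply/funext => K; rewrite /series/= big_mkord.
  exact: cal.
exists L => //.
have tail (c : nat -> R) l K : (forall k, `|c k| <= b k) ->
    (fun K => \sum_(k < K) c k) @ \oo --> l ->
    `|l - \sum_(k < K) c k| <= S - \sum_(k < K) b k.
  move=> cb cl.
  have cl' : (fun K' => `|\sum_(k < K') c k - \sum_(k < K) c k|) @ \oo -->
      `|l - \sum_(k < K) c k|.
    by apply: cvg_norm; apply: cvgB => //; exact: cvg_cst.
  rewrite -(cvg_lim (@Rhausdorff R) cl').
  apply: limr_le; first exact: cvgP cl'.
  near=> K'.
  have KK' : (K <= K')%N by near: K'; exact: nbhs_infty_ge.
  rewrite (sum_ord_split c KK') addrAC subrr add0r.
  apply: le_trans (ler_norm_sum _ _ _) _.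
  apply: (@le_trans _ _ (\sum_(K <= k < K') b k)); first exact: ler_sum.
  by rewrite lerBrDl -sum_ord_split.
apply/cvgrPdist_lt => e e0.
have e3 : 0 < e / 3 by rewrite divr_gt0.
have [K hK] : exists K, S - \sum_(k < K) b k < e / 3.
  have /cvgrPdist_lt/(_ _ e3) [K _ hK] := cS.
  by exists K; apply: le_lt_trans (ler_norm _) (hK K _) => /=.
have : (fun N => \sum_(k < K) a N k) @ \oo --> \sum_(k < K) al k.
  by apply: cvg_big => [|k _]; [exact: add_continuous|exact: aal].
move=> /cvgrPdist_lt/(_ _ e3) hN.
near=> N.
have h1 := tail (a N) (t N) K (ab N) (at_ N).
have h2 := tail al L K alb cL.
have h3 : `|\sum_(k < K) al k - \sum_(k < K) a N k| < e / 3 by near: N.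
have -> : L - t N = (L - \sum_(k < K) al k) +
  (\sum_(k < K) al k - \sum_(k < K) a N k) - (t N - \sum_(k < K) a N k) by ring.
apply: le_lt_trans (ler_normB _ _) _.
apply: (@le_lt_trans _ _ (`|L - \sum_(k < K) al k| +
  `|\sum_(k < K) al k - \sum_(k < K) a N k| + `|t N - \sum_(k < K) a N k|)).
  by rewrite lerD2r ler_normD.
have -> : e = e / 3 + e / 3 + e / 3 by field.
apply: ltr_leD; last exact: le_trans h1 (ltW hK).
by apply: ler_ltD => //; exact: le_trans h2 (ltW hK).
Unshelve. all: by end_near. Qed.

End convergence.

Section gram_schmidt.
Context {R : realType} {H : hilbert R}.
Implicit Types u v w : H.

(** A null vector stays null. This is the origin of the null entries that [orthonormal_basis]
    allows: a vector dependent on the earlier ones has a null residue. *)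
Definition hunit u : H := Complex (hnorm u)^-1 0 *: u.

Lemma hunitK u : u = Complex (hnorm u) 0 *: hunit u.
Proof.
rewrite /hunit scalerA; have [->|u0] := eqVneq u 0; first by rewrite scaler0.
suff -> : Complex (hnorm u) 0 * Complex (hnorm u)^-1 0 = 1 by rewrite scale1r.
apply: complex_eq; rewrite /= ?(mul0r, mulr0, subr0, addr0)// divff//.
by apply: contra_neq u0; exact: hnorm_eq0.
Qed.

Lemma hip_hunit u : hip (hunit u) (hunit u) = 1 \/ hunit u = 0.
Proof.
have [->|u0] := eqVneq u 0; first by right; rewrite /hunit scaler0.
left; rewrite hipuuE -hnorm_sqr hnormZ /csq /= (expr0n _ 2) addr0 sqrtr_sqr.
rewrite ger0_norm ?invr_ge0 ?hnorm_ge0// mulVf ?expr1n//.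
by apply: contra_neq u0; exact: hnorm_eq0.
Qed.

Variable d : nat -> H.

(** All earlier vectors are carried in a list because each Gram-Schmidt step projects onto all of
    them. *)
Fixpoint gs_seq k : seq H := if k is k'.+1 then
  rcons (gs_seq k') (hunit (d k' - \sum_(e <- gs_seq k') hip e (d k') *: e))
  else [::].

Definition gs k := nth 0 (gs_seq k.+1) k.

Lemma gs_seqE k : gs_seq k = mkseq gs k.
Proof.
elim: k => // k ih; rewrite mkseqS /= {1}ih; congr rcons.
by rewrite /gs /= nth_rcons ih size_mkseq ltnn eqxx.
Qed.

Definition gs_res k := d k - \sum_(i < k) hip (gs i) (d k) *: gs i.

Lemma gsE k : gs k = hunit (gs_res k).
Proof.
rewrite {1}/gs /= gs_seqE nth_rcons size_mkseq ltnn eqxx /gs_res.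
by rewrite big_map -val_enum_ord big_map big_enum.
Qed.

Lemma gs_unit k : hip (gs k) (gs k) = 1 \/ gs k = 0.
Proof. by rewrite gsE; exact: hip_hunit. Qed.

(** The induction is on a bound for the larger index, so that all pairs below [l] are already
    orthogonal when [gs l] is formed. *)
Lemma gs_orth i j : i != j -> hip (gs i) (gs j) = 0.
Proof.
move: i j; suff h : forall n k l, (k < l < n)%N -> hip (gs k) (gs l) = 0.
  by move=> i j; case: ltngtP => // ij _; [|rewrite hip_conj];
    rewrite (h (maxn i j).+1) ?rmorph0// ij ltnS ?leq_maxr ?leq_maxl.
elim=> [k l|n ih k l]; first by rewrite ltn0 andbF.
rewrite ltnS => /andP[kl ln].
have ih' a b : (a < l)%N -> (b < l)%N -> a != b -> hip (gs a) (gs b) = 0.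
  move=> al bl; case: ltngtP => // ab _; first by rewrite ih// ab (leq_trans bl).
  by rewrite hip_conj ih ?rmorph0// ab (leq_trans al).
rewrite (gsE l) /hunit hipZr; apply/eqP; rewrite mulf_eq0; apply/orP; right; apply/eqP.
rewrite hipBr hip_sumr.
rewrite (bigD1 (Ordinal kl))//= big1 ?addr0 => [|i ik]; last first.
  by rewrite hipZr ih' ?mulr0// eq_sym; apply: contra ik => /eqP ik; apply/eqP/val_inj.
rewrite hipZr; case: (gs_unit k) => [->|->]; first by rewrite mulr1 subrr.
by rewrite !hip0l mulr0 subr0.
Qed.

Lemma gs_span v : (forall i, hip (gs i) v = 0) -> forall k, hip (d k) v = 0.
Proof.
move=> gv k; have -> : d k = gs_res k + \sum_(i < k) hip (gs i) (d k) *: gs i.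
  by rewrite subrK.
rewrite hipDl hip_suml (hunitK (gs_res k)) -gsE hipZl gv mulr0 add0r.
by rewrite big1// => i _; rewrite hipZl gv mulr0.
Qed.

End gram_schmidt.

(** [rip v v] equals [rip (v - d k) v], which is at most [e * hnorm v] for a suitable [k]. *)
Lemma dense_orth0 (R : realType) (H : hilbert R) (d : nat -> H) (v : H) :
  (forall v e, 0 < e -> exists k, hnorm (d k - v) < e) ->
  (forall k, hip (d k) v = 0) -> v = 0.
Proof.
move=> dd dv; apply: hnorm_eq0; apply/eqP; rewrite eq_le hnorm_ge0 andbT.
apply/ler_addgt0Pr => e e0; rewrite add0r.
have [k dk] := dd v e e0.
have : rip v v <= hnorm (v - d k) * hnorm v.
  have -> : rip v v = rip (v - d k) v by rewrite hipBl dv subr0.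
  exact: rip_le_hnorm.
rewrite -hnorm_sqr hnormBC; have := hnorm_ge0 v; have := hnorm_ge0 (d k - v).
by nra.
Qed.

(** The basis in which [tr] is computed is picked by [xget], so a basis has to exist: Gram-Schmidt
    applied to a dense sequence gives one. *)
Lemma some_basisP (R : realType) (H : hilbert R) :
  orthonormal_basis (@some_basis R H).
Proof.
rewrite /some_basis; apply: xgetPex.
have [d dd] := hilbert_separable H; exists (gs d); split.
- exact: gs_orth.
- exact: gs_unit.
- by move=> v gv; apply: (dense_orth0 dd); exact: gs_span.
Qed.

Section basis.
Context {R : realType} {H : hilbert R}.
Implicit Types u v w : H.
Local Notation e := (@some_basis R H).

Lemma basis_orth i j : i != j -> hip (e i) (e j) = 0.
Proof. by have [h _ _] := some_basisP H; exact: h. Qed.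

Lemma basis_unit i : hip (e i) (e i) = 1 \/ e i = 0.
Proof. by have [_ h _] := some_basisP H; exact: h. Qed.

Lemma basis_total v : (forall i, hip (e i) v = 0) -> v = 0.
Proof. by have [_ _ h] := some_basisP H; exact: h. Qed.

Definition bsum (c : nat -> R[i]) N : H := \sum_(n < N) c n *: e n.

(** The factor [hip (e i) (e i)] is 1 or, for a null entry, 0. *)
Lemma hip_bsum c N i : (i < N)%N -> hip (e i) (bsum c N) = c i * hip (e i) (e i).
Proof.
move=> iN; rewrite hip_sumr (bigD1 (Ordinal iN))//= hipZr big1 ?addr0// => j ji.
by rewrite hipZr basis_orth ?mulr0// eq_sym; apply: contra ji => /eqP ji; apply/eqP/val_inj.
Qed.

(** Only an inequality, as the terms of null basis entries vanish on the left but not on the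
    right. *)
Lemma bsum_sqr_le c N M :
  (M <= N)%N -> hnorm (bsum c N - bsum c M) ^+ 2 <= \sum_(M <= n < N) csq (c n).
Proof.
move=> MN; rewrite /bsum (sum_ord_split (fun n => c n *: e n) MN) addrAC subrr add0r.
rewrite hnorm_sqr; elim: N MN => [|N ih].
  by rewrite leqn0 => /eqP ->; rewrite !big_geq// hip0r.
rewrite leq_eqVlt => /orP[/eqP ->|]; first by rewrite !big_geq// hip0r.
rewrite ltnS => MN; rewrite !big_nat_recr//=.
have z : hip (e N) (\sum_(M <= i < N) c i *: e i) = 0.
  rewrite hip_sumr big_nat_cond big1// => i /andP[/andP[_ iN] _].
  by rewrite hipZr basis_orth ?mulr0// gtn_eqF.
rewrite hipDl !hipDr !hipZr !hipZl z (hip_conj (e N)) z rmorph0 !mulr0 add0r addr0.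
rewrite cReD lerD ?ih// mulrA [c N * _]mulrC mul_conjE.
by case: (basis_unit N) => ->; rewrite ?hip0r ?mulr1 ?mulr0//= csq_ge0.
Qed.

Lemma riesz_fischer (c : nat -> R[i]) (B : R) :
  (forall N, \sum_(n < N) csq (c n) <= B) -> exists l, hcvg (bsum c) l.
Proof.
move=> cB; have [S cS leS] := bounded_series_cvg (fun n => csq_ge0 (c n)) cB.
apply: hilbert_complete => eps eps0.
have eps2 : 0 < eps ^+ 2 by rewrite exprn_gt0.
have /cvgrPdist_lt/(_ _ eps2)[N _ hN] := cS.
exists N => p q Np Nq.
wlog pq : p q Np Nq / (p <= q)%N => [hw|].
  by case: (leqP p q) => [|/ltnW] pq; [|rewrite -[ip_norm _ _]/(hnorm _) hnormBC]; exact: hw.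
rewrite -[ip_norm _ _]/(hnorm _) hnormBC.
rewrite -(@ltr_pXn2r _ 2)// ?nnegrE ?hnorm_ge0 ?(ltW eps0)//.
apply: le_lt_trans (bsum_sqr_le c pq) _.
apply: le_lt_trans (hN _ Np).
apply: le_trans (ler_norm _); rewrite lerBrDl -sum_ord_split//.
Qed.

Definition bproj N v : H := bsum (fun n => hip (e n) v) N.

Lemma rip_bproj N v : rip v (bproj N v) = \sum_(n < N) csq (hip (e n) v).
Proof.
rewrite hip_sumr cRe_sum; apply: eq_bigr => i _.
by rewrite hipZr (hip_conj (e i) v) mulrC mul_conjE.
Qed.

(** The sum equals [rip v (bproj N v)] and bounds the squared norm of the projection. Cauchy-Schwarz
    then gives first that the projection is no longer than [v], and next the claim. *)
Lemma bessel N v : \sum_(n < N) csq (hip (e n) v) <= hnorm v ^+ 2.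
Proof.
have h : hnorm (bproj N v) ^+ 2 <= \sum_(n < N) csq (hip (e n) v).
  have := bsum_sqr_le (fun n => hip (e n) v) (leq0n N).
  by rewrite {2}/bsum big_ord0 subr0 big_mkord.
rewrite -rip_bproj in h *.
have := rip_le_hnorm v (bproj N v); have := hnorm_ge0 v; have := hnorm_ge0 (bproj N v).
by nra.
Qed.

Lemma hnorm_bproj N v : hnorm (bproj N v) <= hnorm v.
Proof.
rewrite -(@ler_pXn2r _ 2)// ?nnegrE ?hnorm_ge0//.
apply: le_trans (bessel N v).
have := bsum_sqr_le (fun n => hip (e n) v) (leq0n N).
by rewrite {2}/bsum big_ord0 subr0 big_mkord.
Qed.

(** The projections converge to some [l] by [riesz_fischer]. Their inner product with [e i] is
    constant once [N > i], so [v - l] is orthogonal to the whole basis and hence null. *)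
Lemma bproj_cvg v : hcvg (bproj^~ v) v.
Proof.
have [l cl] := @riesz_fischer (fun n => hip (e n) v) _ (bessel^~ v).
suff vl : v = l by rewrite [X in hcvg _ X]vl.
apply/eqP; rewrite -subr_eq0; apply/eqP; apply: basis_total => i.
rewrite hipBr; apply/eqP; rewrite subr_eq0; apply/eqP.
(* Convergence is available for real parts; testing against [e i] and its product with the imaginary
   unit recovers both parts of the inner product. *)
suff h w : w = e i \/ w = Complex 0 1 *: e i -> rip w v = rip w l.
  apply: complex_eq; first by apply: h; left.
  have imE x : complex.Im (hip (e i) x) = rip (Complex 0 1 *: e i) x.
    by rewrite rip_sym (hip_conj x) cImC Im_hipE opprK.
  by rewrite !imE h//; right.
move=> hw; have h1 := hcvg_rip (w := w) cl.
suff h2 : (fun k => rip w (bproj k v)) @ \oo --> rip w v.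
  by rewrite -(cvg_lim (@Rhausdorff R) h2); exact: cvg_lim h1.
apply: cvg_near_cst; near=> N.
have iN : (i < N)%N by near: N; exact: nbhs_infty_gt.
have hi : hip (e i) v = hip (e i) (bproj N v).
  rewrite hip_bsum//; case: (basis_unit i) => ->; rewrite ?mulr1//.
  by rewrite !hip0l mul0r.
by case: hw => ->; rewrite ?hipZl hi.
Unshelve. all: by end_near. Qed.

End basis.

Section linear_maps.
Context {R : realType} {H K : hilbert R}.
Variable T : H -> K.
Hypothesis linT : linear T.

Lemma linear_opD u v : T (u + v) = T u + T v.
Proof. by have := linT 1 u v; rewrite !scale1r. Qed.

Lemma linear_op0 : T 0 = 0.
Proof. by apply: (addrI (T 0)); rewrite -linear_opD !addr0. Qed.

Lemma linear_opZ a u : T (a *: u) = a *: T u.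
Proof. by have := linT a u 0; rewrite !addr0 linear_op0 addr0. Qed.

Lemma linear_opN u : T (- u) = - T u.
Proof. by rewrite -scaleN1r linear_opZ scaleN1r. Qed.

Lemma linear_opB u v : T (u - v) = T u - T v.
Proof. by rewrite linear_opD linear_opN. Qed.

Lemma linear_op_sum (N : nat) (F : nat -> H) :
  T (\sum_(i < N) F i) = \sum_(i < N) T (F i).
Proof.
by elim: N => [|N ih]; [rewrite !big_ord0 linear_op0|rewrite !big_ord_recr/= linear_opD ih].
Qed.

End linear_maps.

Lemma bounded_opP (R : realType) (H K : hilbert R) (T : H -> K) :
  bounded_op T -> linear T /\
  exists2 c : R, 0 <= c & forall u, hnorm (T u) <= c * hnorm u.
Proof.
move=> [lT [c cT]]; split=> //; exists `|c| => // u.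
by apply: le_trans (cT u) _; rewrite ler_wpM2r ?hnorm_ge0 ?ler_norm.
Qed.

Lemma bounded_comp (R : realType) (H K L : hilbert R) (T : K -> L) (T' : H -> K) :
  bounded_op T -> bounded_op T' -> bounded_op (T \o T').
Proof.
move=> /bounded_opP[lT [c c0 cT]] /bounded_opP[lT' [c' c'0 cT']].
split=> [a u v|]; first by rewrite /= lT' lT.
exists (c * c') => u /=; apply: le_trans (cT _) _.
by rewrite -mulrA ler_wpM2l.
Qed.

Section riesz.
Context {R : realType} {H : hilbert R}.
Local Notation e := (@some_basis R H).

(** The representing vector has as coordinates the conjugates of [f (e n)]. On a partial sum of
    these, [f] takes as value the sum of their squared moduli, which is thereby at most [C], and
    [riesz_fischer] yields [l]. The difference of [f] and [hip l] is bounded and vanishes on the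
    basis, hence everywhere. *)
Lemma riesz (f : H -> R[i]) (C : R) : 0 <= C ->
  (forall a u v, f (a *: u + v) = a * f u + f v) ->
  (forall u, csq (f u) <= C * hnorm u ^+ 2) ->
  exists l, forall v, f v = hip l v.
Proof.
move=> C0 fL fC.
have fD u v : f (u + v) = f u + f v by have := fL 1 u v; rewrite scale1r mul1r.
have f0 : f 0 = 0 by apply: (addrI (f 0)); rewrite -fD !addr0.
have fZ a u : f (a *: u) = a * f u by have := fL a u 0; rewrite !addr0 f0 addr0.
have fS N (F : nat -> H) : f (\sum_(i < N) F i) = \sum_(i < N) f (F i).
  by elim: N => [|N ih]; [rewrite !big_ord0|rewrite !big_ord_recr/= fD ih].
pose c n := (f (e n))^*.
have cC N : \sum_(n < N) csq (c n) <= C.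
  set S := \sum_(_ < _) _.
  have fb : f (bsum c N : H) = Complex S 0.
    rewrite [bsum _ _]/bsum (fS N (fun n => c n *: e n)).
    apply: complex_eq; rewrite /= ?cRe_sum ?cIm_sum.
      by apply: eq_bigr => i _; rewrite fZ mul_conjE csqC.
    by rewrite big1// => i _; rewrite fZ mul_conjE.
  have bS : hnorm (bsum c N : H) ^+ 2 <= S.
    have := @bsum_sqr_le R H c _ _ (leq0n N).
    by rewrite [bsum _ 0%N]big_ord0 subr0 big_mkord.
  have S0 : 0 <= S by apply: sumr_ge0 => i _; exact: csq_ge0.
  have := fC (bsum c N : H); rewrite fb /csq /= (expr0n _ 2) addr0 => h.
  have h2 : S ^+ 2 <= C * S by apply: le_trans h _; rewrite ler_wpM2l.
  move: S0; rewrite le_eqVlt => /orP[/eqP <-//|S0].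
  by rewrite -(ler_pM2r S0).
have [l cl] := @riesz_fischer R H c C cC; exists l => v.
apply/eqP; rewrite -subr_eq0; apply/eqP/csq_eq0/eqP.
rewrite eq_le csq_ge0 andbT.
pose g u := f u - hip l u.
have gD u w : g (u - w) = g u - g w.
  by rewrite /g -scaleN1r fD fZ hipDr hipZr; ring.
(* The squared modulus of a difference is at most twice the sum of the squared moduli. *)
have gC u : csq (g u) <= 2 * (C + hnorm l ^+ 2) * hnorm u ^+ 2.
  have := fC u; have := csq_hip_le l u; rewrite /g /csq !(cReD, cImD, cReN, cImN).
  have := sqr_ge0 (complex.Re (f u) + complex.Re (hip l u)).
  have := sqr_ge0 (complex.Im (f u) + complex.Im (hip l u)).
  by move: (hnorm u ^+ 2) (hnorm l ^+ 2) => x y; lra.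
have ge i : g (e i) = 0.
  suff hl : hip (e i) l = c i * hip (e i) (e i).
    rewrite /g hip_conj hl rmorphM /= conjCK -hip_conj.
    case: (@basis_unit R H i) => ->; rewrite ?hip0l ?mulr1 ?subrr//.
    by rewrite f0 mulr0 subrr.
  have h2 w : w = e i \/ w = Complex 0 1 *: e i ->
      (fun k => rip w (bsum c k)) @ \oo --> complex.Re (hip w (c i *: e i)).
    move=> hw; apply: cvg_near_cst; near=> N.
    have iN : (i < N)%N by near: N; exact: nbhs_infty_gt.
    by case: hw => ->; rewrite ?hipZl hip_bsum// hipZr.
  have imE x : complex.Im (hip (e i) x) = rip (Complex 0 1 *: e i) x.
    by rewrite rip_sym (hip_conj x) cImC Im_hipE opprK.
  have h3 w : w = e i \/ w = Complex 0 1 *: e i ->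
      complex.Re (hip w l) = complex.Re (hip w (c i *: e i)).
    move=> hw; rewrite -(cvg_lim (@Rhausdorff R) (h2 w hw)).
    by apply/esym/(cvg_lim (@Rhausdorff R)); exact: hcvg_rip.
  rewrite -hipZr; apply: complex_eq; first by apply: h3; left.
  by rewrite !imE; apply: h3; right.
have gP N : g (bproj N v) = 0.
  have gS M (F : nat -> H) : g (\sum_(i < M) F i) = \sum_(i < M) g (F i).
    rewrite /g (fS M F) hip_sumr -sumrB //.
  rewrite /bproj /bsum (gS N (fun n => hip (e n) v *: e n)) big1// => i _.
  by rewrite /g fZ hipZr -mulrBr -/(g (e i)) ge mulr0.
have h := bproj_cvg v.
apply: (@cvgn_eq0 _ (fun N => 2 * (C + hnorm l ^+ 2) * hnorm (bproj N v - v) ^+ 2)).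
  rewrite -(mulr0 (2 * (C + hnorm l ^+ 2))); apply: cvgMr.
  under eq_fun do rewrite expr2.
  have := cvgM h h; rewrite mulr0; exact.
move=> k; rewrite -/(g v).
by apply: le_trans (gC _); rewrite gD gP sub0r /csq cReN cImN !sqrrN.
Unshelve. all: by end_near. Qed.

End riesz.

Section adjoint.
Context {R : realType} {H K : hilbert R}.
Variable T : H -> K.

Lemma adj_unique B B' : (forall u v, hip (T u) v = hip u (B v)) ->
  (forall u v, hip (T u) v = hip u (B' v)) -> B = B'.
Proof. by move=> h h'; apply/funext => v; apply: hip_ext => w; rewrite -h -h'. Qed.

Lemma adjE B : (forall u v, hip (T u) v = hip u (B v)) -> adj T = B.
Proof. by move=> h; apply: xget_unique => // B' h'; exact: adj_unique h' h. Qed.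

Hypothesis bT : bounded_op T.

(** Since [adj] is a choice, an adjoint has to exist: its value at [v] is the Riesz vector of the
    functional [u |-> hip v (T u)]. *)
Lemma adjP u v : hip (T u) v = hip u (adj T v).
Proof.
have [lT [c c0 cT]] := bounded_opP bT.
have : forall v, exists l, forall u, hip v (T u) = hip l u.
  move=> w; apply: (@riesz _ _ _ (hnorm w ^+ 2 * c ^+ 2)).
  - by rewrite mulr_ge0 ?sqr_ge0.
  - by move=> a x y; rewrite lT hip_linear.
  - move=> x; apply: le_trans (csq_hip_le _ _) _.
    rewrite -mulrA ler_wpM2l ?sqr_ge0// -exprMn.
    by rewrite ler_pXn2r// ?nnegrE ?mulr_ge0 ?hnorm_ge0.
move=> /choice[B hB].
have hB' x y : hip (T x) y = hip x (B y) by rewrite hip_conj hB -hip_conj.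
by rewrite (adjE hB').
Qed.

Lemma hnorm_adj_le c : 0 <= c -> (forall u, hnorm (T u) <= c * hnorm u) ->
  forall v, hnorm (adj T v) <= c * hnorm v.
Proof.
move=> c0 cT v.
have h : hnorm (adj T v) ^+ 2 <= c * hnorm (adj T v) * hnorm v.
  rewrite hnorm_sqr -adjP; apply: le_trans (rip_le_hnorm _ _) _.
  by rewrite ler_wpM2r ?hnorm_ge0.
have := hnorm_ge0 (adj T v); rewrite le_eqVlt => /orP[/eqP e0|p].
  by rewrite -e0 mulr_ge0 ?hnorm_ge0.
by rewrite -(ler_pM2l p) -expr2 mulrA [_ * c]mulrC.
Qed.

End adjoint.

Section unitary.
Context {R : realType} {H K : hilbert R}.
Variable V : H -> K.
Hypothesis uV : unitary_op V.

Lemma unitary_linear : linear V. Proof. by case: uV. Qed.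

Lemma unitary_hip u v : hip (V u) (V v) = hip u v.
Proof. by case: uV. Qed.

Lemma unitary_hnorm u : hnorm (V u) = hnorm u.
Proof. by rewrite /hnorm /ip_norm unitary_hip. Qed.

Lemma unitary_bounded : bounded_op V.
Proof.
by split; [exact: unitary_linear|exists 1 => u; rewrite mul1r unitary_hnorm].
Qed.

Lemma unitary_adjK : cancel V (adj V).
Proof.
move=> u; apply: hip_ext => w; rewrite -(adjP unitary_bounded).
by rewrite unitary_hip.
Qed.

Lemma unitary_Kadj : cancel (adj V) V.
Proof. by case: uV => _ _ /[swap] v /(_ v)[u <-]; rewrite unitary_adjK. Qed.

Lemma hip_unitary u v : hip u (V v) = hip (adj V u) v.
Proof. by rewrite -{1}(unitary_Kadj u) unitary_hip. Qed.

Lemma adj_unitary : unitary_op (adj V).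
Proof.
split.
- move=> a u v; apply: (can_inj unitary_adjK).
  by rewrite unitary_Kadj unitary_linear !unitary_Kadj.
- by move=> u v; rewrite -hip_unitary unitary_Kadj.
- by move=> v; exists (V v); rewrite unitary_adjK.
Qed.

Lemma adj_adj_unitary : adj (adj V) = V.
Proof. by apply: adjE => u v; rewrite hip_unitary. Qed.

End unitary.

(** * Trace *)

(** A competitor with finite sum in the infimum that defines [trace_norm]. Finiteness is put as a
    bound on the real partial sums, which avoids extended reals. *)
Definition expansion (R : realType) (H K : hilbert R) (T : H -> K)
    (xi : nat -> K) (eta : nat -> H) :=
  (forall v, (fun N => hnorm (T v - \sum_(k < N) hip (eta k) v *: xi k))
    @ \oo --> (0 : R)) /\
  exists B : R, forall N, \sum_(k < N) hnorm (xi k) * hnorm (eta k) <= B.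

Definition has_expansion (R : realType) (H K : hilbert R) (T : H -> K) :=
  exists xi eta, expansion T xi eta.

Section expansions.
Context {R : realType}.
Implicit Types H K L : hilbert R.

Lemma expansion_cvg H K (T : H -> K) xi eta v : expansion T xi eta ->
  hcvg (fun N => \sum_(k < N) hip (eta k) v *: xi k) (T v).
Proof. by move=> [/(_ v) h _]; rewrite /hcvg; under eq_fun do rewrite hnormBC. Qed.

Lemma trace_class_expansion H K (T : H -> K) : trace_class T -> has_expansion T.
Proof.
move=> [bT /ereal_inf_lt[_ [xi [eta [cT ->]]]]] fin.
exists xi, eta; split=> //.
set s := (\sum_(_ <= _ <oo) _)%E in fin.
have s0 : (0 <= s)%E by apply: nneseries_ge0 => k _ _; rewrite lee_fin mulr_ge0// hnorm_ge0.
exists (fine s) => N; rewrite -lee_fin fineK ?ge0_fin_numE// -sumEFin.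
rewrite -(big_mkord xpredT (fun k => (hnorm (xi k) * hnorm (eta k))%:E)).
by apply: nneseries_lim_ge => k _ _; rewrite lee_fin mulr_ge0// hnorm_ge0.
Qed.

Lemma expansion_compl H K L (T : H -> K) (B : K -> L) xi eta :
  bounded_op B -> expansion T xi eta -> expansion (B \o T) (B \o xi) eta.
Proof.
move=> /bounded_opP[lB [c c0 cB]] [cT [b bb]]; split=> [v|].
- apply: (@cvg0_le _ _ (fun N => c * hnorm (T v - \sum_(k < N) hip (eta k) v *: xi k))).
    move=> N; rewrite hnorm_ge0/=; apply: le_trans (cB _).
    rewrite linear_opB// (linear_op_sum lB N (fun k => hip (eta k) v *: xi k)).
    rewrite (_ : (\sum_(k < N) B (hip (eta k) v *: xi k)) = \sum_(k < N) hip (eta k) v *: B (xi k))//.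
    by apply: eq_bigr => k _; rewrite linear_opZ.
  by rewrite -(mulr0 c); apply: cvgMr; exact: cT.
- exists (c * b) => N; apply: (@le_trans _ _ (c * \sum_(k < N) hnorm (xi k) * hnorm (eta k))).
    by rewrite mulr_sumr; apply: ler_sum => k _; rewrite mulrA ler_wpM2r ?hnorm_ge0//; exact: cB.
  by rewrite ler_wpM2l.
Qed.

(** [B] moves to the other side of [hip (eta k)] as its adjoint. *)
Lemma expansion_compr H K L (T : K -> L) (B : H -> K) xi eta :
  bounded_op B -> expansion T xi eta -> expansion (T \o B) xi (adj B \o eta).
Proof.
move=> bB [cT [b bb]]; have [lB [c c0 cB]] := bounded_opP bB; split=> [v|].
- have := cT (B v); apply: cvg_trans; apply: near_eq_cvg; near=> N => /=.
  congr (hnorm (_ - _)); apply: eq_bigr => k _.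
  by rewrite (hip_conj (B v)) adjP// -hip_conj.
- exists (c * b) => N; apply: (@le_trans _ _ (c * \sum_(k < N) hnorm (xi k) * hnorm (eta k))).
    rewrite mulr_sumr; apply: ler_sum => k _; rewrite mulrCA ler_wpM2l ?hnorm_ge0//.
    exact: hnorm_adj_le.
  by rewrite ler_wpM2l.
Unshelve. all: by end_near. Qed.

Lemma has_expansion_compl H K L (T : H -> K) (B : K -> L) :
  bounded_op B -> has_expansion T -> has_expansion (B \o T).
Proof.
by move=> bB [xi [eta h]]; exists (B \o xi), eta; exact: expansion_compl.
Qed.

Lemma has_expansion_compr H K L (T : K -> L) (B : H -> K) :
  bounded_op B -> has_expansion T -> has_expansion (T \o B).
Proof.
by move=> bB [xi [eta h]]; exists xi, (adj B \o eta); exact: expansion_compr.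
Qed.

Local Notation e := (@some_basis R _).

(* Tannery's theorem, applied to [Tr T = lim_N sum_k <eta_k, P_N xi_k>], where
   [P_N] is the projection onto the first [N] basis vectors. *)
Lemma expansion_Re_tr H (T : H -> H) xi eta : expansion T xi eta ->
  exists2 L : R, (fun N => \sum_(k < N) rip (eta k) (xi k)) @ \oo --> L &
    (fun N => complex.Re (\sum_(n < N) hip (e n) (T (e n)))) @ \oo --> L.
Proof.
move=> ex; have [cT [B bB]] := ex.
apply: (@tannery _ (fun N k => rip (eta k) (bproj N (xi k)))
  (fun k => hnorm (xi k) * hnorm (eta k)) (fun k => rip (eta k) (xi k))
  (fun N => complex.Re (\sum_(n < N) hip (e n) (T (e n)))) B) => //.
- move=> N k; apply: le_trans (norm_rip_le _ _) _.
  by rewrite mulrC ler_wpM2r ?hnorm_ge0 ?hnorm_bproj.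
- by move=> k; apply: hcvg_rip; exact: bproj_cvg.
- move=> N.
  have -> : (fun m => \sum_(k < m) rip (eta k) (bproj N (xi k))) =
    (fun m => \sum_(n < N) rip (e n) (\sum_(k < m) hip (eta k) (e n) *: xi k)).
    apply/funext => m.
    under [RHS]eq_bigr do rewrite hip_sumr cRe_sum.
    rewrite exchange_big; apply: eq_bigr => k _ /=.
    rewrite hip_sumr cRe_sum; apply: eq_bigr => n _.
    by rewrite !hipZr mulrC.
  rewrite cRe_sum; apply: cvg_big => [|n _]; first exact: add_continuous.
  by apply: hcvg_rip; exact: expansion_cvg.
Qed.

(** The imaginary part is the real part of the trace of [- i T]. Neither sum involves the chosen
    basis, which is what lets traces on different spaces be compared. *)
Lemma expansion_tr H (T : H -> H) xi eta : expansion T xi eta ->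
  (fun N => \sum_(k < N) rip (eta k) (xi k)) @ \oo --> complex.Re (tr T) /\
  (fun N => \sum_(k < N) complex.Im (hip (eta k) (xi k))) @ \oo --> complex.Im (tr T).
Proof.
move=> ex; split.
  have [L cL cT] := expansion_Re_tr ex.
  by rewrite /= (cvg_lim (@Rhausdorff R) cT).
have bI : bounded_op (fun u : H => - Complex 0 1 *: u).
  split; first by move=> a u v; rewrite scalerDr !scalerA mulrC.
  by exists (Num.sqrt (csq (- Complex 0 1))) => u; rewrite hnormZ.
have [L cL cT] := expansion_Re_tr (expansion_compl bI ex).
have imE (u v : H) : rip u (- Complex 0 1 *: v) = complex.Im (hip u v).
  by rewrite scaleNr hipNr cReN -Im_hipE.
have -> : (fun N => \sum_(k < N) complex.Im (hip (eta k) (xi k))) =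
    (fun N => \sum_(k < N) rip (eta k) (((fun u => - Complex 0 1 *: u) \o xi) k)).
  by apply/funext => N; apply: eq_bigr => k _; rewrite imE.
suff -> : complex.Im (tr T) = L by [].
rewrite /tr /=; apply: (cvg_lim (@Rhausdorff R)).
apply: cvg_trans cT; apply: near_eq_cvg; near=> N.
by rewrite cRe_sum cIm_sum; apply: eq_bigr => n _; rewrite imE.
Unshelve. all: by end_near. Qed.

Lemma tr_unique_expansion H K (T : H -> H) (S : K -> K) xi eta xi' eta' :
  expansion T xi eta -> expansion S xi' eta' ->
  (forall k, hip (eta k) (xi k) = hip (eta' k) (xi' k)) -> tr T = tr S.
Proof.
move=> /expansion_tr[h1 h2] /expansion_tr[h3 h4] h.
apply: complex_eq.
  rewrite -(cvg_lim (@Rhausdorff R) h1) -(cvg_lim (@Rhausdorff R) h3).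
  by congr (lim _); under eq_fun do under eq_bigr do rewrite h.
rewrite -(cvg_lim (@Rhausdorff R) h2) -(cvg_lim (@Rhausdorff R) h4).
by congr (lim _); under eq_fun do under eq_bigr do rewrite h.
Qed.

(** [V] need not map the chosen basis of [H] to that of [K]. It does map an expansion of [T] to one
    of the conjugate operator, with the same inner products [hip (eta k) (xi k)]. *)
Lemma tr_unitary H K (V : H -> K) (T : H -> H) : unitary_op V ->
  has_expansion T -> tr (V \o T \o adj V) = tr T.
Proof.
move=> uV [xi [eta ex]].
have ex' := expansion_compr (unitary_bounded (adj_unitary uV))
  (expansion_compl (unitary_bounded uV) ex).
apply: tr_unique_expansion ex' ex _ => k /=.
by rewrite adj_adj_unitary// unitary_hip.
Qed.

Lemma trace_norm_expansion H K (T : H -> K) xi eta : expansion T xi eta ->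
  (trace_norm T < +oo)%E.
Proof.
move=> [cT [B bB]]; apply: (@le_lt_trans _ _ B%:E); last exact: ltry.
apply: (@le_trans _ _ (\sum_(0 <= k <oo) (hnorm (xi k) * hnorm (eta k))%:E)%E).
  by apply: ereal_inf_lbound; exists xi, eta.
apply: lime_le.
  by apply: is_cvg_nneseries => k _ _; rewrite lee_fin mulr_ge0// hnorm_ge0.
by apply: nearW => N; rewrite big_mkord sumEFin lee_fin.
Qed.

Lemma trace_classP H K (T : H -> K) :
  trace_class T <-> bounded_op T /\ has_expansion T.
Proof.
split=> [tT|[bT [xi [eta ex]]]]; first by split; [case: tT|exact: trace_class_expansion].
by split=> //; exact: trace_norm_expansion ex.
Qed.

Lemma trace_class_compl H K L (T : H -> K) (B : K -> L) :
  bounded_op B -> trace_class T -> trace_class (B \o T).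
Proof.
move=> bB /trace_classP[bT eT]; apply/trace_classP; split; first exact: bounded_comp.
exact: has_expansion_compl.
Qed.

Lemma trace_class_compr H K L (T : K -> L) (B : H -> K) :
  bounded_op B -> trace_class T -> trace_class (T \o B).
Proof.
move=> bB /trace_classP[bT eT]; apply/trace_classP; split; first exact: bounded_comp.
exact: has_expansion_compr.
Qed.

Definition rank_one H K (a : K) (b : H) : H -> K := fun v => hip b v *: a.

Lemma expansion_rank_one H K (a : K) (b : H) :
  expansion (rank_one a b) (fun k => if k == 0%N then a else 0) (fun=> b).
Proof.
split=> [v|].
- apply: cvg_near_cst; near=> N.
  have N0 : (0 < N)%N by near: N; exact: nbhs_infty_gt.
  rewrite -(prednK N0) big_ord_recl /= big1 ?addr0 ?subrr ?hnorm0// => i _.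
  by rewrite scaler0.
- exists (hnorm a * hnorm b) => -[|N].
    by rewrite big_ord0 mulr_ge0// hnorm_ge0.
  rewrite big_ord_recl /= big1 ?addr0// => i _.
  by rewrite hnorm0 mul0r.
Unshelve. all: by end_near. Qed.

Lemma rank_one_trace_class H K (a : K) (b : H) : trace_class (rank_one a b).
Proof.
apply/trace_classP; split; last first.
  by eexists; eexists; exact: expansion_rank_one.
split; first by move=> c u v; rewrite /rank_one hip_linear scalerDl scalerA.
exists (hnorm b * hnorm a) => u; rewrite hnormZ.
apply: (@le_trans _ _ (hnorm b * hnorm u * hnorm a)); last by rewrite mulrAC.
rewrite ler_wpM2r ?hnorm_ge0// -[leRHS]ger0_norm ?mulr_ge0 ?hnorm_ge0//.
by rewrite -sqrtr_sqr ler_wsqrtr// exprMn csq_hip_le.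
Qed.

Lemma tr_rank_one H (a b : H) : tr (rank_one a b) = hip b a.
Proof.
have [h1 h2] := expansion_tr (expansion_rank_one a b).
have hE (F : R[i] -> R) : F 0 = 0 ->
    (fun N => \sum_(k < N) F (hip b (if k == 0%N :> nat then a else 0))) @ \oo --> F (hip b a).
  move=> F0; apply: cvg_near_cst; near=> N.
  have N0 : (0 < N)%N by near: N; exact: nbhs_infty_gt.
  rewrite -(prednK N0) big_ord_recl /= big1 ?addr0// => i _.
  by rewrite hip0r F0.
apply: complex_eq.
  rewrite -(cvg_lim (@Rhausdorff R) h1).
  by apply: (cvg_lim (@Rhausdorff R)); exact: (hE (@complex.Re R)).
rewrite -(cvg_lim (@Rhausdorff R) h2).
by apply: (cvg_lim (@Rhausdorff R)); exact: (hE (@complex.Im R)).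
Unshelve. all: by end_near. Qed.

(** Rank-one tests suffice: [rank_one a b \o S] has trace [hip b (S a)]. The uniqueness of ultraweak
    integrals rests on this. *)
Lemma bounded_op_tr_unique H K (T T' : H -> K) : bounded_op T -> bounded_op T' ->
  (forall rho : K -> H, trace_class rho -> tr (rho \o T) = tr (rho \o T')) -> T = T'.
Proof.
move=> bT bT' h; apply/funext => a; apply: hip_ext => b.
have rE (S : H -> K) : bounded_op S -> tr (rank_one a b \o S) = hip b (S a).
  move=> bS; have -> : rank_one a b \o S = rank_one a (adj S b).
    by apply/funext => v; rewrite /rank_one /= (hip_conj (S v)) adjP// -hip_conj.
  by rewrite tr_rank_one (hip_conj a) -adjP// -hip_conj.
by rewrite -!rE// h//; exact: rank_one_trace_class.
Qed.

End expansions.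

(** * The groupoid *)

Section matrix_topology.
Context {R : realType}.

Lemma continuous_mx (T : topologicalType) m n (f : T -> 'M[R]_(m, n)) x :
  (forall i j, {for x, continuous (fun t => f t i j)}) -> {for x, continuous f}.
Proof.
move=> cf; apply/cvg_ballP => e e0.
have h i j : \forall y \near x, ball (f x i j) e (f y i j).
  by have /cvg_ballP/(_ e e0) := cf i j.
have : \forall y \near x, forall i, forall j, ball (f x i j) e (f y i j).
  by apply: filter_forall => i; apply: filter_forall => j; exact: h.
by apply: filterS => y hy; split.
Qed.

Lemma continuous_coord (T : topologicalType) m n (f : T -> 'M[R]_(m, n)) x i j :
  {for x, continuous f} -> {for x, continuous (fun t => f t i j)}.
Proof.
by move=> cf; apply: (@continuous_comp _ _ _ f (fun M => M i j)) => //; exact: matrix_normedtype.coord_continuous.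
Qed.

Lemma continuous_mulmx (T : topologicalType) m n p
    (f : T -> 'M[R]_(m, n)) (g : T -> 'M[R]_(n, p)) x :
  {for x, continuous f} -> {for x, continuous g} ->
  {for x, continuous (fun t => f t *m g t)}.
Proof.
move=> cf cg; apply: continuous_mx => i j.
have -> : (fun t => (f t *m g t) i j) = (fun t => \sum_k f t i k * g t k j).
  by apply/funext => t; rewrite mxE.
apply: cvg_big => [|k _]; first exact: add_continuous.
by apply: cvgM; exact: continuous_coord.
Qed.

Lemma continuous_det (T : topologicalType) n (f : T -> 'M[R]_n) x :
  {for x, continuous f} -> {for x, continuous (fun t => \det (f t))}.
Proof.
move=> cf; apply: cvg_big => [|s _]; first exact: add_continuous.
apply: cvgMr; apply: cvg_big => [|i _]; first exact: mul_continuous.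
exact: continuous_coord.
Qed.

Lemma continuous_near_eq (T U : topologicalType) (f g : T -> U) x :
  {near x, f =1 g} -> {for x, continuous f} -> {for x, continuous g}.
Proof.
move=> fg cf; have fgx : f x = g x := nbhs_singleton fg.
rewrite /prop_for /continuous_at -fgx; apply: cvg_trans cf.
by apply: near_eq_cvg; apply: filterS fg => y /esym.
Qed.

Lemma open_setI_preimage (T U : topologicalType) (f : T -> U) (O : set T) (W : set U) :
  open O -> open W -> (forall x, O x -> {for x, continuous f}) ->
  open (O `&` f @^-1` W).
Proof.
move=> oO oW cf; rewrite openE => x [Ox Wx]; apply: filterI; first exact: open_nbhs_nbhs.
by apply: (cf x Ox); exact: open_nbhs_nbhs.
Qed.

End matrix_topology.

Section charts.
Context {R : realType} {n : nat} {M : ptopologicalType}.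
Variable A : oriented_manifold R n M.
Implicit Types c : chart A.

Lemma tangent_chart x (v : tangent A x) c c' : dom c x -> dom c' x ->
  v c' = v c *m jac c c' x.
Proof. by case: v => v /= /asboolP[_ h]; exact: h. Qed.

(** The components in the other charts around [x] follow by the Jacobians, and those in charts away
    from [x] are null by convention. *)
Lemma tangent_eq x (u v : tangent A x) c : dom c x -> u c = v c -> u = v.
Proof.
move=> cx uv; apply/val_inj/funext => c'.
have [c'x|c'x] := pselect (dom c' x).
  by rewrite /= (tangent_chart u cx c'x) (tangent_chart v cx c'x) uv.
by case: u v uv => u /asboolP[u0 _] [v /asboolP[v0 _]] _ /=; rewrite u0// v0.
Qed.

Lemma det_jac_gt0 x c c' : dom c x -> dom c' x -> 0 < \det (jac c c' x).
Proof. by move=> cx c'x; exact: change_oriented. Qed.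

Lemma jac_unit x c c' : dom c x -> dom c' x -> jac c c' x \in unitmx.
Proof. by move=> cx c'x; rewrite unitmxE unitfE gt_eqF// det_jac_gt0. Qed.

(** The cocycle rule makes this matrix idempotent, and it is invertible. *)
Lemma jac_id x c : dom c x -> jac c c x = 1%:M.
Proof.
move=> cx; apply: (can_inj (mulKmx (jac_unit cx cx))).
by rewrite mulmx1 -jac_comp.
Qed.

Lemma tvec_self c x u : dom c x -> tvec c x u c = u.
Proof.
move=> cx; rewrite /= /tvec_fun; case: asboolP => [_|[]//].
by rewrite jac_id// mulmx1.
Qed.

Lemma tangentD x (u v : tangent A x) c : (u + v) c = u c + v c.
Proof. by []. Qed.

Lemma tangentZ x a (v : tangent A x) c : (a *: v) c = a *: v c.
Proof. by []. Qed.

Lemma tangent_sum x I (r : seq I) (F : I -> tangent A x) c :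
  (\sum_(i <- r) F i) c = \sum_(i <- r) F i c.
Proof. by elim/big_rec2 : _ => // i a b _ <-; rewrite tangentD. Qed.

Lemma tangent_partial x (v : tangent A x) c : dom c x ->
  v = \sum_i v c 0 i *: partial c x i.
Proof.
move=> cx; apply: (tangent_eq cx); rewrite tangent_sum.
under eq_bigr do rewrite tangentZ tvec_self//.
exact: row_sum_delta.
Qed.

Lemma open_dom_coord c c' : open (coord c @` (dom c `&` dom c')).
Proof.
have -> : coord c @` (dom c `&` dom c') = 
    coord c @` dom c `&` param c @^-1` dom c'.
  apply/seteqP; split=> [_ [x [cx c'x] <-]|_ [[x cx <-]]].
    by split; [exists x|rewrite /= coordK].
  by rewrite /= coordK// => c'x; exists x.
apply: open_setI_preimage; [exact: coord_open|exact: dom_open|].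
by move=> _ [x cx <-]; exact: param_continuous.
Qed.

Lemma smooth_on_continuous (V W : normedModType R) (U : set V) (f : V -> W) x :
  smooth_on U f -> U x -> {for x, continuous f}.
Proof. by move=> /(_ 0%N) h; exact: h. Qed.

(** Row [i] of the Jacobian is the derivative in the direction [delta_mx 0 i], continuous because
    the change of charts is C^1. *)
Lemma jac_continuous c c' u : (coord c @` (dom c `&` dom c')) u ->
  {for u, continuous (fun u => jac c c' (param c u))}.
Proof.
move=> Uu; have [df cdf] := change_smooth c c' 1%N.
have nU : \forall w \near u, (coord c @` (dom c `&` dom c')) w.
  by apply: open_nbhs_nbhs; split=> //; exact: open_dom_coord.
apply: (@continuous_near_eq _ _ (fun u => jacobian (coord c' \o param c) u)).
  by apply: filterS nU => _ [x [cx _] <-]; rewrite /jac coordK.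
apply: continuous_mx => i j.
apply: (@continuous_near_eq _ _
    (fun w => 'D_(delta_mx 0 i) (coord c' \o param c) w 0 j)).
  apply: filterS nU => w Uw.
  have e1 : 'D_(delta_mx 0 i) (coord c' \o param c) w =
    (delta_mx 0 i : 'rV[R]_n) *m jacobian (coord c' \o param c) w :=
    deriveEjacobian _ (df w Uw).
  by apply: (etrans (congr1 (fun m : 'rV[R]_n => m 0 j) e1)); rewrite -rowE mxE.
by apply: continuous_coord; exact: cdf.
Qed.

End charts.

(** * Linear algebra of Lorentz isometries, and inverses of arrows *)

Section lorentz.
Context {R : realType} {n : nat} {M : ptopologicalType}.
Context {A : oriented_manifold R n M}.
Variable S : spacetime A.
Local Notation met := (metric S).

Lemma metricDl x (u v w : tangent A x) : met (u + v) w = met u w + met v w.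
Proof. by have := metric_linear S 1 u v w; rewrite scale1r mul1r. Qed.

Lemma metric0l x (w : tangent A x) : met 0 w = 0.
Proof. by apply: (addrI (met 0 w)); rewrite -metricDl !addr0. Qed.

Lemma metricZl x a (u w : tangent A x) : met (a *: u) w = a * met u w.
Proof. by have := metric_linear S a u 0 w; rewrite !addr0 metric0l addr0. Qed.

Lemma metricZr x a (u w : tangent A x) : met w (a *: u) = a * met w u.
Proof. by rewrite metric_sym metricZl metric_sym. Qed.

Lemma metricDr x (u v w : tangent A x) : met w (u + v) = met w u + met w v.
Proof. by rewrite metric_sym metricDl !(metric_sym S w). Qed.

Lemma metric_suml x (I : Type) (r : seq I) (F : I -> tangent A x) w :
  met (\sum_(i <- r) F i) w = \sum_(i <- r) met (F i) w.
Proof.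
by elim/big_rec2 : _ => [|i a b _ <-]; rewrite ?metric0l// metricDl.
Qed.

Definition gram c x : 'M[R]_n := \matrix_(i, j) met (partial c x i) (partial c x j).

Lemma metric_gram x (u v : tangent A x) (c : chart A) : dom c x ->
  met u v = (u c *m gram c x *m (v c)^T) 0 0.
Proof.
move=> cx; rewrite {1}(tangent_partial u cx) metric_suml -mulmxA mxE.
apply: eq_bigr => i _; rewrite metricZl; congr (_ * _).
rewrite {1}(tangent_partial v cx) metric_sym metric_suml mxE.
by apply: eq_bigr => j _; rewrite metricZl metric_sym !mxE mulrC.
Qed.

Lemma gram_frame x (c : chart A) (e : 'I_n -> tangent A x) : dom c x ->
  (\matrix_(i, j) met (e i) (e j)) =
  (\matrix_(i, j) e i c 0 j) *m gram c x *m (\matrix_(i, j) e i c 0 j)^T.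
Proof.
move=> cx; apply/matrixP => i j; rewrite [LHS]mxE (metric_gram _ _ cx).
have eE k : e k c = row k (\matrix_(i, j) e i c 0 j).
  by apply/rowP => l; rewrite !mxE.
by rewrite (eE i) (eE j) tr_row -row_mul mxE [RHS]mxE; apply: eq_bigr => k _; rewrite !mxE.
Qed.

Lemma det_lorentz_basis x (e : 'I_n -> tangent A x) :
  (forall i j, met (e i) (e j) = if i == j then (if val i == 0%N then -1 else 1) else 0) ->
  \det (\matrix_(i, j) met (e i) (e j)) != 0.
Proof.
move=> he; have -> : \matrix_(i, j) met (e i) (e j) =
    diag_mx (\row_i (if val i == 0%N then -1 else 1)).
  by apply/matrixP => i j; rewrite !mxE he; case: eqP => [->|]; rewrite ?mulr1n ?mulr0n.
rewrite det_diag; apply/prodf_neq0 => i _; rewrite mxE.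
by case: ifP => _; rewrite ?oppr_eq0 oner_eq0.
Qed.

(** The Gram matrix of a Lorentz basis is diagonal with entries [1] and [-1], and it is the product
    of [gram c x] with the frame matrix and its transpose. *)
Lemma gram_unit x (c : chart A) : dom c x -> gram c x \in unitmx.
Proof.
move=> cx; have [e he] := metric_lorentzian S x.
have := det_lorentz_basis he; rewrite (gram_frame e cx) !det_mulmx.
by rewrite !mulf_eq0 !negb_or unitmxE unitfE => /andP[/andP[]].
Qed.

Lemma hom_mxP x y (f : hom S x y) (c c' : chart A) (v : tangent A x) : dom c x ->
  f v c' = v c *m hom_mx c c' f.
Proof.
move=> cx; rewrite {1}(tangent_partial v cx).
have lf := hom_linear f.
have f0 : f 0 = 0.
  by apply: (addrI (f 0)); have := lf 1 0 0; rewrite !scale1r !addr0.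
have -> (r : seq 'I_n) : f (\sum_(i <- r) v c 0 i *: partial c x i) =
    \sum_(i <- r) v c 0 i *: f (partial c x i).
  by elim: r => [|i r ih]; rewrite ?big_nil// !big_cons lf ih.
rewrite tangent_sum; apply/rowP => j; rewrite summxE mxE.
by apply: eq_bigr => i _; rewrite tangentZ !mxE.
Qed.

Lemma hom_mx_gram x y (f : hom S x y) (c c' : chart A) : dom c x -> dom c' y ->
  gram c x = hom_mx c c' f *m gram c' y *m (hom_mx c c' f)^T.
Proof.
move=> cx c'y; rewrite -gram_frame//; apply/matrixP => i j.
by rewrite !mxE hom_isometry.
Qed.

(** An isometry of nondegenerate metrics is injective: its matrix is a factor of the invertible
    [gram c x]. *)
Lemma hom_mx_unit x y (f : hom S x y) (c c' : chart A) : dom c x -> dom c' y ->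
  hom_mx c c' f \in unitmx.
Proof.
move=> cx c'y; have := gram_unit cx; rewrite (hom_mx_gram f cx c'y).
by rewrite !unitmx_mul => /andP[/andP[]].
Qed.

Lemma partial_oriented x (c : chart A) : dom c x -> oriented_frame (partial c x).
Proof.
move=> cx c' c'x; rewrite (_ : \matrix_(i, j) _ = jac c c' x) ?det_jac_gt0//.
apply/matrixP => i j; rewrite mxE (tangent_chart _ cx c'x) tvec_self//.
by rewrite -rowE mxE.
Qed.

Lemma det_hom_mx_gt0 x y (f : hom S x y) (c c' : chart A) : dom c x -> dom c' y ->
  0 < \det (hom_mx c c' f).
Proof. by move=> cx c'y; exact: (hom_orientation f (partial_oriented cx)). Qed.

Definition chart_at x : chart A := sval (cid (dom_cover A x)).

Lemma chart_atP x : dom (chart_at x) x.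
Proof. by rewrite /chart_at; case: cid. Qed.

Section inverse.
Context {x y : M}.
Variable f : hom S x y.

(** The record [hom] carries no inverse. It is obtained by inverting a matrix in two chosen charts,
    and the conditions of [hom] are then checked for it one by one. *)
Definition hom_inv_fun (v : tangent A y) : tangent A x :=
  tvec (chart_at x) x
    (v (chart_at y) *m invmx (hom_mx (chart_at x) (chart_at y) f)).

Lemma hom_invKfun : cancel hom_inv_fun f.
Proof.
move=> v; apply: (tangent_eq (chart_atP y)); rewrite (hom_mxP _ _ _ (chart_atP x)).
by rewrite tvec_self ?mulmxKV ?hom_mx_unit//; exact: chart_atP.
Qed.

Lemma hom_funK : cancel f hom_inv_fun.
Proof.
move=> v; apply: (tangent_eq (chart_atP x)); rewrite tvec_self; last exact: chart_atP.
by rewrite (hom_mxP _ _ _ (chart_atP x)) mulmxK// hom_mx_unit//; exact: chart_atP.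
Qed.

Lemma hom_inv_linear : linear hom_inv_fun.
Proof.
move=> a u v; apply: (can_inj hom_funK).
by rewrite hom_linear !hom_invKfun.
Qed.

Lemma hom_inv_isometry u v : met (hom_inv_fun u) (hom_inv_fun v) = met u v.
Proof. by rewrite -(hom_isometry f) !hom_invKfun. Qed.

(** The matrix of [e] is that of its inverse image times the matrix of [f]; the first and the last
    have positive determinant. *)
Lemma hom_inv_orientation (e : 'I_n -> tangent A y) :
  oriented_frame e -> oriented_frame (hom_inv_fun \o e).
Proof.
move=> oe c cx; have cy := chart_atP y.
have := oe _ cy.
have -> : \matrix_(i, j) e i (chart_at y) 0 j =
    (\matrix_(i, j) (hom_inv_fun \o e) i c 0 j) *m hom_mx c (chart_at y) f.
  apply/row_matrixP => i; rewrite row_mul.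
  have -> : row i (\matrix_(i, j) (hom_inv_fun \o e) i c 0 j) = hom_inv_fun (e i) c.
    by apply/rowP => j; rewrite !mxE.
  by rewrite -hom_mxP// hom_invKfun; apply/rowP => j; rewrite !mxE.
by rewrite det_mulmx pmulr_lgt0// det_hom_mx_gt0.
Qed.

End inverse.

(** The Gram matrix of [e] is invertible, hence so is its factor [E], the frame matrix; a Lorentz
    basis therefore spans. *)
Lemma lorentz_basis_sqr x (e : 'I_n -> tangent A x) :
  (forall i j, met (e i) (e j) = if i == j then (if val i == 0%N then -1 else 1) else 0) ->
  forall s, exists a : 'I_n -> R, s = \sum_i a i *: e i.
Proof.
move=> he s; have cx := chart_atP x.
pose E := \matrix_(i, j) e i (chart_at x) 0 j.
have uE : E \in unitmx.
  have := det_lorentz_basis he; rewrite (gram_frame e cx) !det_mulmx.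
  by rewrite !mulf_eq0 !negb_or unitmxE unitfE => /andP[/andP[]].
exists (fun i => (s (chart_at x) *m invmx E) 0 i).
apply: (tangent_eq cx); rewrite tangent_sum -{1}[s _](mulmxKV uE).
set a := _ *m invmx E; rewrite mulmx_sum_row; apply: eq_bigr => i _.
by rewrite tangentZ; congr (_ *: _); apply/rowP => j; rewrite !mxE.
Qed.

(* In a Lorentz basis, [b_0 u - a_0 w] has no time component; if [g(u, w) = 0],
   its square [b_0^2 g(u, u) + a_0^2 g(w, w)] is nevertheless negative. *)
Lemma timelike_metric_neq0 x (u w : tangent A x) :
  met u u < 0 -> met w w < 0 -> met u w != 0.
Proof.
move=> uu ww; apply/eqP => uw.
have [e he] := metric_lorentzian S x.
have ipE (a b : 'I_n -> R) : met (\sum_i a i *: e i) (\sum_i b i *: e i) =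
    \sum_i a i * b i * (if val i == 0%N then -1 else 1).
  rewrite metric_suml; apply: eq_bigr => i _.
  rewrite metricZl metric_sym metric_suml (bigD1 i)//= big1 ?addr0 => [|j ji].
    by rewrite metricZl he eqxx mulrA.
  by rewrite metricZl he (negbTE ji) mulr0.
have spacelike (a : 'I_n -> R) : (forall i, val i = 0%N -> a i = 0) ->
    0 <= met (\sum_i a i *: e i) (\sum_i a i *: e i).
  move=> a0; rewrite ipE; apply: sumr_ge0 => i _.
  by case: ifP => [/eqP/a0 ->|_]; rewrite ?mul0r// mulr1 -expr2 sqr_ge0.
have [a ua] := lorentz_basis_sqr he u; have [b wb] := lorentz_basis_sqr he w.
have [n0|n0] := posnP n.
  suff : 0 <= met u u by rewrite leNgt uu.
  rewrite ua; apply: spacelike => -[i hi]; exfalso; move: hi; rewrite n0; exact/negP.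
pose i0 := Ordinal n0.
have a0 : a i0 != 0.
  apply/eqP => a0; suff : 0 <= met u u by rewrite leNgt uu.
  rewrite ua; apply: spacelike => i hi; rewrite -a0; congr a; exact: val_inj.
have := spacelike (fun i => b i0 * a i - a i0 * b i).
have -> : \sum_i (b i0 * a i - a i0 * b i) *: e i = b i0 *: u + (- a i0) *: w.
  rewrite ua wb !scaler_sumr -big_split; apply: eq_bigr => i _ /=.
  by rewrite scalerBl !scalerA mulNr scaleNr.
rewrite metricDl !metricDr !metricZl !metricZr uw (metric_sym S w) uw.
move=> h; suff : 0 <= b i0 * (b i0 * met u u) + (- a i0) * (- a i0 * met w w).
  have : 0 < a i0 ^+ 2 by rewrite exprn_even_gt0.
  have := sqr_ge0 (b i0); nra.
have := h; rewrite !(mulr0, addr0, add0r); apply => i hi.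
have -> : i = i0 by exact: val_inj.
by rewrite mulrC subrr.
Qed.

(* If [u] were past-pointing, [f] would map the future-pointing [- u] to [- v]. *)
Lemma hom_inv_time x y (f : hom S x y) (v : tangent A y) :
  future_timelike S v -> future_timelike S (hom_inv_fun f v).
Proof.
move=> [vv vT]; set u := hom_inv_fun f v.
have uu : met u u < 0 by rewrite hom_inv_isometry.
split=> //; rewrite ltNge; apply/negP; rewrite le_eqVlt eq_sym => /orP[|uT].
  by rewrite (negbTE (timelike_metric_neq0 uu (time_field_timelike S x))).
have : future_timelike S ((-1) *: u).
  split; first by rewrite metricZl metricZr; move: uu; lra.
  by rewrite metricZl; move: uT; lra.
move=> /(hom_time_orientation f)[_].
have f0 : f 0 = 0.
  by apply: (addrI (f 0)); have := hom_linear f 1 0 0; rewrite !scale1r !addr0.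
have -> : f ((-1) *: u) = (-1) *: v.
  by have := hom_linear f (-1) u 0; rewrite !addr0 f0 addr0 hom_invKfun.
rewrite metricZl; move: vT; lra.
Qed.

Definition hom_inv x y (f : hom S x y) : hom S y x :=
  Hom (@hom_inv_linear x y f) (hom_inv_isometry f) (@hom_inv_orientation x y f)
    (@hom_inv_time x y f).

Lemma hom_ext x y (f g : hom S x y) : (forall v, f v = g v) -> f = g.
Proof.
case: f => f f1 f2 f3 f4; case: g => g g1 g2 g3 g4 /= /funext fg.
by case: _ / fg g1 g2 g3 g4 => g1 g2 g3 g4; congr Hom; exact: Prop_irrelevance.
Qed.

Lemma comp_hom_invK x y z (f : hom S x y) (g : hom S z x) :
  comp_hom (hom_inv f) (comp_hom f g) = g.
Proof. by apply: hom_ext => v; exact: hom_funK. Qed.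

Lemma comp_homKV x y z (f : hom S x y) (g : hom S z y) :
  comp_hom f (comp_hom (hom_inv f) g) = g.
Proof. by apply: hom_ext => v; exact: hom_invKfun. Qed.

Lemma comp_hom_inv x y (f : hom S x y) : comp_hom (hom_inv f) f = id_hom S x.
Proof. by apply: hom_ext => v; exact: hom_funK. Qed.

Lemma hom_mx_comp x y z (f : hom S y z) (g : hom S x y) (c c1 c2 : chart A) : dom c1 y ->
  hom_mx c c2 (comp_hom f g) = hom_mx c c1 g *m hom_mx c1 c2 f.
Proof.
move=> c1y; apply/row_matrixP => i; rewrite row_mul.
have rE w c3 (h : hom S x w) : row i (hom_mx c c3 h) = h (partial c x i) c3.
  by apply/rowP => j; rewrite !mxE.
by rewrite !rE /= -hom_mxP.
Qed.

Lemma hom_mx_change x y (f : hom S x y) (c c' c1 c1' : chart A) :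
  dom c x -> dom c' x -> dom c1 y -> dom c1' y ->
  hom_mx c c1 f = jac c c' x *m hom_mx c' c1' f *m jac c1' c1 y.
Proof.
move=> cx c'x c1y c1'y; apply/row_matrixP => i; rewrite !row_mul.
have -> : row i (hom_mx c c1 f) = f (partial c x i) c1.
  by apply/rowP => j; rewrite !mxE.
rewrite (tangent_chart _ c1'y c1y) (hom_mxP _ _ _ c'x); congr (_ *m _ *m _).
by rewrite (tangent_chart _ cx c'x) tvec_self// rowE.
Qed.

End lorentz.

Lemma continuous_pair (T U V : topologicalType) (f : T -> U) (g : T -> V) x :
  {for x, continuous f} -> {for x, continuous g} ->
  {for x, continuous (fun t => (f t, g t))}.
Proof. by move=> cf cg; exact: (cvg_pair cf cg). Qed.

Section fibers.
Context {R : realType} {n : nat} {M : ptopologicalType}.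
Context {A : oriented_manifold R n M}.
Variable S : spacetime A.

Lemma arrow_openE (W : set (arrow S)) : open W = arrow_open W.
Proof. by []. Qed.

(** Openness has to be tested in every other pair of charts [c'], [c1']; there the set is the
    preimage of [U] under the change of coordinates [P], which is continuous on the overlap [O]. *)
Lemma chart_box_open (c c1 : chart A) (U : set ('rV[R]_n * 'rV[R]_n * 'M[R]_n)) :
  open U -> open [set g : arrow S |
    [/\ dom c (src g), dom c1 (tgt g) & U (arrow_coord c c1 g)]].
Proof.
move=> oU; rewrite arrow_openE => c' c1'.
pose O := [set p : 'rV[R]_n * 'rV[R]_n * 'M[R]_n |
  (coord c' @` (dom c' `&` dom c)) p.1.1 /\ (coord c1' @` (dom c1' `&` dom c1)) p.1.2].
(* The matrix of a linear map changes by one Jacobian on each side, as in [hom_mx_change]. *)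
pose P (p : 'rV[R]_n * 'rV[R]_n * 'M[R]_n) := (coord c (param c' p.1.1),
  coord c1 (param c1' p.1.2),
  jac c c' (param c' p.1.1) *m p.2 *m jac c1' c1 (param c1' p.1.2)).
have oO : open O.
  have -> : O = (fun p => p.1.1) @^-1` (coord c' @` (dom c' `&` dom c)) `&`
     (fun p => p.1.2) @^-1` (coord c1' @` (dom c1' `&` dom c1)).
    by apply/seteqP; split.
  apply: openI; (apply: open_comp; last exact: open_dom_coord) => p _.
    by apply: continuous_comp; exact: cvg_fst.
  by apply: (@continuous_comp _ _ _ fst snd); [exact: cvg_fst|exact: cvg_snd].
have fstC (T1 T2 : topologicalType) : continuous (@fst T1 T2) by move=> ?; exact: cvg_fst.
have sndC (T1 T2 : topologicalType) : continuous (@snd T1 T2) by move=> ?; exact: cvg_snd.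
have P11 (p : 'rV[R]_n * 'rV[R]_n * 'M[R]_n) : {for p, continuous (fun q => q.1.1 : 'rV[R]_n)}.
  by apply: (@continuous_comp _ _ _ fst fst); exact: fstC.
have P12 (p : 'rV[R]_n * 'rV[R]_n * 'M[R]_n) : {for p, continuous (fun q => q.1.2 : 'rV[R]_n)}.
  by apply: (@continuous_comp _ _ _ fst snd); [exact: fstC|exact: sndC].
have cP p : O p -> {for p, continuous P}.
  move=> [[x [c'x cx] xp] [y [c1'y c1y] yp]].
  have hx : {for p, continuous (fun q : 'rV[R]_n * 'rV[R]_n * 'M[R]_n => param c' q.1.1)}.
    apply: (@continuous_comp _ _ _ (fun q => q.1.1) (param c')); first exact: P11.
    by rewrite -xp; exact: param_continuous.
  have hy : {for p, continuous (fun q : 'rV[R]_n * 'rV[R]_n * 'M[R]_n => param c1' q.1.2)}.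
    apply: (@continuous_comp _ _ _ (fun q => q.1.2) (param c1')); first exact: P12.
    by rewrite -yp; exact: param_continuous.
  apply: continuous_pair; first apply: continuous_pair.
  - apply: (@continuous_comp _ _ _ _ (coord c)); first exact: hx.
    by rewrite -xp coordK//; exact: coord_continuous.
  - apply: (@continuous_comp _ _ _ _ (coord c1)); first exact: hy.
    by rewrite -yp coordK//; exact: coord_continuous.
  - apply: continuous_mulmx; first apply: continuous_mulmx.
    + apply: (@continuous_comp _ _ _ (fun q => q.1.1) (fun u => jac c c' (param c' u)));
        first exact: P11.
      (* [jac_continuous] concerns the parametrisation by [c], so the point is first rewritten
         through the chart [c]. *)
      apply: (@continuous_near_eq _ _
          (fun u => jac c c' (param c (coord c (param c' u))))).
        have : \forall w \near p.1.1, (coord c' @` (dom c' `&` dom c)) w.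
          by apply: open_nbhs_nbhs; split; [exact: open_dom_coord|exists x].
        by apply: filterS => _ [z [c'z cz] <-]; rewrite coordK// coordK.
      apply: (@continuous_comp _ _ _ (fun u => coord c (param c' u))
        (fun u => jac c c' (param c u))).
        apply: (@continuous_comp _ _ _ (param c') (coord c)).
          by rewrite -xp; exact: param_continuous.
        by rewrite -xp coordK//; exact: coord_continuous.
      by rewrite -xp coordK//; apply: jac_continuous; exists x.
    + exact: sndC.
    + apply: (@continuous_comp _ _ _ (fun q => q.1.2) (fun u => jac c1' c1 (param c1' u)));
        first exact: P12.
      by apply: jac_continuous; exists y.
exists (O `&` P @^-1` U); first exact: open_setI_preimage.
move=> g sg tg.
have key : dom c (src g) -> dom c1 (tgt g) -> P (arrow_coord c' c1' g) = arrow_coord c c1 g.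
  move=> cs ct; rewrite /P /arrow_coord /= !coordK//; congr (_, _).
  by rewrite -hom_mx_change.
split=> [[cs ct Ug]|[[[x [c'x cx] xp] [y [c1'y c1y] yp]]]] /=.
  split; last by rewrite /= key.
  by split; [exists (src g)|exists (tgt g)].
have cs : dom c (src g).
  by rewrite -(coordK sg) (_ : coord c' (src g) = coord c' x) ?coordK.
have ct : dom c1 (tgt g).
  by rewrite -(coordK tg) (_ : coord c1' (tgt g) = coord c1' y) ?coordK.
by rewrite key// => Ug; split.
Qed.

End fibers.

(** * Covariance of relational fields *)

Section isomorphic_integrals.
Context {d1 d2 : measure_display} {T1 : measurableType d1} {T2 : measurableType d2}.
Context {R : realType}.
Variables (F : T1 -> T2) (G : T2 -> T1).
Hypotheses (FK : cancel F G) (GK : cancel G F).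
Hypotheses (mF : measurable_fun setT F) (mG : measurable_fun setT G).
(* Arbitrary set functions: no measure structure is available on [povm_state]. *)
Variables (m1 : set T1 -> \bar R) (m2 : set T2 -> \bar R).
Hypothesis m12 : forall D, measurable D -> m2 D = m1 (F @^-1` D).

Import HBNNSimple.

Let nnsfun_measurable_comp d d' (T : measurableType d) (T' : measurableType d')
    (H : T -> T') (h : {nnsfun T' >-> R}) :
  measurable_fun setT H -> exists h' : {nnsfun T >-> R}, h' =1 h \o H.
Proof.
move=> mH; pose k : T -> R := h \o H.
have mk : @isMeasurableFun _ _ _ _ k.
  by split; exact: measurableT_comp.
have fk : @FiniteImage _ _ k.
  split; apply: (@sub_finite_set _ _ (range h)); last exact: fimfunP.
  by move=> _ [t _ <-]; exists (H t).
have nk : @isNonNegFun _ _ k by split=> t; exact: fun_ge0.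
pose k' : {nnsfun T >-> R} := HB.pack k mk fk nk.
by exists k'.
Qed.

(** An integral is a difference of two suprema over nonnegative simple functions. Composition with
    [F] and with [G] exchanges the simple functions below [g] and those below [g \o F], and
    preserves their integrals, which depend on the set function at level sets alone. *)
Lemma iso_integral (f : T2 -> \bar R) :
  (\int[m2]_t f t = \int[m1]_t f (F t))%E.
Proof.
have sup_eq (g : T2 -> \bar R) :
   [set sintegral m2 h | h in [set h : {nnsfun T2 >-> R} | forall t, ((h t)%:E <= g t)%E]] =
   [set sintegral m1 h | h in [set h : {nnsfun T1 >-> R} | forall t, ((h t)%:E <= g (F t))%E]].
  apply/seteqP; split=> _ [h /= hg <-].
    have [h' h'E] := nnsfun_measurable_comp h mF.
    exists h' => [t|]; first by rewrite h'E; exact: hg.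
    apply: eq_fsbigr => r _; congr (_ * _)%E; rewrite m12//.
    by congr m1; apply/funext => t /=; rewrite /preimage/= h'E.
  have [h' h'E] := nnsfun_measurable_comp h mG.
  exists h' => [t|]; first by rewrite h'E -[in leRHS](GK t); exact: hg.
  apply: eq_fsbigr => r _; congr (_ * _)%E; rewrite m12//.
  by congr m1; apply/funext => t /=; rewrite /preimage/= h'E /= FK.
rewrite /integral !patch_setT; congr (ereal_sup _ - ereal_sup _)%E.
  have -> : funepos (fun t => f (F t)) = funepos f \o F.
    by apply/funext => t; rewrite /= !funeposE.
  exact: (sup_eq (funepos f)).
have -> : funeneg (fun t => f (F t)) = funeneg f \o F.
  by apply/funext => t; rewrite /= !funenegE.
exact: (sup_eq (funeneg f)).
Qed.

Lemma iso_integrable (f : T2 -> \bar R) :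
  m1.-integrable setT (f \o F) -> m2.-integrable setT f.
Proof.
move=> /integrableP[mf fi]; apply/integrableP; split.
  have -> : f = (f \o F) \o G by apply/funext => t /=; rewrite GK.
  exact: measurableT_comp mf mG.
by rewrite iso_integral.
Qed.

End isomorphic_integrals.

Section transport.
Context {R : realType} {n : nat} {M : ptopologicalType}.
Context {A : oriented_manifold R n M}.
Variable S : spacetime A.

(** Read in charts, [Lmul f] multiplies a matrix on the right by that of [f]. The charts at [y] and
    [x] are fixed but the source is free, so the preimage of an open set is described by chart
    boxes, one for each source chart [c]. *)
Lemma Lmul_measurable x y (f : hom S y x) :
  measurable_fun setT (Lmul f : borel_fiber S y -> borel_fiber S x).
Proof.
pose G := [set D : set (fiber S x) | exists2 W, open W & D = @fiber_arrow _ _ _ _ S x @^-1` W].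
suff h : preimage_set_system setT (Lmul f : fiber S y -> fiber S x) G `<=`
    (measurable : set (set (borel_fiber S y))).
  exact: (@measurability _ _ _ _ setT (Lmul f : borel_fiber S y -> borel_fiber S x) G erefl h).
move=> _ [_ [W oW ->] <-]; rewrite setTI; apply: sub_sigma_algebra.
have c1y := chart_atP (A := A) y; have c2x := chart_atP (A := A) x.
set c1 := chart_at y in c1y; set c2 := chart_at x in c2x.
have /choice[U UP] : forall c : chart A, exists U, open U /\ forall g, dom c (src g) ->
    dom c2 (tgt g) -> W g <-> U (arrow_coord c c2 g).
  by move=> c; move: oW; rewrite arrow_openE => /(_ c c2)[U oU UP]; exists U.
(* The target coordinate is replaced by the constant [coord c2 x]: only arrows into [y] matter, and
   their translates all end at [x]. *)
pose P (p : 'rV[R]_n * 'rV[R]_n * 'M[R]_n) := (p.1.1, coord c2 x, p.2 *m hom_mx c1 c2 f).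
have cP : continuous P.
  move=> p; suff : {for p, continuous P} by [].
  apply: continuous_pair; first apply: continuous_pair.
  - by apply: (@continuous_comp _ _ _ fst fst); exact: cvg_fst.
  - exact: cvg_cst.
  - by apply: continuous_mulmx; [exact: cvg_snd|exact: cvg_cst].
exists (\bigcup_c [set g : arrow S | [/\ dom c (src g), dom c1 (tgt g) &
    (P @^-1` U c) (arrow_coord c c1 g)]]).
  apply: bigcup_open => c _; apply: chart_box_open.
  by apply: open_comp => [p _|]; [exact: cP|have [] := UP c].
apply/seteqP; split=> g /=.
  move=> Wg; have [c cg] := dom_cover A (fiber_src g).
  exists c => //; split=> //; have [_ h] := UP c.
  have [h1 _] := h (fiber_arrow (Lmul f g)) cg c2x.
  by have := h1 Wg; rewrite /P /arrow_coord /= (hom_mx_comp _ _ _ _ c1y).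
move=> [c _ [/= cg _ Ug]]; have [_ h] := UP c.
have [_] := h (fiber_arrow (Lmul f g)) cg c2x; apply.
by rewrite /arrow_coord /= (hom_mx_comp _ _ _ _ c1y).
Qed.

Lemma LmulK x y (f : hom S y x) : cancel (Lmul f) (Lmul (hom_inv f)).
Proof. by move=> [z g]; rewrite /Lmul /= comp_hom_invK. Qed.

Lemma LmulKV x y (f : hom S y x) : cancel (Lmul (hom_inv f)) (Lmul f).
Proof. by move=> [z g]; rewrite /Lmul /= comp_homKV. Qed.

End transport.

Section representations.
Context {R : realType} {n : nat} {M : ptopologicalType}.
Context {A : oriented_manifold R n M} {S : spacetime A}.
Variables (F : cfield R M) (U : rep S F).
Hypothesis rU : unitary_rep U.

Lemma rep_unitary x y (f : hom S x y) : unitary_op (U f).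
Proof. by case: rU. Qed.

Lemma rep_comp x y z (f : hom S y z) (g : hom S x y) : U (comp_hom f g) = U f \o U g.
Proof. by case: rU => _ h _ _; apply/funext => v; exact: h. Qed.

Lemma rep_id x : U (id_hom S x) = id.
Proof. by case: rU => _ _ h _; apply/funext => v; exact: h. Qed.

Lemma rep_inv x y (f : hom S x y) : U (hom_inv f) = adj (U f).
Proof.
apply/esym/adjE => u v.
rewrite -(unitary_hip (rep_unitary (hom_inv f))).
have e : U (hom_inv f) (U f u) = u.
  by rewrite -[LHS]/((U (hom_inv f) \o U f) u) -rep_comp comp_hom_inv rep_id.
by rewrite e.
Qed.

Lemma adj_rep_comp x y z (f : hom S y z) (g : hom S x y) :
  adj (U (comp_hom f g)) = adj (U g) \o adj (U f).
Proof.
apply: adjE => u v; rewrite rep_comp /=.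
rewrite -(adjP (unitary_bounded (rep_unitary g))).
by rewrite -(adjP (unitary_bounded (rep_unitary f))).
Qed.

End representations.

Section relational.
Context {R : realType} {n : nat} {M : ptopologicalType}.
Context {A : oriented_manifold R n M} {S : spacetime A}.
Context {mu : {measure set (borel M) -> \bar R}}.
Variables (Sys : qsystem S) (Fr : qframe S mu).
Local Notation V := (@sys_rep _ _ _ _ _ Sys _ _).
Local Notation U := (@frame_rep _ _ _ _ _ _ Fr _ _).

Definition conj_rep x y (f : hom S y x) (T : Sys y -> Sys y) : Sys x -> Sys x :=
  V f \o T \o adj (V f).

Lemma povm_state_transport x y (f : hom S y x) (w w' : opfield Fr)
    (D : set (borel_fiber S x)) : measurable D -> trace_class (w y) ->
  w' x = U f \o w y \o adj (U f) ->
  povm_state w' D = povm_state w (Lmul f @^-1` D : set (borel_fiber S y)).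
Proof.
move=> mD tw w'E; set D' := Lmul f @^-1` D.
have rU := frame_unitary Fr.
have mD' : measurable (D' : set (borel_fiber S y)).
  by rewrite -[X in measurable X]setTI; apply: Lmul_measurable.
(* [povm_covariant] concerns images under [Lmul f], so [D] is written as the image of its
   preimage. *)
have DE : D = (Lmul f : borel_fiber S y -> borel_fiber S x) @` D'.
  apply/seteqP; split=> [g Dg|_ [g Dg <-]//].
  by exists (Lmul (hom_inv f) g); rewrite /D' /= ?LmulKV.
have bE : bounded_op (frame_povm (q := Fr) D') by have [] := povm_effect Fr mD'.
rewrite /povm_state; congr (complex.Re _)%:E.
rewrite -(tr_unitary (rep_unitary rU f)).
  congr tr; apply/funext => v; rewrite /= w'E {1}DE -povm_covariant//=.
  by rewrite (unitary_adjK (rep_unitary rU f)).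
by apply: has_expansion_compr => //; exact: trace_class_expansion.
Qed.

(** A test operator [rho'] at [x] is pulled back to [rho] at [y]; by unitary invariance of the
    trace, testing a conjugate [conj_rep f K] with [rho'] amounts to testing [K] with [rho]. *)
Lemma relational_value_transport (phi : opfield Sys) (w w' : opfield Fr) x y
    (f : hom S y x) (T : Sys y -> Sys y) :
  (forall z, bounded_op (phi z)) -> trace_class (w y) ->
  w' x = U f \o w y \o adj (U f) ->
  is_relational_value phi w T -> is_relational_value phi w' (conj_rep f T).
Proof.
move=> bphi tw w'E [bT hT].
have rV := sys_unitary Sys; have uf := rep_unitary rV f.
have bf := unitary_bounded uf; have baf := unitary_bounded (adj_unitary uf).
split; first by apply: bounded_comp => //; exact: bounded_comp.
move=> rho' trho'.
pose rho := adj (V f) \o rho' \o V f.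
have trho : trace_class rho by apply: trace_class_compr => //; exact: trace_class_compl.
have key (K : Sys y -> Sys y) : bounded_op K -> tr (rho' \o conj_rep f K) = tr (rho \o K).
  move=> bK; rewrite -(tr_unitary uf).
    by congr tr; apply/funext => v; rewrite /rho /conj_rep /= unitary_Kadj.
  by apply: has_expansion_compr => //; exact: trace_class_expansion.
move=> h'; have [] := hT rho trho; set h := (X in cintegrable _ X) => ih hTE.
(* An arrow [g] and its translate have the same source, so both integrands involve the same value of
   [phi]; multiplicativity of [V] splits off the conjugation by [V f]. *)
have hE : h' \o (Lmul f : borel_fiber S y -> borel_fiber S x) = h.
  apply/funext => g; rewrite /h' /h /= -key; last first.
    have ug := rep_unitary rV (fiber_hom g).
    apply: bounded_comp; last exact: unitary_bounded (adj_unitary ug).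
    by apply: bounded_comp => //; exact: unitary_bounded ug.
  by rewrite (adj_rep_comp rV) (rep_comp rV).
have m12 (D : set (borel_fiber S x)) : measurable D -> povm_state w' D =
    povm_state w ((Lmul f : borel_fiber S y -> borel_fiber S x) @^-1` D).
  by move=> mD; exact: povm_state_transport.
have FK := @LmulK _ _ _ _ S _ _ f; have KF := @LmulKV _ _ _ _ S _ _ f.
have m1 := @Lmul_measurable _ _ _ _ S _ _ f.
have m2 := @Lmul_measurable _ _ _ _ S _ _ (hom_inv f).
pose LF := Lmul f : borel_fiber S y -> borel_fiber S x.
pose LG := Lmul (hom_inv f) : borel_fiber S x -> borel_fiber S y.
have tI := @iso_integrable _ _ _ _ R LF LG FK KF m1 m2 _ _ m12.
have tE := @iso_integral _ _ _ _ R LF LG FK KF m1 m2 _ _ m12.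
split.
  case: ih => i1 i2; split.
    by apply: (tI (fun t => (complex.Re (h' t))%:E)); move: i1; rewrite -hE.
  by apply: (tI (fun t => (complex.Im (h' t))%:E)); move: i2; rewrite -hE.
have {}hTE : tr (rho \o T) = cintegral (povm_state w (x := y)) h := hTE.
rewrite key// hTE -hE /cintegral; congr (Complex (fine _) (fine _)); apply: esym.
  exact: (tE (fun t => (complex.Re (h' t))%:E)).
exact: (tE (fun t => (complex.Im (h' t))%:E)).
Qed.

Lemma relational_value_unique (phi : opfield Sys) (w : opfield Fr) x (T T' : Sys x -> Sys x) :
  is_relational_value phi w T -> is_relational_value phi w T' -> T = T'.
Proof.
move=> [bT hT] [bT' hT']; apply: bounded_op_tr_unique => // rho trho.
by have [_ ->] := hT rho trho; have [_ ->] := hT' rho trho.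
Qed.

(** Where no integral exists the default value is the zero map, which is linear too. *)
Lemma relational_field_linear (phi : opfield Sys) (w : opfield Fr) x :
  linear (relational_field phi w (x := x)).
Proof.
rewrite /relational_field; case: xgetP => [T _ [[]]//|_] a u v.
by rewrite scaler0 addr0.
Qed.

Lemma relational_field_transport (phi : opfield Sys) (w w' : opfield Fr) x y
    (f : hom S y x) :
  (forall z, bounded_op (phi z)) -> trace_class (w y) ->
  w' x = U f \o w y \o adj (U f) ->
  relational_field phi w' (x := x) = conj_rep f (relational_field phi w (x := y)).
Proof.
move=> bphi tw w'E; have rV := sys_unitary Sys; have rU := frame_unitary Fr.
have tw' : trace_class (w' x).
  rewrite w'E; apply: trace_class_compr; first exact: unitary_bounded (adj_unitary (rep_unitary rU f)).
  by apply: trace_class_compl => //; exact: unitary_bounded (rep_unitary rU f).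
(* Written for the inverse arrow, so that existence of the integral also passes from [x] back to
   [y]. *)
have wE : w y = U (hom_inv f) \o w' x \o adj (U (hom_inv f)).
  rewrite (rep_inv rU) adj_adj_unitary; last exact: rep_unitary.
  by apply/funext => v; rewrite w'E /= !(unitary_adjK (rep_unitary rU f)).
have [[T hT]|noT] := pselect (exists T, is_relational_value phi w (x := y) T).
  have hT' := relational_value_transport bphi tw w'E hT.
  have -> : relational_field phi w (x := y) = T.
    by apply: xget_unique => // T2 hT2; exact: relational_value_unique hT2 hT.
  by apply: xget_unique => // T2 hT2; exact: relational_value_unique hT2 hT'.
rewrite /relational_field xgetPN => [|T hT]; last first.
  by apply: noT; exists (conj_rep (hom_inv f) T); exact: (relational_value_transport bphi tw' wE hT).
rewrite xgetPN => [|T hT]; last by apply: noT; exists T.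
by apply/funext => v; rewrite /conj_rep /= linear_op0//; exact: unitary_linear (rep_unitary rV f).
Qed.

End relational.

(** * Measurable sections *)

Section borel_maps.
Context {R : realType}.

Lemma open_borel (T : ptopologicalType) (U : set T) :
  open U -> measurable (U : set (borel T)).
Proof. by move=> oU; exact: sub_sigma_algebra. Qed.

Lemma continuous_borel (T U : ptopologicalType) (f : T -> U) :
  (forall W, open W -> open (f @^-1` W)) ->
  measurable_fun setT (f : borel T -> borel U).
Proof.
move=> cf.
suff h : preimage_set_system setT f open `<=` (measurable : set (set (borel T))).
  exact: (@measurability _ _ (borel T) (borel U) setT f open erefl h).
by move=> _ [W oW <-]; rewrite setTI; apply: open_borel; exact: cf.
Qed.

(** [R] has its own measurable structure, distinct in form from [borel]; it is accessed through its
    generating open intervals. *)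
Lemma continuous_borel_real (T : ptopologicalType) (f : T -> R) :
  continuous f -> measurable_fun setT (f : borel T -> R).
Proof.
move=> cf.
suff h : preimage_set_system setT f (@RGenOpens.G R) `<=` (measurable : set (set (borel T))).
  exact: (@measurability _ _ (borel T) R setT f (@RGenOpens.G R) (@RGenOpens.measurableE R) h).
move=> _ [_ [x [y ->]] <-]; rewrite setTI; apply: open_borel.
by apply: open_comp => //; exact: interval_open.
Qed.

End borel_maps.

Section complex_measurable.
Context {R : realType} d {T : measurableType d}.
Implicit Types f g : T -> R[i].

Lemma cmeasurable_conj f : cmeasurable f -> cmeasurable (fun x => (f x)^*).
Proof.
move=> [rf jf]; split.
  by under eq_fun do rewrite cReC.
by under eq_fun do rewrite cImC; exact: measurable_funN.
Qed.

Lemma cmeasurableD f g : cmeasurable f -> cmeasurable g -> cmeasurable (fun x => f x + g x).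
Proof.
move=> [rf jf] [rg jg]; split.
  by under eq_fun do rewrite cReD; exact: measurable_funD.
by under eq_fun do rewrite cImD; exact: measurable_funD.
Qed.

Lemma cmeasurableM f g : cmeasurable f -> cmeasurable g -> cmeasurable (fun x => f x * g x).
Proof.
move=> [rf jf] [rg jg]; split.
  under eq_fun do rewrite cReM.
  by apply: measurable_funB; exact: measurable_funM.
under eq_fun do rewrite cImM.
by apply: measurable_funD; exact: measurable_funM.
Qed.

Lemma cmeasurable_cst (a : R[i]) : cmeasurable (fun _ : T => a).
Proof. by split; exact: measurable_cst. Qed.

Lemma cmeasurable_comp d' (T' : measurableType d') (h : T' -> T) f :
  measurable_fun setT h -> cmeasurable f -> cmeasurable (f \o h).
Proof.
by move=> mh [rf jf]; split; [exact: measurableT_comp rf mh|exact: measurableT_comp jf mh].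
Qed.

Lemma cmeasurable_ext f g : (forall x, f x = g x) -> cmeasurable f -> cmeasurable g.
Proof. by move=> /funext ->. Qed.

End complex_measurable.

Section measurable_sections.
Context {R : realType} {M : ptopologicalType} {F : cfield R M}.
Implicit Types s t : section F.

Lemma csec_cmeasurable_norm (xi : section F) : csec xi ->
  measurable_fun setT (fun x : borel M => hnorm (xi x)).
Proof. by move=> xic; apply: continuous_borel_real; exact: csec_norm. Qed.

Lemma measurable_sectionD s t :
  measurable_section s -> measurable_section t -> measurable_section (fun x => s x + t x).
Proof.
move=> ms mt xi xic; apply: (@cmeasurable_ext _ _ _ (fun x : borel M =>
  hip (xi x) (s x) + hip (xi x) (t x))); first by move=> x; rewrite hipDr.
by apply: cmeasurableD; [exact: ms|exact: mt].
Qed.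

Lemma measurable_sectionZ (a : borel M -> R[i]) s : cmeasurable a ->
  measurable_section s -> measurable_section (fun x => a x *: s x).
Proof.
move=> ma ms xi xic; apply: (@cmeasurable_ext _ _ _ (fun x : borel M =>
  a x * hip (xi x) (s x))); first by move=> x; rewrite hipZr.
by apply: cmeasurableM => //; exact: ms.
Qed.

(* [|s|^2 = sup_k (2 Re <xi_k, s> - |xi_k|^2)] for a dense sequence [xi], since
   [|s - xi_k|^2 >= 0] has infimum [0]. *)
Lemma measurable_section_sqr s : measurable_section s ->
  measurable_fun setT (fun x : borel M => hnorm (s x) ^+ 2).
Proof.
move=> ms; have [xi [xic xid]] := csec_dense F.
pose h k (x : borel M) := 2 * rip (xi k x) (s x) - hnorm (xi k x) ^+ 2.
have mh k : measurable_fun setT (h k).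
  apply: measurable_funB.
    by apply: measurable_funM => //; have [] := ms _ (xic k).
  apply: measurable_funX; exact: csec_cmeasurable_norm.
have hE k x : hnorm (s x - xi k x) ^+ 2 = hnorm (s x) ^+ 2 - h k x.
  rewrite hnorm_sqr hipBl !hipBr !(cReD, cReN) (rip_sym (s x) (xi k x)) -!hnorm_sqr /h; ring.
have -> : (fun x : borel M => hnorm (s x) ^+ 2) = (fun x => sups (h ^~ x) 0%N).
  apply/funext => x; apply/esym/eqP.
  have ub : ubound (range (h^~ x)) (hnorm (s x) ^+ 2).
    by move=> _ [k _ <-]; rewrite -subr_ge0 -hE sqr_ge0.
  have hs : has_sup (range (h^~ x)) by split; [exists (h 0%N x), 0%N|exists (hnorm (s x) ^+ 2)].
  rewrite (_ : sups (h^~ x) 0%N = sup (range (h^~ x))); last first.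
    rewrite /sups/=; congr sup.
    by apply/seteqP; split=> _ [k _ <-]; exists k.
  rewrite eq_le; apply/andP; split; first by apply: ge_sup => //; case: hs.
  apply/ler_addgt0Pr => e e0.
  have se : 0 < Num.sqrt e by rewrite sqrtr_gt0.
  have [k hk] := xid x (s x) _ se.
  apply: (@le_trans _ _ (h k x + e)); last first.
    by rewrite lerD2r; apply: ub_le_sup; [case: hs|exists k].
  rewrite -lerBlDl -hE hnormBC -(sqr_sqrtr (ltW e0)).
  by rewrite ler_pXn2r// ?nnegrE ?hnorm_ge0 ?sqrtr_ge0// ltW.
apply: measurable_fun_sups => // x _.
by exists (hnorm (s x) ^+ 2) => _ [k _ <-]; rewrite -subr_ge0 -hE sqr_ge0.
Qed.

(** Polarisation. Measurable sections are tested against continuous ones only; the norms of sums,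
    measurable by [measurable_section_sqr], give access to the inner product of two measurable
    sections. *)
Lemma measurable_section_hip s t : measurable_section s -> measurable_section t ->
  cmeasurable (fun x : borel M => hip (s x) (t x)).
Proof.
move=> ms mt.
have mr u : measurable_section u ->
    measurable_fun setT (fun x : borel M => rip (s x) (u x)).
  move=> mu_; have -> : (fun x : borel M => rip (s x) (u x)) = (fun x : borel M =>
      2^-1 * (hnorm (s x + u x) ^+ 2 - hnorm (s x) ^+ 2 - hnorm (u x) ^+ 2)).
    apply/funext => x; rewrite !hnorm_sqr hipDl !hipDr !cReD (rip_sym (u x) (s x)).
    by field.
  apply: measurable_funM => //; apply: measurable_funB; last exact: measurable_section_sqr.
  apply: measurable_funB; last exact: measurable_section_sqr.
  by apply: measurable_section_sqr; exact: measurable_sectionD.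
split; first exact: mr.
have -> : (fun x : borel M => complex.Im (hip (s x) (t x))) =
    (fun x : borel M => - rip (s x) (Complex 0 1 *: t x)).
  by apply/funext => x; rewrite Im_hipE.
apply: measurable_funN; apply: (mr (fun x => Complex 0 1 *: t x)).
by apply: measurable_sectionZ => //; exact: cmeasurable_cst.
Qed.

(** Polarisation again, with [csec_norm] as the source of measurability. *)
Lemma csec_measurable (xi : section F) : csec xi -> measurable_section xi.
Proof.
move=> xic eta etac.
have mn (u : section F) : csec u -> measurable_fun setT (fun x : borel M => hnorm (u x) ^+ 2).
  by move=> uc; apply: measurable_funX; exact: csec_cmeasurable_norm.
have mr (u : section F) : csec u ->
    measurable_fun setT (fun x : borel M => rip (eta x) (u x)).
  (* The factor [1] gives the sum the shape required by [csec_linear]. *)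
  move=> uc; have -> : (fun x : borel M => rip (eta x) (u x)) = (fun x : borel M =>
      2^-1 * (hnorm (1 *: eta x + u x) ^+ 2 - hnorm (eta x) ^+ 2 - hnorm (u x) ^+ 2)).
    apply/funext => x; rewrite !hnorm_sqr scale1r hipDl !hipDr !cReD (rip_sym (u x) (eta x)).
    by field.
  apply: measurable_funM => //; apply: measurable_funB; last exact: mn.
  apply: measurable_funB; last exact: mn.
  by apply: (mn (fun x => 1 *: eta x + u x)); exact: csec_linear.
have zc : csec (fun x => 0 : F x).
  rewrite (_ : (fun x => 0 : F x) = (fun x => (-1) *: xi x + xi x)); first exact: csec_linear.
  by apply: functional_extensionality_dep => x; rewrite scaleN1r addNr.
split; first exact: mr.
have -> : (fun x : borel M => complex.Im (hip (eta x) (xi x))) =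
    (fun x : borel M => - rip (eta x) (Complex 0 1 *: xi x + 0)).
  by apply/funext => x; rewrite addr0 Im_hipE.
by apply: measurable_funN; apply: (mr (fun x => Complex 0 1 *: xi x + 0)); exact: csec_linear.
Qed.

(** The operator is moved to the other side: [adj (T x) (xi x)] is a measurable section, because its
    products with continuous sections are conjugate matrix elements of [T]. *)
Lemma measurable_opfield_section (T : opfield F) s : (forall x, bounded_op (T x)) ->
  measurable_opfield T -> measurable_section s -> measurable_section (dint_act T s).
Proof.
move=> bT mT ms xi xic.
have mA : measurable_section (fun x => adj (T x) (xi x)).
  move=> eta etac; have := cmeasurable_conj (mT xi eta xic etac).
  by apply: cmeasurable_ext => x; rewrite -adjP// -hip_conj.
by apply: cmeasurable_ext (measurable_section_hip mA ms) => x;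
   rewrite hip_conj -adjP// -hip_conj.
Qed.

End measurable_sections.

(** * Bisections *)

Section bisections.
Context {R : realType} {n : nat} {M : ptopologicalType}.
Context {A : oriented_manifold R n M} {S : spacetime A}.
Variable b : bisection S.

Lemma bis_map_borel : measurable_fun setT (bis_map b : borel M -> borel M).
Proof.
apply: continuous_borel => W oW; apply: open_comp => // x _.
exact: (bis_map_smooth b).1.
Qed.

Lemma bis_inv_borel : measurable_fun setT (bis_inv b : borel M -> borel M).
Proof.
apply: continuous_borel => W oW; apply: open_comp => // x _.
exact: (bis_inv_smooth b).1.
Qed.

(** The map is even continuous: near a given point one pair of charts is enough, and there the
    source, the target and the matrix entries depend continuously on the point. *)
Lemma bis_arrow_borel :
  measurable_fun setT ((fun x => Arrow (bis_hom b x)) : borel M -> borel (arrow S)).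
Proof.
apply: continuous_borel => W; rewrite arrow_openE => oW.
rewrite openE => x Wx; rewrite /interior /=.
have cx := chart_atP (A := A) x; have c1x := chart_atP (A := A) (bis_map b x).
move: (chart_at x) (chart_at (bis_map b x)) cx c1x => c c1 cx c1x.
have [U oU UP] := oW c c1.
have cmap : {for x, continuous (bis_map b)} by exact: (bis_map_smooth b).1.
have cc : {for x, continuous (fun y => arrow_coord c c1 (Arrow (bis_hom b y)))}.
  apply: continuous_pair; first apply: continuous_pair.
  - exact: Defs.coord_continuous.
  - by apply: (@continuous_comp _ _ _ (bis_map b) (coord c1)) => //; exact: Defs.coord_continuous.
  - apply: continuous_mx => i j.
    apply: (@continuous_near_eq _ _
        (fun y => hom_mx c c1 (bis_hom b (param c (coord c y))) i j)).
      have : \forall y \near x, dom c y by apply: open_nbhs_nbhs; split=> //; exact: dom_open.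
      by apply: filterS => y cy; rewrite coordK.
    apply: (@continuous_comp _ _ _ (coord c)
       (fun u => hom_mx c c1 (bis_hom b (param c u)) i j)).
      exact: Defs.coord_continuous.
    by apply: smooth_on_continuous (bis_hom_smooth b c c1 i j) _; exists x.
have n1 : \forall y \near x, dom c y by apply: open_nbhs_nbhs; split=> //; exact: dom_open.
have n2 : \forall y \near x, dom c1 (bis_map b y).
  by apply: cmap; apply: open_nbhs_nbhs; split=> //; exact: dom_open.
have n3 : \forall y \near x, U (arrow_coord c c1 (Arrow (bis_hom b y))).
  apply: cc; apply: open_nbhs_nbhs; split=> //.
  exact/(UP (Arrow (bis_hom b x)) cx c1x).
near=> y; apply/(UP (Arrow (bis_hom b y))); rewrite /=.
- by near: y.
- by near: y.
- by near: y.
Unshelve. all: by end_near. Qed.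

(** [bis_to] is [bis_hom] transported along [bis_invK]. With the target generalised, the equation
    can be eliminated, so that facts about [bis_hom] pass to [bis_to]. *)
Lemma ecast_hom_ind z y (h : hom S z y) x (e : y = x) (P : forall w, hom S z w -> Prop) :
  P y h -> P x (ecast w (hom S z w) e h).
Proof. by case: _ / e. Qed.

Lemma bis_to_ind x (P : forall z, hom S (bis_inv b x) z -> Prop) :
  P _ (bis_hom b (bis_inv b x)) -> P x (bis_to b x).
Proof. exact: ecast_hom_ind. Qed.

Section transported_sections.
Context {F : cfield R M}.
Variable U : rep S F.
Hypothesis rU : unitary_rep U.
Implicit Types s t : section F.

(** This is [bisection_op] without the density factor; [bis_pull] is its inverse, written with
    [bis_hom] so as to avoid the transport. *)
Definition bis_push s : section F := fun x => U (bis_to b x) (s (bis_inv b x)).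

Definition bis_pull s : section F := fun y => adj (U (bis_hom b y)) (s (bis_map b y)).

Lemma bis_push_map s y : bis_push s (bis_map b y) = U (bis_hom b y) (s y).
Proof.
(* The arrow on the left starts at [bis_inv b (bis_map b y)], equal to [y] but not convertible to
   it. With that point generalised to [z], both equations can be eliminated. *)
have key z (e : z = y) (e' : bis_map b z = bis_map b y) :
    U (ecast w (hom S z w) e' (bis_hom b z)) (s z) = U (bis_hom b y) (s y).
  by subst z; rewrite (Prop_irrelevance e' erefl).
exact: key (bis_mapK b y) _.
Qed.

Lemma bis_pull_inv s x : bis_pull s (bis_inv b x) = adj (U (bis_to b x)) (s x).
Proof. by rewrite /bis_pull; apply: (@bis_to_ind x (fun z h => _ = adj (U h) (s z))). Qed.

Lemma hip_push_pull s t x :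
  hip (t x) (bis_push s x) = hip (bis_pull t (bis_inv b x)) (s (bis_inv b x)).
Proof. by rewrite bis_pull_inv hip_unitary//; exact: (rep_unitary rU). Qed.

(** First of three steps. Measurability of a representation concerns continuous sections, so their
    pullbacks are treated first; by [hip_push_pull] this gives the pushes of all measurable
    sections, and from these follow the pullbacks of all measurable sections. *)
Lemma bis_pull_measurable s : csec s -> measurable_section (bis_pull s).
Proof.
move=> sc xi xic.
have [_ _ _ mU] := rU.
have := cmeasurable_conj (cmeasurable_comp bis_arrow_borel (mU xi s xic sc)).
apply: cmeasurable_ext => y /=.
rewrite /bis_pull -(adjP (unitary_bounded (rep_unitary rU (bis_hom b y)))).
by rewrite -hip_conj.
Qed.

Lemma bis_push_measurable s : measurable_section s -> measurable_section (bis_push s).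
Proof.
move=> ms eta etac.
have := cmeasurable_comp bis_inv_borel (measurable_section_hip (bis_pull_measurable etac) ms).
by apply: cmeasurable_ext => x /=; rewrite hip_push_pull.
Qed.

Lemma bis_pull_measurable_section s : measurable_section s -> measurable_section (bis_pull s).
Proof.
move=> ms xi xic.
have mp := bis_push_measurable (csec_measurable xic).
have := cmeasurable_comp bis_map_borel (measurable_section_hip mp ms).
apply: cmeasurable_ext => y /=.
by rewrite bis_push_map -(adjP (unitary_bounded (rep_unitary rU (bis_hom b y)))).
Qed.

Lemma hnorm_bis_pull s y : hnorm (bis_pull s y) = hnorm (s (bis_map b y)).
Proof. exact: unitary_hnorm (adj_unitary (rep_unitary rU _)) _. Qed.

(** The matrix element at [x] is that of [w] between the pulled back sections, at [bis_inv b x]. *)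
Lemma conj_opfield_measurable (w : opfield F) : (forall x, bounded_op (w x)) ->
  measurable_opfield w ->
  measurable_opfield (fun x => U (bis_to b x) \o w (bis_inv b x) \o adj (U (bis_to b x))).
Proof.
move=> bw mw xi eta xic etac.
have mx := bis_pull_measurable xic; have me := bis_pull_measurable etac.
have mwe := measurable_opfield_section bw mw me.
have := cmeasurable_comp bis_inv_borel (measurable_section_hip mx mwe).
apply: cmeasurable_ext => x /=.
by rewrite /dint_act !bis_pull_inv [RHS]hip_unitary//; exact: (rep_unitary rU).
Qed.

End transported_sections.

End bisections.

(** * Lebesgue null sets *)

Section dyadic_cubes.
Context {R : realType} {n : nat}.
Implicit Types x y : 'rV[R]_n.

Definition dyadic k x : {ffun 'I_n -> int} := [ffun i => Num.floor (2 ^+ k * x 0 i)].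

Definition cube k (z : {ffun 'I_n -> int}) : set 'rV[R]_n := [set x | dyadic k x = z].

(** Each dyadic interval lies in one of twice its length: if [floor s < floor t], the integer
    [2 floor t] exceeds [2 s] but not [2 t], and so separates the floors of the doubles. *)
Lemma floor_double_eq (s t : R) :
  Num.floor (2 * s) = Num.floor (2 * t) -> Num.floor s = Num.floor t.
Proof.
wlog st : s t / Num.floor s <= Num.floor t => [hw|] h.
  by have [/hw|/ltW/hw] := leP (Num.floor s) (Num.floor t); [exact|move=> ->].
apply/eqP; rewrite eq_le st /=; apply/negPn/negP; rewrite -ltNge => lt_st.
have h1 : Num.floor s + 1 <= Num.floor t by rewrite lezD1.
have := floor_itv s; have := floor_itv t; have := floor_itv (2 * s).
have := floor_itv (2 * t); rewrite h.
move: h1; rewrite -(ler_int R) !intrD => h1 /andP[a1 a2] /andP[b1 b2] /andP[c1 c2] /andP[d1 d2].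
have : (Num.floor (2 * t))%:~R < (2 * Num.floor t)%:~R :> R.
  by rewrite intrM; apply: le_lt_trans b1 _; lra.
rewrite ltr_int => q; have : Num.floor (2 * t) + 1 <= 2 * Num.floor t by rewrite lezD1.
by rewrite -(ler_int R) intrD intrM; lra.
Qed.

Lemma dyadic_nested k k' x y : (k' <= k)%N -> dyadic k x = dyadic k y ->
  dyadic k' x = dyadic k' y.
Proof.
move=> /subnK <-; elim: (k - k')%N => //= m ih h; apply: ih.
apply/ffunP => i; move/ffunP/(_ i): h; rewrite !ffunE.
by rewrite addSn exprS -!mulrA => /floor_double_eq.
Qed.

Lemma dyadic_dist k x y i : dyadic k x = dyadic k y -> `|x 0 i - y 0 i| < (2 ^+ k)^-1.
Proof.
move=> /ffunP/(_ i); rewrite !ffunE => h.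
have := floor_itv (2 ^+ k * x 0 i); have := floor_itv (2 ^+ k * y 0 i).
rewrite h intrD => /andP[a b] /andP[c d].
have p : 0 < (2 : R) ^+ k by rewrite exprn_gt0.
rewrite -(ltr_pM2l p) divff ?gt_eqF// -[X in X * _](gtr0_norm p) -normrM mulrBr.
by rewrite ltr_norml; apply/andP; split; lra.
Qed.

Lemma expr2V_small (e : R) : 0 < e -> exists k, (2 ^+ k)^-1 < e.
Proof.
move=> e0; have [k _ hk] := near_infty_natSinv_lt (PosNum e0).
exists k; apply: le_lt_trans (hk k (leqnn k)) => /=.
rewrite lef_pV2 ?posrE ?exprn_gt0// -natrX ler_nat.
exact: ltn_expl.
Qed.

Lemma cube_sub_open (U : set 'rV[R]_n) x : open U -> U x ->
  exists k, cube k (dyadic k x) `<=` U.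
Proof.
move=> oU Ux; have : nbhs x U by apply: open_nbhs_nbhs.
move=> /nbhs_ballP[e e0 eU]; have [k ke] := expr2V_small e0.
exists k => y yx; apply: eU; split=> // i j; rewrite ord1.
by apply: lt_trans ke; apply: dyadic_dist; rewrite yx.
Qed.

End dyadic_cubes.

Section borel_rV.
Context {R : realType}.

Lemma coord_borel n i : measurable_fun setT ((fun x => x 0 i) : borel 'rV[R]_n -> R).
Proof.
by apply: (@continuous_borel_real R 'rV[R]_n); exact: matrix_normedtype.coord_continuous.
Qed.

(** An open set is a countable union of dyadic cubes, and a cube is given by finitely many
    conditions on coordinates. *)
Lemma borel_rV d (T : measurableType d) n (f : T -> borel 'rV[R]_n) :
  (forall i, measurable_fun setT (fun t => f t 0 i)) -> measurable_fun setT f.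
Proof.
move=> mf.
suff h : preimage_set_system setT f open `<=` (measurable : set (set T)).
  exact: (@measurability _ _ T (borel 'rV[R]_n) setT f open erefl h).
move=> _ [U oU <-]; rewrite setTI.
have -> : f @^-1` U = \bigcup_(p in [set p : nat * {ffun 'I_n -> int} | cube p.1 p.2 `<=` U])
    \bigcap_(i in [set: 'I_n]) [set t | Num.floor (2 ^+ p.1 * f t 0 i) = p.2 i].
  apply/seteqP; split=> [t Ut|t [[k z] /= zU ht]].
    have [k hk] := cube_sub_open oU Ut.
    by exists (k, dyadic k (f t)) => // i _; rewrite /= ffunE.
  by apply: zU; apply/ffunP => i; rewrite ffunE; exact: ht.
rewrite bigcup_mkcond; apply: countable_bigcupT_measurable => [|[k z]]; first exact: countableP.
case: ifP => // _.
apply: fin_bigcap_measurable => // i _ /=.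
have -> : [set t | Num.floor (2 ^+ k * f t 0 i) = z i] =
  (fun t => 2 ^+ k * f t 0 i) @^-1` `[(z i)%:~R, (z i + 1)%:~R[.
  by apply/seteqP; split=> t /=; rewrite in_itv/= -floor_eq => /eqP.
rewrite -[X in measurable X]setTI; apply: measurable_funM => //.
Qed.

End borel_rV.

Lemma product_sigma_finite d1 d2 (T1 : measurableType d1) (T2 : measurableType d2)
    (R : realType) (m1 : {sigma_finite_measure set T1 -> \bar R})
    (m2 : {sigma_finite_measure set T2 -> \bar R}) : sigma_finite setT (m1 \x m2)%E.
Proof.
have [F FT Foo] := sigma_finiteT m1; have [G GT Goo] := sigma_finiteT m2.
exists (fun k => if unpickle k is Some (i, j) then F i `*` G j else set0).
  apply/esym/seteqP; split=> // -[x y] _.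
  have [i _ Fx] : (\bigcup_i F i) x by rewrite -FT.
  have [j _ Gy] : (\bigcup_j G j) y by rewrite -GT.
  by exists (pickle (i, j)) => //; rewrite pickleK.
move=> k; case: (unpickle k) => [[i j]|]; last by rewrite measure0.
have [mF fF] := Foo i; have [mG fG] := Goo j; split; first exact: measurableX.
by rewrite product_measure1E// lte_mul_pinfty// ge0_fin_numE.
Qed.

(** The sets that exhaust the source are pulled back along the left inverse [G], which does not
    change their measure. *)
Lemma pushforward_sigma_finite d1 d2 (T1 : measurableType d1) (T2 : measurableType d2)
    (R : realType) (m : {measure set T1 -> \bar R}) (F : T1 -> T2) (G : T2 -> T1) :
  sigma_finite setT m -> cancel F G -> measurable_fun setT F -> measurable_fun setT G ->
  exists m' : {sigma_finite_measure set T2 -> \bar R},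
    forall f : T2 -> \bar R, measurable_fun setT f -> (forall x, 0 <= f x)%E ->
      (\int[m']_x f x = \int[m]_x (f \o F) x)%E.
Proof.
move=> [H HT Hoo] FK mF mG.
pose m0 : {measure set T2 -> \bar R} :=
  measure_function_pushforward__canonical__measure_function_Measure m mF.
have sf : sigma_finite setT m0.
  exists (fun k => G @^-1` H k).
    by rewrite -preimage_bigcup -HT preimage_setT.
  move=> k; have [mH Hf] := Hoo k; split.
    by rewrite -[X in measurable X]setTI; apply: mG.
  rewrite /m0 /= /pushforward (_ : F @^-1` _ = H k)//.
  by apply/seteqP; split=> p; rewrite /preimage /= FK.
pose m0sf := Measure_isSigmaFinite.Build _ _ R m0 sf.
pose m' : {sigma_finite_measure set T2 -> \bar R} := HB.pack (Measure.sort m0) m0sf.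
exists m' => f mf f0.
transitivity (\int[m0]_x f x)%E; first by [].
by rewrite /m0 /= ge0_integral_pushforward// preimage_setT.
Qed.

(** * A Lebesgue measure behind the iterated integral *)

Section lebesgue_rV.
Context {R : realType}.

(** [integral_rV] comes with no measure attached. By induction and Tonelli it is integration against
    the image of a product measure under [row_mx]; sigma-finiteness is kept so that Tonelli applies
    at the next step. *)
Lemma integral_rV_measure n : exists m : {sigma_finite_measure set (borel 'rV[R]_n) -> \bar R},
  forall f : borel 'rV[R]_n -> \bar R, measurable_fun setT f -> (forall x, 0 <= f x)%E ->
    (integral_rV f = \int[m]_x f x)%E.
Proof.
elim: n => [|n [m hm]].
  (* Evaluation at the only vector of length 0 is integration against a Dirac mass. *)
  exists (@dirac _ (borel 'rV[R]_0) (0 : 'rV[R]_0) R) => f mf f0.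
  by rewrite integral_dirac// diracT mul1e.
pose F (p : measurableTypeR R * borel 'rV[R]_n) : borel 'rV[R]_n.+1 := row_mx (p.1%:M : 'rV[R]_1) p.2.
pose G (x : borel 'rV[R]_n.+1) : measurableTypeR R * borel 'rV[R]_n :=
  (x 0 0, rsubmx (x : 'rV[R]_(1 + n))).
have Fl t (u : 'rV[R]_n) (j : 'I_1) : F (t, u) 0 (lshift n j) = t.
  by apply: (etrans (row_mxEl (t%:M : 'rV[R]_1) u 0 j)); rewrite ord1 mxE eqxx mulr1n.
have Fr t (u : 'rV[R]_n) (j : 'I_n) : F (t, u) 0 (rshift 1 j) = u 0 j.
  exact: (row_mxEr (t%:M : 'rV[R]_1) u 0 j).
have mF : measurable_fun setT F.
  apply: borel_rV => i.
  have [j ->|j ->] := split_ordP (i : 'I_(1 + n)).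
    have -> : (fun t => F t 0 (lshift n j)) = fst.
      by apply/funext => -[t u]; exact: Fl.
    exact: measurable_fst.
  have -> : (fun t => F t 0 (rshift 1 j)) = (fun x : borel 'rV[R]_n => x 0 j) \o snd.
    by apply/funext => -[t u]; exact: Fr.
  by apply: measurableT_comp; [exact: coord_borel|exact: measurable_snd].
have mG : measurable_fun setT G.
  apply/measurable_fun_pairP; split; first exact: coord_borel.
  apply: borel_rV => i.
  have -> : (fun t => (snd \o G) t 0 i) = (fun x : borel 'rV[R]_n.+1 => x 0 (rshift 1 i)).
    by apply/funext => t; exact: mxE.
  exact: coord_borel.
have FK : cancel F G.
  move=> [t u]; congr (_, _).
    by rewrite -[RHS](Fl t u 0); congr (F _ _ _); exact: val_inj.
  exact: (row_mxKr (t%:M : 'rV[R]_1) u).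
have [m' hm'] := pushforward_sigma_finite (product_sigma_finite lebesgue_measure m) FK mF mG.
exists m' => f mf f0; rewrite hm'//.
have mfF := measurableT_comp mf mF.
have fF0 p : (0 <= (f \o F) p)%E by exact: f0.
have Fu := @fubini_tonelli1 _ _ (measurableTypeR R) (borel 'rV[R]_n) R lebesgue_measure m (f \o F) mfF fF0.
apply: (etrans _ (esym Fu)).
apply: eq_integral => t _.
rewrite -[LHS]/(integral_rV (fun u : 'rV[R]_n => (f \o F) (t, u))).
by rewrite hm//; exact: measurable_fun_pair2.
Qed.

End lebesgue_rV.

Section lebesgue_rV_box.
Context {R : realType}.

Definition lebesgue_rV n : {sigma_finite_measure set (borel 'rV[R]_n) -> \bar R} :=
  sval (cid (integral_rV_measure n)).

Lemma integral_rVE n (f : borel 'rV[R]_n -> \bar R) : measurable_fun setT f ->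
  (forall x, 0 <= f x)%E -> (integral_rV f = \int[lebesgue_rV n]_x f x)%E.
Proof. by rewrite /lebesgue_rV; case: cid => m hm; exact: hm. Qed.

Lemma integral_rV0 n : integral_rV (fun _ : 'rV[R]_n => 0%E) = 0%E.
Proof. by elim: n => //= n ih; rewrite ih integral0. Qed.

Definition box n (I : 'I_n -> set R) : set 'rV[R]_n := [set x | forall i, I i (x 0 i)].

Lemma box_measurable n (I : 'I_n -> set R) : (forall i, measurable (I i)) ->
  measurable (box I : set (borel 'rV[R]_n)).
Proof.
move=> mI; have -> : box I = \bigcap_(i in [set: 'I_n]) ((fun x => x 0 i) @^-1` I i).
  by apply/seteqP; split=> [x h i _|x h i]; exact: h.
apply: fin_bigcap_measurable => // i _.
by rewrite -[X in measurable X]setTI; apply: coord_borel.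
Qed.

Lemma integral_rV_box n (I : 'I_n -> set R) (l : R) : (forall i, measurable (I i)) ->
  (forall i, lebesgue_measure (I i) = l%:E) ->
  integral_rV (fun x => (\1_(box I) x)%:E) = (l ^+ n)%:E.
Proof.
elim: n I => [|n ih] I mI lI /=.
  by rewrite indicE mem_set ?expr0// => -[].
pose I' (i : 'I_n) := I (lift ord0 i).
have E (t : R) (u : 'rV[R]_n) : \1_(box I) (row_mx (t%:M : 'rV[R]_1) u : 'rV[R]_n.+1) =
    \1_(I ord0) t * \1_(box I') u :> R.
  have h0 : (row_mx (t%:M : 'rV[R]_1) u : 'rV[R]_n.+1) 0 ord0 = t.
    transitivity (row_mx (t%:M : 'rV[R]_1) u 0 (lshift n 0)).
      by congr (fun_of_matrix _ _ _); exact: val_inj.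
    by rewrite row_mxEl mxE eqxx mulr1n.
  have hS i : (row_mx (t%:M : 'rV[R]_1) u : 'rV[R]_n.+1) 0 (lift ord0 i) = u 0 i.
    rewrite -(row_mxEr (t%:M : 'rV[R]_1) u 0 i).
    by congr (fun_of_matrix _ _ _); exact: val_inj.
  rewrite !indicE -natrM mulnb; congr (_ %:R); congr nat_of_bool.
  apply/idP/idP => [/set_mem h|/andP[/set_mem It /set_mem Iu]]; last first.
    apply/mem_set => i.
    by have [j ->|->] := unliftP ord0 i; [rewrite hS; exact: Iu|rewrite h0].
  apply/andP; split; apply/mem_set; first by rewrite -h0; exact: h.
  by move=> i; rewrite -hS; exact: h.
have -> : (fun t => integral_rV (fun u : 'rV[R]_n =>
    (\1_(box I) (row_mx (t%:M : 'rV[R]_1) u : 'rV[R]_n.+1))%:E)) =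
    (fun t => (l ^+ n)%:E * (\1_(I ord0) t)%:E)%E.
  apply/funext => t; have [It|It] := boolP (t \in I ord0).
    rewrite [in RHS]indicE It mule1 -(ih I'); [|by move=> i; exact: mI|by move=> i; exact: lI].
    by congr integral_rV; apply/funext => u; rewrite E indicE It mul1r.
  rewrite [in RHS]indicE (negbTE It) mule0 -(integral_rV0 n).
  by congr integral_rV; apply/funext => u; rewrite E indicE (negbTE It) mul0r.
have l0 : 0 <= l by rewrite -lee_fin -(lI ord0).
rewrite ge0_integralZl//; last 2 first.
- by apply/measurable_EFinP; apply: measurable_indic; exact: mI.
- by rewrite lee_fin exprn_ge0.
rewrite integral_indic//; last exact: mI.
have := lI ord0; rewrite -[I ord0 in X in X -> _]setIT => lI0.
by rewrite [X in (_ * X)%E]lI0 -EFinM exprS mulrC.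
Qed.

Lemma lebesgue_rVE n (B : set (borel 'rV[R]_n)) : measurable B ->
  lebesgue_rV n B = integral_rV (fun x => (\1_B x)%:E).
Proof.
move=> mB; rewrite integral_rVE; first by rewrite integral_indic// setIT.
- by apply/measurable_EFinP; exact: measurable_indic.
- by move=> x; rewrite lee_fin.
Qed.

Lemma lebesgue_rV_box n (I : 'I_n -> set R) (l : R) : (forall i, measurable (I i)) ->
  (forall i, lebesgue_measure (I i) = l%:E) -> lebesgue_rV n (box I) = (l ^+ n)%:E.
Proof.
move=> mI lI; rewrite lebesgue_rVE; last exact: box_measurable.
exact: integral_rV_box.
Qed.

Lemma lebesgue_rV_cube n k (z : {ffun 'I_n -> int}) :
  measurable (cube k z : set (borel 'rV[R]_n)) /\
  lebesgue_rV n (cube k z : set (borel 'rV[R]_n)) = (((2 ^+ k)^-1) ^+ n)%:E.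
Proof.
have -> : cube k z = box (fun i => `[(z i)%:~R / 2 ^+ k, (z i + 1)%:~R / 2 ^+ k[%classic : set R).
  have p : 0 < (2 : R) ^+ k by rewrite exprn_gt0.
  have P (x : 'rV[R]_n) i : (Num.floor (2 ^+ k * x 0 i) == z i) =
      ((z i)%:~R / 2 ^+ k <= x 0 i < (z i + 1)%:~R / 2 ^+ k).
    by rewrite floor_eq ler_pdivrMr// ltr_pdivlMr// mulrC.
  apply/seteqP; split=> [x /= xz i|x /= h].
    by rewrite /= in_itv/= -P -xz ffunE.
  by apply/ffunP => i; apply/eqP; rewrite ffunE P; have := h i; rewrite /= in_itv.
split; first by apply: box_measurable.
apply: lebesgue_rV_box => // i.
have p : 0 < ((2 : R) ^+ k)^-1 by rewrite invr_gt0 exprn_gt0.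
rewrite lebesgue_measure_itv/= lte_fin ltr_pM2r// ltr_int ltrDl ltr01 -EFinB intrD.
by congr (_%:E); rewrite mulrDl addrAC subrr add0r mul1r.
Qed.

End lebesgue_rV_box.

(** * Regularity of finite Borel measures on row vectors *)

Section regularity.
Context {R : realType} {n : nat}.
Variable m : {measure set (borel 'rV[R]_n) -> \bar R}.
Hypothesis finm : (m setT < +oo)%E.

Lemma closed_borel (F : set 'rV[R]_n) : closed F -> measurable (F : set (borel 'rV[R]_n)).
Proof.
by move=> cF; rewrite -[F]setCK; apply: measurableC; apply: open_borel; exact: closed_openC.
Qed.

(** Continuity from above. It serves twice: to exhaust an open set by closed sets, and to truncate a
    countable union. *)
Lemma measure_vanish (D : nat -> set (borel 'rV[R]_n)) (e : R) : 0 < e ->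
  (forall k, measurable (D k)) -> (forall i j, (i <= j)%N -> D j `<=` D i) ->
  \bigcap_k D k = set0 -> exists k, (m (D k) < e%:E)%E.
Proof.
move=> e0 mD nD D0; apply: contrapT => /forallNP h.
have ge k : (e%:E <= m (D k))%E by rewrite leNgt; apply/negP; exact: h.
have fD : (m (D 0%N) < +oo)%E by apply: le_lt_trans finm; apply: le_measure; rewrite ?inE.
have : (m \o D) @ \oo --> m (\bigcap_k D k).
  apply: nonincreasing_cvg_mu => //; first by rewrite D0.
  by move=> i j ij; apply/subsetPset; exact: nD.
rewrite D0 measure0 => c; have : (e%:E <= limn (m \o D))%E.
  by apply: lime_ge; [exact: cvgP c|apply: nearW => k; exact: ge].
by rewrite (cvg_lim _ c)// lee_fin leNgt e0.
Qed.

(** Asking for a closed and an open approximation together makes the class stable under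
    complements. *)
Definition regular (B : set 'rV[R]_n) := forall e : R, 0 < e -> exists F U,
  [/\ closed F, open U, F `<=` B, B `<=` U & (m (U `\` F) < e%:E)%E].

(** The closed sets [F k], of points at distance at least [1 / (k + 1)] from the complement, exhaust
    [U]. *)
Lemma open_regular U : open U -> regular U.
Proof.
move=> oU e e0; pose F k := [set x : 'rV[R]_n | ball x k.+1%:R^-1 `<=` U].
have cF k : closed (F k).
  rewrite -[F k]setCK; apply: open_closedC.
  have -> : ~` F k = \bigcup_(y in ~` U) ball y k.+1%:R^-1.
    apply/seteqP; split=> [x /= /existsNP[y /not_implyP[xy Uy]]|x [y Uy yx] Fx].
      by exists y => //; exact: ball_sym.
    by apply: Uy; apply: Fx; exact: ball_sym.
  by apply: bigcup_open => y _; exact: ball_open.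
have FU k : F k `<=` U by move=> x; apply; exact: ballxx.
have nF i j : (i <= j)%N -> F i `<=` F j.
  move=> ij x Fx y xy; apply: Fx; apply: le_ball xy.
  by rewrite lef_pV2 ?posrE// ler_nat.
have [k hk] : exists k, (m (U `\` F k) < e%:E)%E.
  apply: measure_vanish => //.
  - by move=> k; apply: measurableD; [exact: open_borel|exact: closed_borel].
  - by move=> i j ij; apply: setDS; exact: nF.
  - rewrite -subset0 => x Ux; have Ux0 : U x by have [] := Ux 0%N Logic.I.
    have /nbhs_ballP[d /= d0 dU] : nbhs x U by exact: open_nbhs_nbhs.
    have [k _ hk] := near_infty_natSinv_lt (PosNum d0).
    have [_] := Ux k Logic.I; apply => y xy; apply: dU; apply: le_ball xy.
    by apply: ltW; apply: hk => /=.
by exists (F k), U; split.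
Qed.

Lemma regularC B : regular B -> regular (~` B).
Proof.
move=> rB e e0; have [F [U [cF oU FB BU mUF]]] := rB e e0.
exists (~` U), (~` F); split; [exact: open_closedC|exact: closed_openC|exact: subsetC|exact: subsetC|].
by rewrite setDE setCK setIC -setDE.
Qed.

(** One half of [e] pays for approximating all the [B k], at geometrically decreasing cost; the
    other half for replacing the union of the closed sets, which need not be closed, by a finite
    one. *)
Lemma regular_bigcup (B : nat -> set 'rV[R]_n) :
  (forall k, regular (B k)) -> regular (\bigcup_k B k).
Proof.
move=> rB e e0; have e2 : 0 < e / 2 by rewrite divr_gt0.
have /choice[FU hFU] : forall k, exists FU : set 'rV[R]_n * set 'rV[R]_n,
    [/\ closed FU.1, open FU.2, FU.1 `<=` B k, B k `<=` FU.2 &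
     (m (FU.2 `\` FU.1) < (e / 2 / (2 ^ k.+1)%:R)%:E)%E].
  move=> k; have : 0 < e / 2 / (2 ^ k.+1)%:R by rewrite divr_gt0// ltr0n expn_gt0.
  by move=> /(rB k)[F [U h]]; exists (F, U).
pose F k := (FU k).1; pose U k := (FU k).2.
have cF k : closed (F k) by have [] := hFU k.
have oU k : open (U k) by have [] := hFU k.
have mF k := closed_borel (cF k); have mU k := open_borel (oU k).
pose G K := \big[setU/set0]_(k < K) F k.
have cG K : closed (G K) by apply: closed_bigsetU => k _; exact: cF.
have GF K : G K `<=` \bigcup_k F k.
  by rewrite /G -bigcup_mkord => x [k _ Fx]; exists k.
have mUF : measurable (\bigcup_k F k : set (borel 'rV[R]_n)) by exact: bigcupT_measurable.
have mUU : measurable (\bigcup_k U k : set (borel 'rV[R]_n)) by exact: bigcupT_measurable.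
have [K hK] : exists K, (m (\bigcup_k F k `\` G K) < (e / 2)%:E)%E.
  apply: measure_vanish => //.
  - by move=> K; apply: measurableD => //; exact: closed_borel.
  - move=> i j ij; apply: setDS; rewrite /G -!bigcup_mkord => x [k /= ki Fx].
    by exists k => //=; exact: leq_trans ij.
  - rewrite -subset0 => x Fx; have [[k _ Fkx] _] := Fx 0%N Logic.I.
    have [_] := Fx k.+1 Logic.I; apply; rewrite /G -bigcup_mkord.
    by exists k => /=.
have hX : (m (\bigcup_k U k `\` \bigcup_k F k) <= (e / 2)%:E)%E.
  apply: (@le_trans _ _ (\sum_(0 <= k <oo) m (U k `\` F k))%E).
    apply: measure_sigma_subadditive.
    - by move=> k; exact: measurableD.
    - exact: measurableD.
    - by move=> x [[k _ Ux] Fx]; exists k => //; split=> // Fkx; apply: Fx; exists k.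
  apply: le_trans (epsilon_trick0 xpredT (ltW e2)).
  by apply: lee_nneseries => // k _; apply: ltW; have [] := hFU k.
exists (G K), (\bigcup_k U k); split=> //.
- exact: bigcup_open.
- by move=> x /GF [k _ Fx]; exists k => //; have [_ _ + _ _] := hFU k; apply.
- by move=> x [k _ Bx]; exists k => //; have [_ _ _ + _] := hFU k; apply.
apply: (@le_lt_trans _ _ (m (\bigcup_k U k `\` \bigcup_k F k) + m (\bigcup_k F k `\` G K))%E).
  apply: le_trans (measureU2 _ _ _); last 2 first.
  - exact: measurableD.
  - by apply: measurableD => //; exact: closed_borel.
  apply: le_measure; rewrite ?inE.
  - by apply: measurableD => //; exact: closed_borel.
  - by apply: measurableU; apply: measurableD => //; exact: closed_borel.
  - by move=> x [Ux Gx]; have [Fx|Fx] := pselect ((\bigcup_k F k) x); [right|left].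
have -> : e%:E = ((e / 2)%:E + (e / 2)%:E)%E by rewrite -EFinD -splitr.
have fX : (m (\bigcup_k U k `\` \bigcup_k F k)) \is a fin_num.
  by rewrite ge0_fin_numE//; apply: le_lt_trans hX _; exact: ltry.
by rewrite -(fineK fX) in hX *; apply: lee_ltD.
Qed.

Lemma borel_regular B : measurable (B : set (borel 'rV[R]_n)) -> regular B.
Proof.
apply: smallest_sub; last exact: open_regular.
split.
- by apply: open_regular; exact: open0.
- by move=> A rA; rewrite setTD; exact: regularC.
- exact: regular_bigcup.
Qed.

End regularity.

(** * Images of null sets under Lipschitz maps, then under C^1 maps *)

Section lipschitz_negligible.
Context {R : realType} {n : nat}.
Local Notation lam := (@lebesgue_rV R n).

Lemma null_open_cover (Q N : set (borel 'rV[R]_n)) (e : R) : open (Q : set 'rV[R]_n) ->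
  (lam Q < +oo)%E -> measurable N -> lam N = 0%E -> N `<=` Q -> 0 < e ->
  exists U : set 'rV[R]_n, [/\ open U, N `<=` U, U `<=` Q & (lam U <= e%:E)%E].
Proof.
move=> oQ fQ mN N0 NQ e0; have mQ := open_borel oQ.
(* Regularity is available for finite measures, hence the restriction to [Q]. *)
pose m : {measure set (borel 'rV[R]_n) -> \bar R} := mrestr lam mQ.
have fm : (m setT < +oo)%E by rewrite /m /= /mrestr setTI.
have [F [U [cF oU FN NU mUF]]] := borel_regular fm mN e0.
have mF := closed_borel cF; have mU := open_borel oU.
exists (U `&` Q); split.
- exact: openI.
- by move=> x Nx; split; [exact: NU|exact: NQ].
- by move=> x [].
apply: le_trans (_ : _ <= m (U `\` F) + lam F)%E _.
  apply: le_trans (measureU2 _ _ _) => //; last by apply: measurableI => //; exact: measurableD.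
  apply: le_measure; rewrite ?inE; first exact: measurableI.
    by apply: measurableU => //; apply: measurableI => //; exact: measurableD.
  by move=> x [Ux Qx]; have [Fx|Fx] := pselect (F x); [right|left].
have -> : lam F = 0%E by apply: subset_measure0 N0.
by rewrite adde0 ltW.
Qed.

(* The maximal dyadic cubes inside [U]. *)
Definition good_cube (U : set 'rV[R]_n) k (z : {ffun 'I_n -> int}) :=
  cube k z `<=` U /\ forall k' (x : 'rV[R]_n), (k' < k)%N -> cube k z x -> ~ cube k' (dyadic k' x) `<=` U.

(** A point of [U] lies in the cube of the least generation contained in [U]. Two selected cubes
    with a common point have the same generation, since the coarser one would contradict the
    maximality of the finer one. *)
Lemma open_cubes (U : set 'rV[R]_n) : open U ->
  exists2 kz : nat -> option (nat * {ffun 'I_n -> int}),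
    U = \bigcup_j oapp (fun p => cube p.1 p.2) set0 (kz j) &
    trivIset setT (fun j => oapp (fun p => @cube R n p.1 p.2) set0 (kz j)).
Proof.
move=> oU.
(* Indices that code no maximal cube contribute the empty set. *)
pose kz j : option (nat * {ffun 'I_n -> int}) :=
  if pickle_inv j is Some p then if `[< good_cube U p.1 p.2 >] then Some p else None else None.
exists kz.
  apply/seteqP; split=> [x Ux|x [j _]]; last first.
    rewrite /kz; case: (pickle_inv j) => // p; case: asboolP => // -[pU _].
    exact: pU.
  have ex : exists k, `[< cube k (dyadic k x) `<=` U >].
    by have [k hk] := cube_sub_open oU Ux; exists k; apply/asboolP.
  have [k /asboolP kU mk] := ex_minnP ex.
  exists (pickle (k, dyadic k x)) => //; rewrite /kz pickleK_inv.
  case: asboolP => // -[]; split=> // k' y k'k yx kU'.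
  have := mk k'; rewrite leqNgt k'k => /(_ _)/negP; apply => //; apply/asboolP.
  by rewrite -(dyadic_nested (ltnW k'k) (x := y)).
apply/trivIsetP => i j _ _ ij; rewrite -subset0 => x [] /=.
rewrite /kz.
have := @pickle_invK (nat * {ffun 'I_n -> int})%type i.
have := @pickle_invK (nat * {ffun 'I_n -> int})%type j.
case: (pickle_inv i) => [[k z]|//]; case: (pickle_inv j) => [[k' z']|//] /= ej ei.
case: asboolP => // -[/= zU zN]; case: asboolP => // -[/= zU' zN'] /= xz xz'.
have [kk'|kk'|kk'] := ltngtP k k'.
- by have := zN' k x kk' xz'; apply; rewrite [dyadic k x]xz.
- by have := zN k' x kk' xz; apply; rewrite [dyadic k' x]xz'.
- by move/eqP: ij; apply; rewrite -ei -ej -xz -xz' kk'.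
Qed.

(** Lipschitz for the sup norm, so that the image of a cube fits into a cube. *)
Definition coord_lipschitz (Q : set 'rV[R]_n) (L : R) (f : 'rV[R]_n -> 'rV[R]_n) :=
  forall x y d, Q x -> Q y -> (forall i, `|x 0 i - y 0 i| <= d) ->
    forall i, `|f x 0 i - f y 0 i| <= L * d.

Lemma lipschitz_null_cover (Q N : set (borel 'rV[R]_n)) (L e : R) f :
  open (Q : set 'rV[R]_n) -> (lam Q < +oo)%E -> 0 <= L -> coord_lipschitz Q L f ->
  measurable N -> lam N = 0%E -> N `<=` Q -> 0 < e ->
  exists D : set (borel 'rV[R]_n), [/\ measurable D, f @` N `<=` D &
    (lam D <= ((L + L) ^+ n)%:E * e%:E)%E].
Proof.
move=> oQ fQ L0 fL mN N0 NQ e0.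
have [U [oU NU UQ Ue]] := null_open_cover oQ fQ mN N0 NQ e0.
have [kz UE tkz] := open_cubes oU.
pose C j : set (borel 'rV[R]_n) := oapp (fun p => cube p.1 p.2) set0 (kz j).
have mC j : measurable (C j).
  by rewrite /C; case: (kz j) => [[k z]|] //=; have [] := @lebesgue_rV_cube R n k z.
have CU j : C j `<=` U by rewrite UE => x Cx; exists j.
have /choice[D hD] : forall j, exists D : set (borel 'rV[R]_n), [/\ measurable D,
    f @` C j `<=` D & (lam D <= ((L + L) ^+ n)%:E * lam (C j))%E].
  move=> j; have [C0|/set0P[x0 Cx0]] := eqVneq (C j) set0.
    by exists set0; split=> //; rewrite ?C0 ?image_set0// !measure0 mule0.
  move: (CU j) Cx0; rewrite /C; case: (kz j) => [[k z]|]//= zU zx0.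
  have [_ ->] := @lebesgue_rV_cube R n k z.
  (* The image of a cube of side [2^-k] lies in a box of half side [l] around [f x0], whence the
     factor [(L + L) ^+ n]. *)
  pose l := L * (2 ^+ k)^-1.
  have l0 : 0 <= l by rewrite mulr_ge0// invr_ge0 exprn_ge0.
  exists (box (fun i => `[f x0 0 i - l, f x0 0 i + l]%classic)); split.
  - exact: box_measurable.
  - move=> _ [x zx <-] i; rewrite /= in_itv/= -ler_distlC.
    apply: fL; [exact/UQ/zU|exact/UQ/zU|] => i'.
    by apply/ltW/dyadic_dist; rewrite [LHS]zx0 [RHS]zx.
  - rewrite (@lebesgue_rV_box _ _ _ (l + l)) => [|//|i].
      by rewrite -EFinM lee_fin -exprMn /l mulrDl.
    rewrite lebesgue_measure_itv/= lte_fin; case: ifPn => [_|].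
      by rewrite -EFinB; congr (_%:E); ring.
    (* Here the interval is a single point and [l] is 0. *)
    rewrite -leNgt => h; congr (_%:E); move: h l0; lra.
exists (\bigcup_j D j); split.
- by apply: bigcupT_measurable => j; have [] := hD j.
- move=> _ [x /NU + <-]; rewrite UE => -[j _ Cx].
  by exists j => //; have [_ + _] := hD j; apply; exists x.
apply: le_trans (_ : _ <= \sum_(0 <= j <oo) lam (D j))%E _.
  apply: measure_sigma_subadditive => //; first by move=> j; have [] := hD j.
  by apply: bigcupT_measurable => j; have [] := hD j.
apply: le_trans (_ : _ <= \sum_(0 <= j <oo) ((L + L) ^+ n)%:E * lam (C j))%E _.
  by apply: lee_nneseries => // j _; have [] := hD j.
rewrite nneseriesZl//; apply: lee_wpmul2l; first by rewrite lee_fin exprn_ge0// addr_ge0.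
have <- // : lam U = (\sum_(0 <= j <oo) lam (C j))%E.
by rewrite {1}UE; apply: measure_semi_bigcup => //; exact: bigcupT_measurable.
Qed.

(** The image of [N] need not be Borel, so it is enclosed in a countable intersection of Borel
    covers whose measures tend to 0. *)
Lemma lipschitz_negligible (Q N : set (borel 'rV[R]_n)) (L : R) f :
  open (Q : set 'rV[R]_n) -> (lam Q < +oo)%E -> 0 <= L -> coord_lipschitz Q L f ->
  N `<=` Q -> lam.-negligible N -> lam.-negligible (f @` N : set (borel 'rV[R]_n)).
Proof.
move=> oQ fQ L0 fL NQ [N' [mN' N'0 NN']].
have mQ := open_borel oQ.
pose N2 := N' `&` Q.
have mN2 : measurable N2 by exact: measurableI.
have N20 : lam N2 = 0%E by apply: (subset_measure0 mN2 mN' _ N'0) => x [].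
have N2Q : N2 `<=` Q by move=> x [].
have /choice[D hD] : forall j, exists D : set (borel 'rV[R]_n), [/\ measurable D,
    f @` N2 `<=` D & (lam D <= ((L + L) ^+ n)%:E * (j.+1%:R^-1)%:E)%E].
  by move=> j; apply: (lipschitz_null_cover oQ fQ L0 fL mN2 N20 N2Q).
have mD : measurable (\bigcap_j D j) by apply: bigcapT_measurable => j; have [] := hD j.
exists (\bigcap_j D j); split=> //; last first.
  move=> y [x Nx <-] j _; have [_ + _] := hD j; apply; exists x => //.
  by split; [exact: NN'|exact: NQ].
apply/eqP; rewrite eq_le measure_ge0 andbT; apply/lee_addgt0Pr => e e0; rewrite add0e.
set K := (L + L) ^+ n.
have K0 : 0 <= K by rewrite exprn_ge0// addr_ge0.
(* Adding 1 keeps the denominator positive when [K] is 0. *)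
have eK : 0 < e / (K + 1) by rewrite divr_gt0// ltr_wpDl.
have [j _ hj] := near_infty_natSinv_lt (PosNum eK).
have [mDj _ lDj] := hD j.
apply: le_trans (_ : lam (D j) <= _)%E.
  by apply: le_measure; rewrite ?inE// => x; apply.
apply: le_trans lDj _; rewrite -EFinM lee_fin.
have := hj j (leqnn j); rewrite /= ltr_pdivlMr ?ltr_wpDl// => h.
have : 0 < j.+1%:R^-1 :> R by rewrite invr_gt0.
by move: h; rewrite -/K; move: (j.+1%:R^-1) => a h1 h2; rewrite mulrDr mulr1 in h1; rewrite mulrC; lra.
Qed.

End lipschitz_negligible.

Section C1_lipschitz.
Context {R : realType} {n : nat}.
Local Notation lam := (@lebesgue_rV R n).
Implicit Types (f : 'rV[R]_n -> 'rV[R]_n) (O : set 'rV[R]_n).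

Lemma lebesgue_rV_ball_fin (p : 'rV[R]_n) (r : R) : 0 < r -> (lam (ball p r) < +oo)%E.
Proof.
move=> r0; pose B := box (fun i => `[p 0 i - r, p 0 i + r]%classic : set R).
have lB : lam B = ((r + r) ^+ n)%:E.
  apply: lebesgue_rV_box => // i.
  rewrite lebesgue_measure_itv/= lte_fin ifT; last by move: r0; lra.
  by rewrite -EFinB; congr (_%:E); ring.
have mB : measurable (B : set (borel 'rV[R]_n)) by exact: box_measurable.
apply: (@le_lt_trans _ _ (lam B)); last by rewrite lB ltry.
apply: le_measure; rewrite ?inE//; first by apply: open_borel; exact: ball_open.
move=> x [_ px] i; rewrite /= in_itv/= -ler_distlC.
by have := px 0 i; rewrite /ball /= => /ltW.
Qed.

Lemma is_derive_line f (x v : 'rV[R]_n) (t : R) j : differentiable f (x + t *: v) ->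
  is_derive t (1 : R) (fun s : R => f (x + s *: v) 0 j) ('D_v f (x + t *: v) 0 j).
Proof.
move=> df; set w := x + t *: v.
have dv : derivable f w v by exact: diff_derivable.
have c1 : (fun h : R => (h^-1 *: ((f \o shift w) (h *: v) - f w)) 0 j) @ 0^' -->
    'D_v f w 0 j.
  have dv' : (fun h : R => h^-1 *: ((f \o shift w) (h *: v) - f w)) @ 0^' --> 'D_v f w := dv.
  apply: (cvg_comp _ (fun M : 'rV[R]_n => M 0 j) dv').
  exact: matrix_normedtype.coord_continuous.
have E : (fun h : R => h^-1 *: (((fun s : R => f (x + s *: v) 0 j) \o shift t) (h *: (1 : R)) -
    f (x + t *: v) 0 j)) =
    (fun h : R => (h^-1 *: ((f \o shift w) (h *: v) - f w)) 0 j).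
  apply/funext => h; rewrite !mxE /=; congr (_ * (f _ _ _ - _)).
  rewrite /w [h *: 1]mulr1 scalerDl.
  by rewrite addrA [_ + h *: v]addrC -addrA.
by split; [apply: (cvgP ('D_v f w 0 j)); rewrite E|apply: cvg_lim => //; rewrite E].
Qed.

Lemma derive_coordE f w (v : 'rV[R]_n) j : differentiable f w ->
  'D_v f w 0 j = \sum_i v 0 i * 'D_(delta_mx 0 i) f w 0 j.
Proof.
move=> df.
have e1 (u : 'rV[R]_n) : 'D_u f w = u *m jacobian f w := deriveEjacobian u df.
rewrite (congr1 (fun M : 'rV[R]_n => M 0 j) (e1 v)) mxE; apply: eq_bigr => i _.
rewrite (congr1 (fun M : 'rV[R]_n => M 0 j) (e1 (delta_mx 0 i))).
by rewrite -rowE [in RHS]mxE.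
Qed.

Lemma ball_line (p x y : 'rV[R]_n) r (t : R) : 0 <= t <= 1 ->
  ball p r x -> ball p r y -> ball p r (x + t *: (y - x)).
Proof.
move=> /andP[t0 t1] [r0 px] [_ py]; split=> // i j.
have := px i j; have := py i j; rewrite /ball /= !mxE !ltr_norml.
move=> /andP[a b] /andP[c d].
have convex (s u : R) : 0 < s -> 0 < u -> 0 < s + t * (u - s).
  by move=> s0 u0; case: (leP s u) => su; nra.
apply/andP; split.
  have := convex (p i j - x i j + r) (p i j - y i j + r); lra.
have := convex (r - (p i j - x i j)) (r - (p i j - y i j)); lra.
Qed.

(** On a ball where the partial derivatives are bounded by [B], the mean value theorem on the
    segment from [x] to [y] gives the constant [n B]. It is applied to one coordinate at a time, as
    it fails for vector-valued maps. *)
Lemma C1_lipschitz O f p : open O -> Ck_on 1 O f -> O p ->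
  exists r L, [/\ 0 < r, 0 <= L, ball p r `<=` O & coord_lipschitz (ball p r) L f].
Proof.
move=> oO [df cdf] Op.
(* The sum dominates each partial derivative at [p], and 1 allows for their variation near [p]. *)
pose B := \sum_(i < n) \sum_(j < n) `|'D_(delta_mx 0 i) f p 0 j| + 1.
have nB : \forall w \near p, forall i j : 'I_n, `|'D_(delta_mx 0 i) f w 0 j| <= B.
  apply: (@filter_forall _ _ (fun i w => forall j : 'I_n,
    `|'D_(delta_mx 0 i) f w 0 j| <= B) (nbhs p)) => i.
  apply: (@filter_forall _ _ (fun j w => `|'D_(delta_mx 0 i) f w 0 j| <= B) (nbhs p)) => j.
  have := continuous_coord (i := 0) (j := j) (cdf (delta_mx 0 i) p Op).
  move=> /cvgrPdist_lt/(_ 1 ltr01); apply: filterS => w hw.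
  have : `|'D_(delta_mx 0 i) f p 0 j| <= \sum_(i < n) \sum_(j < n) `|'D_(delta_mx 0 i) f p 0 j|.
    rewrite (bigD1 i)//= (bigD1 j)//= -addrA lerDl addr_ge0//.
      by apply: sumr_ge0.
    by apply: sumr_ge0 => k _; apply: sumr_ge0.
  have := ler_norm ('D_(delta_mx 0 i) f w 0 j).
  have := ler_normB ('D_(delta_mx 0 i) f p 0 j) ('D_(delta_mx 0 i) f p 0 j - 'D_(delta_mx 0 i) f w 0 j).
  by rewrite opprB addrC subrK /B => h1 _ h2; apply: le_trans h1 _; move: hw h2; lra.
have B0 : 0 <= B.
  by rewrite addr_ge0//; apply: sumr_ge0 => i _; apply: sumr_ge0.
have : \forall w \near p, O w /\ forall i j : 'I_n, `|'D_(delta_mx 0 i) f w 0 j| <= B.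
  by apply: filterI => //; exact: open_nbhs_nbhs.
move=> /nbhs_ballP[r /= r0 hr]; exists r, (n%:R * B); split=> //.
- by rewrite mulr_ge0.
- by move=> x /hr[].
move=> x y d px py xyd j.
have line (t : R) : 0 <= t <= 1 -> ball p r (x + t *: (y - x)) by move=> t01; exact: ball_line.
pose g (t : R) := f (x + t *: (y - x)) 0 j.
have gd (t : R) : 0 <= t <= 1 -> is_derive t (1 : R) g ('D_(y - x) f (x + t *: (y - x)) 0 j).
  by move=> /line/hr[Ow _]; apply: is_derive_line; exact: df.
have [t t01 gE] : exists2 t : R, t \in `]0, 1[%R &
    g 1 - g 0 = 'D_(y - x) f (x + t *: (y - x)) 0 j * (1 - 0).
  apply: (@MVT _ g (fun t : R => 'D_(y - x) f (x + t *: (y - x)) 0 j)) => // [t|].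
    by rewrite in_itv/= => /andP[t0 t1]; apply: gd; rewrite !ltW.
  apply: continuous_in_subspaceT => t; rewrite inE/= in_itv/= => t01.
  apply: differentiable_continuous; apply/derivable1_diffP.
  by have [] := gd t t01.
move: t01; rewrite in_itv/= => /andP[t0 t1].
have tt : 0 <= t <= 1 by rewrite !ltW.
move: gE; rewrite subr0 mulr1 /g scale1r scale0r addr0 subrKC => gE.
rewrite distrC gE; have [Ow bw] := hr _ (line t tt).
rewrite derive_coordE; last exact: df.
apply: le_trans (ler_norm_sum _ _ _) _.
apply: (@le_trans _ _ (\sum_(i < n) B * d)); last first.
  by rewrite sumr_const card_ord -mulrA mulr_natl.
apply: ler_sum => i _; rewrite normrM mulrC; apply: ler_pM => //.
by rewrite !mxE distrC.
Qed.

(** The balls on which [f] is Lipschitz are uncountably many; the dyadic cubes inside such balls are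
    countable and still cover [O]. *)
Lemma C1_negligible O f (N : set (borel 'rV[R]_n)) : open O -> Ck_on 1 O f ->
  N `<=` O -> lam.-negligible N -> lam.-negligible (f @` N : set (borel 'rV[R]_n)).
Proof.
move=> oO fO NO N0.
pose good (c : nat * {ffun 'I_n -> int}) := exists p r L, [/\ 0 < r, 0 <= L,
  cube c.1 c.2 `<=` ball p r & coord_lipschitz (ball p r) L f].
have -> : f @` N = \bigcup_k (f @` (N `&`
    oapp (fun c => if `[< good c >] then cube c.1 c.2 else set0) set0 (unpickle k))).
  apply/seteqP; split=> [_ [x Nx <-]|_ [k _ [x [Nx _] <-]]]; last by exists x.
  have [r [L [r0 L0 rO fL]]] := C1_lipschitz oO fO (NO _ Nx).
  have [k hk] := cube_sub_open (ball_open x r) (ballxx x r0).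
  exists (pickle (k, dyadic k x)) => //; exists x => //; split=> //.
  rewrite pickleK /=; case: asboolP => // -[]; exists x, r, L; split=> //.
apply: negligible_bigcup => k.
case: (unpickle k) => [c|] /=; last first.
  by rewrite setI0 image_set0; exact: negligible_set0.
case: asboolP => [[p [r [L [r0 L0 cp fL]]]]|_]; last first.
  by rewrite setI0 image_set0; exact: negligible_set0.
apply: (lipschitz_negligible _ (lebesgue_rV_ball_fin p r0) L0 fL).
- exact: ball_open.
- by move=> x [_ /cp].
- by apply: negligibleS N0 => x [].
Qed.

End C1_lipschitz.

(** * Volume measure *)

(** Lindelof's argument: the basic open sets satisfying [P] are listed through the injection [f]. An
    index without such a set gives the empty set, for which [P] holds by monotonicity. *)
Lemma second_countable_cover (M : ptopologicalType) (P : set M -> Prop) :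
  @second_countable M -> (forall U V, U `<=` V -> P V -> P U) ->
  (forall x, exists U, [/\ open U, U x & P U]) ->
  exists U : nat -> set M, (forall k, open (U k) /\ P (U k)) /\ \bigcup_k U k = setT.
Proof.
move=> [B /countable_injP[f injf] [oB bB]] mono loc.
have P0 : P set0 by have [U [_ _ PU]] := loc point; exact: mono PU.
pose U k := xget set0 [set V | [/\ B V, P V & f V = k]].
exists U; split=> [k|].
  rewrite /U; case: xgetP => [V _ [BV PV _]|_]; last by split=> //; exact: open0.
  by split=> //; exact: oB.
apply/seteqP; split=> // x _; have [W [oW Wx PW]] := loc x.
have [V [BV Vx] VW] : filter_from [set U | B U /\ U x] id W.
  by apply: bB; exact: open_nbhs_nbhs.
exists (f V) => //; rewrite /U; case: xgetP => [V' _ [BV' _ fV]|/(_ V)].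
  by rewrite (injf V' V)// inE.
by case; split=> //; exact: mono PW.
Qed.

Lemma continuous_on_borel (T U : ptopologicalType) (O : set T) (f : T -> U) : open O ->
  (forall x, O x -> {for x, continuous f}) ->
  measurable_fun (O : set (borel T)) (f : borel T -> borel U).
Proof.
move=> oO cf.
suff h : preimage_set_system O f open `<=` (measurable : set (set (borel T))).
  exact: (@measurability _ _ (borel T) (borel U) O f open erefl h).
by move=> _ [W oW <-]; apply: open_borel; exact: open_setI_preimage.
Qed.

Lemma continuous_on_borel_real (R : realType) (T : ptopologicalType) (O : set T) (f : T -> R) :
  open O -> (forall x, O x -> {for x, continuous f}) ->
  measurable_fun (O : set (borel T)) (f : borel T -> R).
Proof.
move=> oO cf.
suff h : preimage_set_system O f (@RGenOpens.G R) `<=` (measurable : set (set (borel T))).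
  exact: (@measurability _ _ (borel T) R O f (@RGenOpens.G R) (@RGenOpens.measurableE R) h).
move=> _ [_ [x [y ->]] <-]; apply: open_borel.
by apply: open_setI_preimage => //; exact: interval_open.
Qed.

Section volume_measure.
Context {R : realType} {n : nat} {M : ptopologicalType}.
Context {A : oriented_manifold R n M} {S : spacetime A}.
Variable mu : {measure set (borel M) -> \bar R}.
Hypothesis hmu : is_volume_measure S mu.
Local Notation lam := (@lebesgue_rV R n).
Implicit Types (c : chart A) (B : set (borel M)).

Definition density c (u : 'rV[R]_n) : R := Num.sqrt `|\det (gram S c (param c u))|.

Lemma density_gt0 c u : (coord c @` dom c) u -> 0 < density c u.
Proof.
move=> [x cx <-]; rewrite sqrtr_gt0 normr_gt0 coordK// -unitfE -unitmxE.
exact: gram_unit.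
Qed.

Lemma density_continuous c u : (coord c @` dom c) u -> {for u, continuous (density c)}.
Proof.
move=> cu.
apply: (@continuous_comp _ _ _ (fun w => `|\det (gram S c (param c w))|) Num.sqrt);
  last exact: sqrt_continuous.
suff h : {for u, continuous (fun w => \det (gram S c (param c w)))} by exact: (cvg_norm h).
apply: continuous_det; apply: continuous_mx => i j.
have -> : (fun w => gram S c (param c w) i j) = (fun w =>
    metric S (partial c (param c w) i) (partial c (param c w) j)).
  by apply/funext => w; rewrite mxE.
exact: (smooth_on_continuous (metric_smooth S c i j) cu).
Qed.

(** This trades an image for a preimage under [param c], whose measurability follows from
    continuity. *)
Lemma chart_imageE c B : B `<=` dom c ->
  coord c @` B = coord c @` dom c `&` param c @^-1` B.
Proof.
move=> Bc; apply/seteqP; split=> [_ [x Bx <-]|_ [[x cx <-]]].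
  by split; [exists x => //; exact: Bc|rewrite /= coordK//; exact: Bc].
by rewrite /= coordK// => Bx; exists x.
Qed.

Lemma chart_image_borel c B : measurable B -> B `<=` dom c ->
  measurable (coord c @` B : set (borel 'rV[R]_n)).
Proof.
move=> mB Bc; rewrite chart_imageE//.
apply: (@continuous_on_borel 'rV[R]_n M (coord c @` dom c) (param c)) => //.
- exact: coord_open.
- by move=> _ [x cx <-]; exact: param_continuous.
- by apply: open_borel; exact: coord_open.
Qed.

Lemma density_measurable c B : measurable B -> B `<=` dom c ->
  measurable_fun (coord c @` B : set (borel 'rV[R]_n))
    (fun u : borel 'rV[R]_n => (density c u)%:E).
Proof.
move=> mB Bc; apply/measurable_EFinP.
apply: (@measurable_funS _ _ _ _ (coord c @` dom c : set (borel 'rV[R]_n))).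
- by apply: open_borel; exact: coord_open.
- by move=> _ [x Bx <-]; exists x => //; exact: Bc.
- apply: (@continuous_on_borel_real R 'rV[R]_n); first exact: coord_open.
  exact: density_continuous.
Qed.

Lemma volume_chart c B : measurable B -> B `<=` dom c ->
  mu B = (\int[lam]_(u in coord c @` B) (density c u)%:E)%E.
Proof.
move=> mB Bc; rewrite (hmu mB Bc) integral_mkcond.
have mI := chart_image_borel mB Bc.
rewrite -integral_rVE.
- congr integral_rV; apply/funext => u; rewrite /patch indicE; case: ifP => uB.
    by rewrite mul1r.
  by rewrite mul0r.
- by apply/(measurable_restrictT _ mI); exact: density_measurable.
- by move=> u; rewrite /patch; case: ifP => // _; rewrite lee_fin sqrtr_ge0.
Qed.

(** The density is positive on the chart, so its integral over a set vanishes only if the set is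
    null. *)
Lemma volume_null_chart c B : measurable B -> B `<=` dom c ->
  mu B = 0%E <-> lam (coord c @` B) = 0%E.
Proof.
move=> mB Bc; rewrite (volume_chart mB Bc).
have mI := chart_image_borel mB Bc; have md := density_measurable mB Bc.
split=> [I0|]; last by move=> l0; exact: null_set_integral.
have : (\int[lam]_(u in coord c @` B) `|(density c u)%:E| = 0)%E.
  by rewrite -[RHS]I0; apply: eq_integral => u _; rewrite gee0_abs// lee_fin sqrtr_ge0.
move=> /(ae_eq_integral_abs _ mI md)[N [mN N0 hN]].
apply: (subset_measure0 mI mN) => // u cu.
apply: hN => /(_ cu)/eqP; rewrite eqe => /eqP d0.
suff : 0 < density c u by rewrite d0 ltxx.
by apply: density_gt0; case: cu => x Bx <-; exists x => //; exact: Bc.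
Qed.

Lemma volume_negligible_chart c B : B `<=` dom c ->
  mu.-negligible B <-> lam.-negligible (coord c @` B : set (borel 'rV[R]_n)).
Proof.
move=> Bc; split=> [[N [mN N0 BN]]|[N [mN N0 BN]]].
  have mNc : measurable (N `&` dom c : set (borel M)).
    by apply: measurableI => //; apply: open_borel; exact: dom_open.
  exists (coord c @` (N `&` dom c)); split.
  - by apply: chart_image_borel => // x [].
  - have sub : N `&` dom c `<=` dom c by move=> x [].
    apply/(volume_null_chart mNc sub).
    by apply: (subset_measure0 mNc mN) => // x [].
  - by move=> _ [x Bx <-]; exists x => //; split; [exact: BN|exact: Bc].
pose N' : set (borel M) := dom c `&` coord c @^-1` N.
have mN' : measurable N'.
  apply: (@continuous_on_borel M 'rV[R]_n (dom c) (coord c)) => //.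
  - exact: dom_open.
  - exact: coord_continuous.
  - by apply: open_borel; exact: dom_open.
exists N'; split=> //; last by move=> x Bx; split; [exact: Bc|apply: BN; exists x].
have sub : N' `<=` dom c by move=> x [].
apply/(volume_null_chart mN' sub).
apply: (subset_measure0 _ mN) => //; first by apply: chart_image_borel => // x [].
by move=> _ [x [_ Nx] <-].
Qed.

(** A countable cover by open sets, each inside one chart and mapped into one chart, reduces the
    claim to [C1_negligible]. *)
Lemma smooth_map_negligible (phi : M -> M) B : smooth_map A phi ->
  mu.-negligible B -> mu.-negligible (phi @` B : set (borel M)).
Proof.
move=> [cphi sphi] B0.
pose P (U : set M) := exists c c' : chart A, U `<=` dom c `&` phi @^-1` dom c'.
have [||U [hU UT]] := @second_countable_cover M P (manifold_second_countable A).
- by move=> U V UV [c [c' Vc]]; exists c, c' => x /UV /Vc.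
- move=> x; have [c cx] := dom_cover A x; have [c' c'x] := dom_cover A (phi x).
  exists (dom c `&` phi @^-1` dom c'); split=> //; last by exists c, c'.
  by apply: openI; [exact: dom_open|apply: open_comp => //; exact: dom_open].
have -> : phi @` B = \bigcup_k (phi @` (B `&` U k)).
  apply/seteqP; split=> [_ [x Bx <-]|_ [k _ [x [Bx _] <-]]]; last by exists x.
  have [k _ Ux] : (\bigcup_k U k) x by rewrite UT.
  by exists k => //; exists x.
apply: negligible_bigcup => k.
have [_ [c [c' Ucc]]] := hU k.
have BUc : B `&` U k `<=` dom c by move=> x [_ /Ucc[]].
have BUc' : phi @` (B `&` U k) `<=` dom c' by move=> _ [x [_ /Ucc[_ h]] <-].
apply/(volume_negligible_chart BUc').
have N0 : lam.-negligible (coord c @` (B `&` U k) : set (borel 'rV[R]_n)).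
  by apply/(volume_negligible_chart BUc); apply: negligibleS B0 => x [].
have oO : open (coord c @` (dom c `&` phi @^-1` dom c')).
  rewrite chart_imageE => [|x []//].
  apply: open_setI_preimage; first exact: coord_open.
    apply: openI; first exact: dom_open.
    by apply: open_comp => //; exact: dom_open.
  by move=> _ [x cx <-]; exact: param_continuous.
have sub : coord c @` (B `&` U k) `<=` coord c @` (dom c `&` phi @^-1` dom c').
  by move=> _ [x [_ /Ucc h] <-]; exists x.
have := C1_negligible oO (sphi c c' 1%N) sub N0.
apply: negligibleS => _ [_ [x BUx <-] <-]; exists (coord c x); first by exists x.
by rewrite /= coordK//; exact: BUc.
Qed.

(** The continuous density is bounded on small balls of a chart, and these have finite Lebesgue
    measure. *)
Lemma volume_sigma_finite : sigma_finite setT mu.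
Proof.
(* The condition has to pass to arbitrary subsets, hence the measurable superset [V]. *)
pose P (U : set M) := exists V : set (borel M), [/\ measurable V, U `<=` V & (mu V < +oo)%E].
have [||U [hU UT]] := @second_countable_cover M P (manifold_second_countable A).
- by move=> U V UV [W [mW VW fW]]; exists W; split=> // x /UV /VW.
- move=> x; have [c cx] := dom_cover A x.
  have cu : (coord c @` dom c) (coord c x) by exists x.
  have nd : \forall u \near coord c x, (coord c @` dom c) u /\ density c u < density c (coord c x) + 1.
    apply: filterI; first by apply: open_nbhs_nbhs; split=> //; exact: coord_open.
    have /cvgrPdist_lt/(_ 1 ltr01) := density_continuous cu.
    by apply: filterS => u; rewrite ltr_norml => /andP[h1 h2]; move: h1; lra.
  have /nbhs_ballP[r /= r0 hr] := nd.
  pose V : set M := dom c `&` coord c @^-1` ball (coord c x) r.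
  have oV : open V.
    apply: open_setI_preimage; [exact: dom_open|exact: ball_open|exact: coord_continuous].
  have mV := open_borel oV; have Vc : V `<=` dom c by move=> y [].
  exists V; split=> //; first by split=> //; exact: ballxx.
  exists V; split=> //; rewrite (volume_chart mV Vc).
  have mI := chart_image_borel mV Vc.
  apply: (@le_lt_trans _ _ (\int[lam]_(u in coord c @` V) (density c (coord c x) + 1)%:E)%E).
    apply: ge0_le_integral => //.
    - by move=> u _; rewrite lee_fin sqrtr_ge0.
    - exact: density_measurable.
    - by move=> _ [y [_ yr] <-]; rewrite lee_fin ltW//; have [] := hr _ yr.
  rewrite integral_cst//; apply: lte_mul_pinfty => //.
    by rewrite lee_fin addr_ge0// sqrtr_ge0.
  apply: le_lt_trans (lebesgue_rV_ball_fin (coord c x) r0).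
  apply: le_measure; rewrite ?inE//; first by apply: open_borel; exact: ball_open.
  by move=> _ [y [_ yr] <-].
exists U; first by rewrite UT.
move=> k; have [oU [V [mV UV fV]]] := hU k; have mU := open_borel oU; split=> //.
by apply: le_lt_trans fV; apply: le_measure; rewrite ?inE.
Qed.

End volume_measure.

(** * Radon-Nikodym derivatives *)

Section density.
Context {d : measure_display} {T : measurableType d} {R : realType}.
Variables (mu nu : {measure set T -> \bar R}) (r : T -> R).
Hypotheses (mr : measurable_fun setT r) (r0 : forall x, 0 <= r x).
Hypothesis nuE : forall B, measurable B -> nu B = (\int[mu]_(x in B) (r x)%:E)%E.

Import HBNNSimple.

Let density_nnsfun (h : {nnsfun T >-> R}) :
  (\int[nu]_x (h x)%:E = \int[mu]_x ((h x)%:E * (r x)%:E))%E.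
Proof.
have mh k : measurable (h @^-1` [set k]) by exact: measurable_sfunP.
have hE x : ((h x)%:E = \sum_(k \in range h) (k * \1_(h @^-1` [set k]) x)%:E)%E.
  by rewrite {1}fimfunE fsumEFin.
transitivity (\sum_(k \in range h) k%:E * \int[mu]_(x in h @^-1` [set k]) (r x)%:E)%E.
  under eq_integral do rewrite hE.
  rewrite ge0_integral_fsum//; last 2 first.
  - by move=> k; apply/measurable_EFinP; apply: measurable_funM => //; exact: measurable_indic.
  - by move=> k x _; rewrite EFinM nnfun_muleindic_ge0.
  apply: eq_fsbigr => k _; rewrite integralZl_indic_nnsfun// integral_indic// setIT.
  by rewrite nuE.
transitivity (\sum_(k \in range h) \int[mu]_x ((k * \1_(h @^-1` [set k]) x)%:E * (r x)%:E))%E.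
  apply: eq_fsbigr => k /set_mem[t _ <-].
  rewrite integral_mkcond -ge0_integralZl//; last 3 first.
  - by apply/(measurable_restrictT _ (mh _))/measurable_EFinP; exact: measurable_funS mr.
  - by move=> x _; rewrite /patch; case: ifP => // _; rewrite lee_fin.
  - by rewrite lee_fin.
  apply: eq_integral => x _; rewrite /patch indicE; case: ifP => _.
    by rewrite mulr1.
  by rewrite mule0 mulr0 mul0e.
rewrite -ge0_integral_fsum//; last 2 first.
- move=> k; apply: emeasurable_funM; apply/measurable_EFinP => //.
  by apply: measurable_funM => //; exact: measurable_indic.
- by move=> k x _; rewrite mule_ge0 ?lee_fin// -lee_fin EFinM nnfun_muleindic_ge0.
apply: eq_integral => x _; rewrite -ge0_mule_fsuml; first by rewrite -hE.
by move=> k; rewrite EFinM nnfun_muleindic_ge0.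
Qed.

Lemma ge0_integral_density (g : T -> \bar R) : measurable_fun setT g ->
  (forall x, 0 <= g x)%E -> (\int[nu]_x g x = \int[mu]_x (g x * (r x)%:E))%E.
Proof.
move=> mg g0; pose h := nnsfun_approx measurableT mg.
have nd x m n : (m <= n)%N -> ((h m x)%:E <= (h n x)%:E)%E.
  by move=> mn; rewrite lee_fin; exact/lefP/nd_nnsfun_approx.
have cg x : (fun n => (h n x)%:E) @ \oo --> g x.
  by apply: (@cvg_nnsfun_approx _ _ _ _ measurableT _ mg) => // y _; exact: g0.
transitivity (limn (fun n => \int[nu]_x (h n x)%:E))%E.
  rewrite -monotone_convergence//.
  - by apply: eq_integral => x _; apply/esym/cvg_lim.
  - by move=> n; exact/measurable_EFinP/measurable_funP.
  - by move=> n x _; rewrite lee_fin.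
  - by move=> x _ m n mn; exact: nd.
under eq_fun do rewrite density_nnsfun.
rewrite -monotone_convergence//.
- apply: eq_integral => x _; apply/cvg_lim => //.
  by apply: cvgeMr => //; exact: cg.
- by move=> n; apply: emeasurable_funM; apply/measurable_EFinP => //; exact: measurable_funP.
- by move=> n x _; rewrite mule_ge0 ?lee_fin.
- by move=> x _ m n mn; rewrite lee_wpmul2r ?lee_fin// -lee_fin; exact: nd.
Qed.

(** Multiplication by the nonnegative [r] commutes with positive and negative parts, so the two
    terms of the difference defining the integral agree separately. *)
Lemma integral_density (g : T -> R) : measurable_fun setT g ->
  (\int[nu]_x (g x)%:E = \int[mu]_x (g x * r x)%:E)%E.
Proof.
move=> mg; rewrite integralE [RHS]integralE; congr (_ - _)%E.
  rewrite ge0_integral_density//; last exact/measurable_funepos/measurable_EFinP.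
  apply: eq_integral => x _; rewrite !funeposE /=.
  by rewrite -(EFin_max _ 0) -(EFin_max (g x * r x) 0) -EFinM maxr_pMl// mul0r.
rewrite ge0_integral_density//; last exact/measurable_funeneg/measurable_EFinP.
apply: eq_integral => x _; rewrite !funenegE /=.
rewrite -(EFin_max (- g x) 0) -(EFin_max (- (g x * r x)) 0) -EFinM maxr_pMl// mul0r.
by rewrite mulNr.
Qed.

End density.

(** The space is cut into disjoint sets [D k] of finite [nu]-measure; on each of them the density of
    the finite measure [nu] restricted to [D k] is used. *)
Lemma radon_nikodym_density d (T : measurableType d) (R : realType)
    (mu nu : {measure set T -> \bar R}) :
  sigma_finite setT mu -> sigma_finite setT nu ->
  (forall B, measurable B -> mu B = 0%E -> nu B = 0%E) ->
  exists r : T -> R, [/\ measurable_fun setT r, forall x, 0 <= r x &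
    forall B, measurable B -> nu B = (\int[mu]_(x in B) (r x)%:E)%E].
Proof.
move=> smu [F FT hF] dom.
(* The pushforward along [id] is a copy of [mu] that [HB.pack] can extend. *)
pose m0 : {measure set T -> \bar R} :=
  measure_function_pushforward__canonical__measure_function_Measure mu
    (@measurable_id _ T setT).
pose msf := Measure_isSigmaFinite.Build _ _ R m0 smu.
pose mu' : {sigma_finite_measure set T -> \bar R} := HB.pack (Measure.sort m0) msf.
pose D := seqDU F.
have mD k : measurable (D k).
  by apply: measurableD; [exact: (hF k).1|apply: bigsetU_measurable => i _; exact: (hF i).1].
have tD : trivIset setT D by exact: trivIset_seqDU.
have DT : \bigcup_k D k = setT by rewrite -seqDU_bigcup_eq -FT.
have fD k : (nu (D k) < +oo)%E.
  apply: le_lt_trans (hF k).2; apply: le_measure; rewrite ?inE//; first exact: (hF k).1.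
  exact: subset_seqDU.
have /choice[f hf] : forall k, exists f : T -> \bar R, [/\ forall x, (0 <= f x)%E,
    forall x, f x \is a fin_num, mu.-integrable setT f &
    forall B, measurable B -> nu (B `&` D k) = (\int[mu]_(x in B) f x)%E].
  move=> k; pose nuk : {finite_measure set T -> \bar R} := mfrestr (mD k) (fD k).
  have domk : nuk `<< mu'.
    apply/null_content_dominatesP => B mB B0.
    rewrite /nuk /= /mfrestr /mrestr; apply: dom; first exact: measurableI.
    by apply: (subset_measure0 _ mB) => //; exact: measurableI.
  have [f [f0 ff fi fE]] := radon_nikodym_sigma_finite domk.
  by exists f; split.
pose rr x := (\sum_(0 <= k <oo) (f k \_ (D k)) x)%E.
have f0 k x : (0 <= (f k \_ (D k)) x)%E.
  by rewrite /patch; case: ifP => // _; have [] := hf k.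
have mf k : measurable_fun setT (f k \_ (D k)).
  apply/(measurable_restrictT _ (mD k)).
  by have [_ _ /integrableP[mfk _] _] := hf k; exact: measurable_funS mfk.
(* At a point of [D k] all other terms of the series vanish, so its sum is finite. *)
have rrE k x : D k x -> rr x = f k x.
  move=> Dx; rewrite /rr (@nneseriesD1 _ (fun k => (f k \_ (D k)) x) k)// eseries0.
    by rewrite adde0 patchE mem_set.
  move=> i _ /= ik; rewrite patchE memNset// => Dix.
  by move/trivIsetP : tD => /(_ i k Logic.I Logic.I ik)/seteqP[+ _] => /(_ x); apply.
have rrfin x : rr x \is a fin_num.
  have [k _ Dx] : (\bigcup_k D k) x by rewrite DT.
  by rewrite (rrE k x Dx); have [] := hf k.
have mrr : measurable_fun setT rr by exact: ge0_emeasurable_sum.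
exists (fine \o rr); split.
- by apply: measurableT_comp => //; exact: measurable_fine.
- by move=> x; apply: fine_ge0; apply: nneseries_ge0 => k _ _; exact: f0.
move=> B mB; under eq_integral do rewrite fineK//.
rewrite integral_nneseries//; last by move=> k; exact: measurable_funS (mf k).
transitivity (\sum_(0 <= k <oo) nu (B `&` D k))%E.
  rewrite -measure_semi_bigcup.
  - by rewrite -setI_bigcupr DT setIT.
  - by move=> k; exact: measurableI.
  - exact: trivIset_setIl.
  - by rewrite -setI_bigcupr DT setIT.
apply: eq_eseriesr => k _; have [_ _ _ hk] := hf k.
rewrite -integral_mkcondr -hk; last exact: measurableI.
by rewrite -setIA setIid.
Qed.

(** * The adjoint of a bisection *)

Section square_integrable_sections.
Context {R : realType} {M : ptopologicalType}.
Variable mu : {measure set (borel M) -> \bar R}.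
Context {F : cfield R M}.
Implicit Types s t : section F.

Lemma rip_integrable s t : square_integrable mu s -> square_integrable mu t ->
  mu.-integrable setT (fun x : borel M => (rip (s x) (t x))%:E).
Proof.
move=> [ms fs] [mt ft].
have mr := (measurable_section_hip ms mt).1.
have m1 := measurable_section_sqr ms; have m2 := measurable_section_sqr mt.
apply/integrableP; split; first by apply/measurable_EFinP.
apply: (@le_lt_trans _ _ (\int[mu]_(x in [set: borel M])
  ((hnorm (s x) ^+ 2)%:E + (hnorm (t x) ^+ 2)%:E))%E).
  apply: ge0_le_integral => //.
  - by apply: measurableT_comp => //; apply/measurable_EFinP.
  - by apply/measurable_EFinP; exact: measurable_funD.
  - move=> x _; rewrite -EFinD abse_EFin lee_fin.
    apply: le_trans (norm_rip_le _ _) _.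
    by have := sqr_ge0 (hnorm (s x) - hnorm (t x)); nra.
rewrite ge0_integralD//.
- exact: lte_add_pinfty.
- by move=> x _; rewrite lee_fin sqr_ge0.
- by apply/measurable_EFinP.
- by move=> x _; rewrite lee_fin sqr_ge0.
- by apply/measurable_EFinP.
Qed.

Lemma square_integrableB s t : square_integrable mu s -> square_integrable mu t ->
  square_integrable mu (fun x => s x - t x).
Proof.
move=> [ms fs] [mt ft].
have mb : measurable_section (fun x => s x - t x).
  have mN : measurable_section (fun x => (-1 : R[i]) *: t x).
    by apply: (@measurable_sectionZ _ _ _ (fun=> -1)) => //; exact: cmeasurable_cst.
  rewrite (_ : (fun x => s x - t x) = (fun x => s x + (-1 : R[i]) *: t x)).
    exact: measurable_sectionD.
  by apply: functional_extensionality_dep => x; rewrite scaleN1r.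
split=> //.
have m1 := measurable_section_sqr ms; have m2 := measurable_section_sqr mt.
have m3 := measurable_section_sqr mb.
apply: (@le_lt_trans _ _ (\int[mu]_(x in [set: borel M])
  (2%:E * ((hnorm (s x) ^+ 2)%:E + (hnorm (t x) ^+ 2)%:E)))%E).
  apply: ge0_le_integral => //.
  - by move=> x _; rewrite lee_fin sqr_ge0.
  - by apply/measurable_EFinP.
  - by apply/measurable_EFinP; apply: measurable_funM => //; exact: measurable_funD.
  - move=> x _; rewrite -EFinD -EFinM lee_fin.
    have := hnormB (s x) (t x); have := hnorm_ge0 (s x - t x).
    have := sqr_ge0 (hnorm (s x) - hnorm (t x)); nra.
rewrite ge0_integralZl//.
- rewrite ge0_integralD//.
  + by apply: lte_mul_pinfty => //; exact: lte_add_pinfty.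
  + by move=> x _; rewrite lee_fin sqr_ge0.
  + by apply/measurable_EFinP.
  + by move=> x _; rewrite lee_fin sqr_ge0.
  + by apply/measurable_EFinP.
- by apply/measurable_EFinP; exact: measurable_funD.
- by move=> x _; rewrite -EFinD lee_fin addr_ge0// sqr_ge0.
Qed.

(** Testing against [s - t] itself shows that its squared norm has integral 0. This determines the
    value chosen by [dint_adj] up to a null set. *)
Lemma dint_ip_unique s t : square_integrable mu s -> square_integrable mu t ->
  (forall Xi, square_integrable mu Xi -> dint_ip mu Xi s = dint_ip mu Xi t) ->
  {ae mu, forall x : borel M, s x = t x}.
Proof.
move=> ss st h; pose D : section F := fun x => s x - t x.
have sD : square_integrable mu D by exact: square_integrableB.
have iDs := rip_integrable sD ss; have iDt := rip_integrable sD st.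
have D0 : (\int[mu]_(x in [set: borel M]) (hnorm (D x) ^+ 2)%:E = 0)%E.
  have -> : (\int[mu]_(x in [set: borel M]) (hnorm (D x) ^+ 2)%:E =
      \int[mu]_(x in [set: borel M]) ((rip (D x) (s x))%:E - (rip (D x) (t x))%:E))%E.
    by apply: eq_integral => x _; rewrite -EFinB hnorm_sqr /D hipBr cReD cReN.
  rewrite integralB//.
  have := congr1 (@complex.Re R) (h D sD); rewrite /dint_ip /cintegral /= => e.
  rewrite -(fineK (integrable_fin_num measurableT iDs)).
  rewrite -(fineK (integrable_fin_num measurableT iDt)).
  by rewrite -EFinB e subrr.
have mD : measurable_fun setT (fun x : borel M => (hnorm (D x) ^+ 2)%:E).
  by apply/measurable_EFinP; apply: measurable_section_sqr; case: sD.
have : (\int[mu]_(x in [set: borel M]) `|(hnorm (D x) ^+ 2)%:E| = 0)%E.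
  by rewrite -[RHS]D0; apply: eq_integral => x _; rewrite gee0_abs// lee_fin sqr_ge0.
move=> /(ae_eq_integral_abs _ measurableT mD).
apply: filterS => x /(_ Logic.I) /eqP; rewrite eqe sqrf_eq0 => /eqP /hnorm_eq0 /eqP.
by rewrite subr_eq0 => /eqP.
Qed.

End square_integrable_sections.

Section bisection_volume.
Context {R : realType} {n : nat} {M : ptopologicalType}.
Context {A : oriented_manifold R n M} {S : spacetime A}.
Variable mu : {measure set (borel M) -> \bar R}.
Hypothesis hmu : is_volume_measure S mu.
Variable b : bisection S.

(** The new exceptional points are images under [bis_map b] of the old ones, and a smooth map
    preserves null sets. *)
Lemma ae_bis_inv (P : M -> Prop) : {ae mu, forall y : borel M, P y} ->
  {ae mu, forall x : borel M, P (bis_inv b x)}.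
Proof.
move=> h; apply: negligibleS (smooth_map_negligible hmu (bis_map_smooth b) h) => x nP.
by exists (bis_inv b x) => //; exact: bis_invK.
Qed.

Let phi : borel M -> borel M := bis_map b.
Let psi : borel M -> borel M := bis_inv b.

Definition bis_density : borel M -> R := RN_derivative mu (pushforward mu phi).

Let nu : {measure set (borel M) -> \bar R} :=
  measure_function_pushforward__canonical__measure_function_Measure mu (bis_map_borel b).

(** [RN_derivative] is a choice, so a density has to exist. The preimage of a null set under
    [bis_map b] lies in its image under the smooth [bis_inv b], hence is null. *)
Lemma bis_densityP : [/\ measurable_fun setT bis_density, forall x, 0 <= bis_density x
  & forall B, measurable B ->
      pushforward mu phi B = (\int[mu]_(x in B) (bis_density x)%:E)%E].
Proof.
have smu := volume_sigma_finite hmu.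
have snu : sigma_finite setT nu.
  case: smu => K KT hK; exists (fun k => psi @^-1` K k).
    by rewrite -preimage_bigcup -KT preimage_setT.
  move=> k; have [mK fK] := hK k; split.
    by rewrite -[X in measurable X]setTI; apply: bis_inv_borel.
  rewrite /nu /= /pushforward (_ : phi @^-1` _ = K k)//.
  by apply/seteqP; split=> x /=; rewrite /psi /phi bis_mapK.
have dom B : measurable B -> mu B = 0%E -> nu B = 0%E.
  move=> mB B0; have nB : mu.-negligible B by exists B; split.
  have nB' : mu.-negligible (phi @^-1` B).
    apply: negligibleS (smooth_map_negligible hmu (bis_inv_smooth b) nB) => y By.
    by exists (phi y) => //; exact: bis_mapK.
  have mB' : measurable (phi @^-1` B).
    by rewrite -[X in measurable X]setTI; apply: bis_map_borel.
  exact: (measure_negligible mB' nB').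
have [r hr] := radon_nikodym_density smu snu dom.
by rewrite /bis_density /RN_derivative; case: xgetP => [f _ []|nf] //; case: (nf r).
Qed.

Lemma integral_bis_map (g : borel M -> R) : measurable_fun setT g ->
  (\int[mu]_y (g (bis_map b y))%:E = \int[mu]_x (g x * bis_density x)%:E)%E.
Proof.
move=> mg; have [mr r0 nuE] := bis_densityP.
rewrite -(@integral_density _ _ _ mu nu)//.
rewrite (@iso_integral _ _ (borel M) (borel M) R phi psi _ _ _ _ mu nu)//.
- exact: bis_mapK.
- exact: bis_invK.
- exact: bis_map_borel.
- exact: bis_inv_borel.
Qed.

(** The preimage of the zero set [Z] under [bis_map b] has as measure the integral of the density
    over [Z], that is 0; the smooth [bis_map b] carries this null set onto [Z]. *)
Lemma bis_density_gt0 : {ae mu, forall x : borel M, 0 < bis_density x}.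
Proof.
have [mr r0 nuE] := bis_densityP.
pose Z := [set x : borel M | bis_density x = 0].
have mZ : measurable Z.
  by rewrite -[Z]setTI; exact: (mr measurableT [set 0] (measurable_set1 0)).
have nZ : mu.-negligible (phi @^-1` Z).
  exists (phi @^-1` Z); split=> //.
    by rewrite -[X in measurable X]setTI; apply: bis_map_borel.
  rewrite -[mu _]/(pushforward mu phi Z) nuE//.
  by rewrite -(@integral0 _ _ _ mu Z); apply: eq_integral => x /set_mem ->.
apply: negligibleS (smooth_map_negligible hmu (bis_map_smooth b) nZ) => x /= rx.
exists (psi x); last exact: bis_invK.
rewrite /Z /= /phi /psi bis_invK; apply/eqP; move: rx; have := r0 x.
by rewrite le_eqVlt eq_sym => /orP[->|].
Qed.

Section bisection_adjoint.
Variable Sys : qsystem S.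
Implicit Types Psi Xi : section Sys.
Let V := sys_rep (q := Sys).
Let rV : unitary_rep V := sys_unitary Sys.

(** Where the density vanishes, the inverse of its square root is 0 by convention. *)
Definition bis_adj Psi : section Sys := fun y =>
  Complex (Num.sqrt (bis_density (bis_map b y)))^-1 0 *: bis_pull b V Psi y.

Lemma bis_adj_inv Psi x : bis_adj Psi (bis_inv b x) =
  Complex (Num.sqrt (bis_density x))^-1 0 *: adj (V (bis_to b x)) (Psi x).
Proof. by rewrite /bis_adj bis_pull_inv bis_invK. Qed.

Lemma measurable_bis_density_sqrtV :
  measurable_fun setT (fun x => (Num.sqrt (bis_density x))^-1).
Proof.
have [mr r0 _] := bis_densityP.
rewrite (_ : (fun x => _) = (@powR R)^~ (- 2^-1) \o bis_density).
  by apply: measurableT_comp => //; exact: measurable_powR.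
by apply/funext => x /=; rewrite powRN powR12_sqrt.
Qed.

Lemma bis_adj_square_integrable Psi : square_integrable mu Psi ->
  square_integrable mu (bis_adj Psi).
Proof.
move=> [mP fP]; have [mr r0 _] := bis_densityP; have mV := measurable_bis_density_sqrtV.
split.
  apply: (@measurable_sectionZ _ _ _
      (fun y => Complex (Num.sqrt (bis_density (bis_map b y)))^-1 0)).
    split=> /=; last exact: measurable_cst.
    exact: measurableT_comp mV (bis_map_borel b).
  exact: bis_pull_measurable_section.
have m1 := measurable_section_sqr mP.
apply: le_lt_trans fP.
pose g (x : borel M) := (Num.sqrt (bis_density x))^-1 ^+ 2 * hnorm (Psi x) ^+ 2.
have mg : measurable_fun setT g.
  by apply: measurable_funM => //; apply: measurable_funX.
rewrite [leLHS](_ : _ = \int[mu]_y (g (bis_map b y))%:E)%E; last first.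
  apply: eq_integral => y _; rewrite /g /bis_adj hnormZ exprMn hnorm_bis_pull//.
  by rewrite /csq /= expr0n addr0 sqrtr_sqr -normrX ger0_norm// sqr_ge0.
rewrite integral_bis_map//.
apply: ge0_le_integral => //.
- by move=> x _; rewrite lee_fin mulr_ge0// mulr_ge0// sqr_ge0.
- by apply/measurable_EFinP; exact: measurable_funM.
- by apply/measurable_EFinP.
(* An equality where the density is nonzero; at its zeros the left side is 0. *)
- move=> x _; rewrite lee_fin /g exprVn sqr_sqrtr// mulrAC.
  rewrite ler_piMl ?sqr_ge0//.
  by have [->|rx] := eqVneq (bis_density x) 0; rewrite ?mulr0// mulVf.
Qed.

(** Passing from an integral over [y] to one over its image brings in the density [r], and
    [r^(-1/2) r] is [r^(1/2)], also at the zeros of [r]. *)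
Lemma dint_ip_bis_adj Psi Xi : square_integrable mu Psi -> square_integrable mu Xi ->
  dint_ip mu (bisection_op mu b Xi) Psi = dint_ip mu Xi (bis_adj Psi).
Proof.
move=> [mP _] [mX _]; have [mr r0 _] := bis_densityP; have mV := measurable_bis_density_sqrtV.
have [mh1 mh2] := measurable_section_hip (bis_push_measurable b rV mX) mP.
(* [p] stands for the real and for the imaginary part. *)
have key (p : R[i] -> R) : (forall (a : R) z, p (Complex a 0 * z) = a * p z) ->
    measurable_fun setT (fun x : borel M => p (hip (bis_push b V Xi x) (Psi x))) ->
    (\int[mu]_(x in [set: borel M]) (p (hip (bisection_op mu b Xi x) (Psi x)))%:E =
     \int[mu]_(x in [set: borel M]) (p (hip (Xi x) (bis_adj Psi x)))%:E)%E.
  move=> pM mp; pose g (x : borel M) := (Num.sqrt (bis_density x))^-1 *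
    p (hip (bis_push b V Xi x) (Psi x)).
  have -> : (\int[mu]_(x in [set: borel M]) (p (hip (Xi x) (bis_adj Psi x)))%:E =
      \int[mu]_y (g (bis_map b y))%:E)%E.
    apply: eq_integral => y _; rewrite /g /bis_adj hipZr pM bis_push_map.
    by rewrite (adjP (unitary_bounded (rep_unitary rV _))).
  rewrite integral_bis_map; last exact: measurable_funM.
  apply: eq_integral => x _; congr (_%:E).
  rewrite [bisection_op _ _ _ _](_ : _ =
      Complex (Num.sqrt (bis_density x)) 0 *: bis_push b V Xi x)// hipZl.
  have -> : (Complex (Num.sqrt (bis_density x)) 0)^* =
      Complex (Num.sqrt (bis_density x)) 0 :> R[i].
    by apply: complex_eq; rewrite ?cReC ?cImC //= oppr0.
  rewrite pM /g; have [r00|rx] := eqVneq (bis_density x) 0.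
    by rewrite r00 sqrtr0 mul0r mulr0.
  have s0 : Num.sqrt (bis_density x) != 0 by rewrite sqrtr_eq0 -ltNge lt_neqAle eq_sym rx r0.
  by rewrite -[X in _ = _ * X](sqr_sqrtr (r0 x)); field.
rewrite /dint_ip /cintegral; congr (Complex (fine _) (fine _)).
- by apply: key => // a z; rewrite cReM /= mul0r subr0.
- by apply: key => // a z; rewrite cImM /= mul0r addr0.
Qed.

(** [bis_adj Psi] shows that the choice in [dint_adj] succeeds; the section chosen agrees with it
    almost everywhere by [dint_ip_unique]. *)
Lemma dint_adj_bisection_op Psi : square_integrable mu Psi ->
  {ae mu, forall y : borel M, dint_adj mu (bisection_op mu b) Psi y = bis_adj Psi y}.
Proof.
move=> sP; have sA := bis_adj_square_integrable sP.
rewrite /dint_adj; case: xgetP => [Chi _ [sC hC]|nC]; last first.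
  by case: (nC (bis_adj Psi)); split=> // Xi sX; exact: dint_ip_bis_adj.
by apply: dint_ip_unique => // Xi sX; rewrite -hC// dint_ip_bis_adj.
Qed.

End bisection_adjoint.

Lemma bisection_state_field (Fr : qframe S mu) (omega : opfield Fr) :
  state_field mu omega -> state_field mu (bisection_state b omega).
Proof.
move=> [[bw mw [c hc]] dw]; have rU := frame_unitary Fr.
have uU x := rep_unitary rU (bis_to b x); have uA x := adj_unitary (uU x).
split; first split.
- move=> x; apply: bounded_comp (unitary_bounded (uA x)).
  exact: bounded_comp (unitary_bounded (uU x)) (bw _).
- exact: conj_opfield_measurable.
- exists c; move: (ae_bis_inv hc); apply: filterS => x h v.
  by rewrite /= (unitary_hnorm (uU x)) (le_trans (h _))// (unitary_hnorm (uA x)).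
- move: (ae_bis_inv dw); apply: filterS => x [tw pw tr1]; split.
  + apply: trace_class_compr; first exact: unitary_bounded (uA x).
    by apply: trace_class_compl => //; exact: unitary_bounded (uU x).
  + by move=> u; rewrite /= (hip_unitary (uU x)).
  + by rewrite [LHS]tr_unitary//; exact: trace_class_expansion.
Qed.

Lemma bisection_op_relational_field (Sys : qsystem S) (Fr : qframe S mu)
    (phi0 : opfield Sys) (omega : opfield Fr) (Psi : section Sys) :
  (forall x, bounded_op (phi0 x)) -> {ae mu, forall x : borel M, trace_class (omega x)} ->
  square_integrable mu Psi ->
  {ae mu, forall x : borel M,
    bisection_op mu b
      (dint_act (relational_field phi0 omega) (dint_adj mu (bisection_op mu b) Psi)) x =
    dint_act (relational_field phi0 (bisection_state b omega)) Psi x}.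
Proof.
move=> bphi tw sP; have [_ r0 _] := bis_densityP.
(* The state and the adjoint are evaluated at [bis_inv b x], the density at [x] itself. *)
move: (ae_bis_inv tw) (ae_bis_inv (dint_adj_bisection_op sP)) bis_density_gt0.
apply: filterS3 => x tx ax rx.
rewrite /dint_act (@relational_field_transport _ _ _ _ _ _ _ _ phi0 omega
  (bisection_state b omega) _ _ (bis_to b x))//.
rewrite /bisection_op ax bis_adj_inv.
have lR := @relational_field_linear _ _ _ _ _ _ _ _ phi0 omega (bis_inv b x).
have lV := (bounded_opP (unitary_bounded (rep_unitary (sys_unitary Sys) (bis_to b x)))).1.
rewrite (linear_opZ lR) (linear_opZ lV) scalerA.
rewrite [X in X *: _](_ : _ = 1) ?scale1r//.
have s0 : Num.sqrt (bis_density x) != 0 by rewrite sqrtr_eq0 -ltNge.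
apply: complex_eq; rewrite ?cReM ?cImM /= ?mulr0 ?mul0r ?addr0 ?subr0//.
by rewrite mulfV.
Qed.

End bisection_volume.

(** The first part ensures that the relational field on the right is taken at a state field.
    Operators act on representatives of vectors of the direct integral, so their equality is
    agreement almost everywhere on each square-integrable [Psi]. *)
Theorem theorem6p14 (R : realType) (n : nat) (hn : (1 < n)%N)
    (M : ptopologicalType) (A : oriented_manifold R n M) (S : spacetime A)
    (mu : {measure set (borel M) -> \bar R}) (hmu : is_volume_measure S mu)
    (Sys : qsystem S) (Fr : qframe S mu)
    (phi : opfield Sys) (hphi : vn_field mu phi)
    (omega : opfield Fr) (homega : state_field mu omega)
    (b : bisection S) :
  state_field mu (bisection_state b omega) /\
  forall Psi : section Sys, square_integrable mu Psi ->
    {ae mu, forall x : borel M,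
      bisection_op mu b
        (dint_act (relational_field phi omega)
          (dint_adj mu (bisection_op mu b) Psi)) x =
      dint_act (relational_field phi (bisection_state b omega)) Psi x}.
Proof.
split; first exact: bisection_state_field.
have [bphi _ _] := hphi; have [_ dw] := homega => Psi sP.
apply: bisection_op_relational_field => //.
by apply: filterS dw => x [].
Qed.
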